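(* Let $d\ge1$, $\gamma>0$, $c>0$, $0<\nu<2$ and let $\varphi\in\mathcal S(\mathbb R^d)$ be a Schwartz function. The solution of the Cauchy problem $$\left(\frac{\partial^2}{\partial t^2}+\frac{d+2\gamma-1}{t}\frac{\partial}{\partial t}\right)u_\nu=-c^2(-\Delta)^{\nu/2}u_\nu,\qquad u_\nu(\mathbf x_d,0)=\varphi(\mathbf x_d),\qquad \left.\frac{\partial u_\nu(\mathbf x_d,t)}{\partial t}\right|_{t=0}=0,$$ is given, for $\mathbf x_d\in\mathbb R^d$ and $t>0$, by $$u_\nu(\mathbf x_d,t)=\int_{-ct}^{ct}g(w,t)\left(\frac{p_1^\nu(\mathbf x_d,w)+p_2^\nu(\mathbf x_d,w)}{2}\right)\mathrm dw,$$ where $$p_1^\nu(\mathbf x_d,w)=\frac1{(2\pi)^d}\int_{\mathbb R^d}e^{-i\langle\xi_d,\mathbf x_d\rangle}e^{i\|\xi_d\|^{\nu/2}w}\hat\varphi(\xi_d)\,\mathrm d\xi_d,\qquad p_2^\nu(\mathbf x_d,w)=\frac1{(2\pi)^d}\int_{\mathbb R^d}e^{-i\langle\xi_d,\mathbf x_d\rangle}e^{-i\|\xi_d\|^{\nu/2}w}\hat\varphi(\xi_d)\,\mathrm d\xi_d,$$ and $$g(w,t)=\frac{\Gamma(\gamma+\frac d2)}{\sqrt\pi\,\Gamma(\frac d2+\gamma-\frac12)\,ct}\left(1-\frac{w^2}{c^2t^2}\right)_+^{\frac d2+\gamma-\frac12-1}$$ is the (fundamental) solution of the one-dimensional Euler–Poisson–Darboux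 equation $\frac{\partial^2 g}{\partial t^2}+2\lambda(t)\frac{\partial g}{\partial t}=c^2\frac{\partial^2 g}{\partial w^2}$ with $\lambda(t)=\frac{\gamma+\frac d2-\frac12}{t}$.
   Context: Fourier transform convention: $\hat f(\xi_d)=\int_{\mathbb R^d}e^{i\langle\xi_d,\mathbf x_d\rangle}f(\mathbf x_d)\,\mathrm d\mathbf x_d$. The fractional Laplacian is the Fourier multiplier operator $(-\Delta)^{\nu/2}f(\mathbf x_d)=\frac1{(2\pi)^d}\int_{\mathbb R^d}e^{-i\langle\xi_d,\mathbf x_d\rangle}\|\xi_d\|^\nu\hat f(\xi_d)\,\mathrm d\xi_d$. The Cauchy problem is understood through the spatial Fourier transform: for each $\xi_d$, $\partial_t^2\hat u_\nu+\frac{d+2\gamma-1}{t}\partial_t\hat u_\nu=-c^2\|\xi_d\|^\nu\hat u_\nu$ for $t>0$, with $\hat u_\nu(\xi_d,0)=\hat\varphi(\xi_d)$ and $\partial_t\hat u_\nu(\xi_d,0)=0$. ''Fundamental solution'' of the one-dimensional Euler–Poisson–Darboux equation means the solution (in the sense of distributions in $w$) with initial datum $\delta(w)$ and zero initial velocity. $(x)_+=\max(0,x)$. *)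

(* Defs.v *)
From HB Require Import structures.
From mathcomp Require Import all_boot all_order all_algebra.
From mathcomp Require Import all_classical all_reals all_analysis.
From mathcomp Require Import complex.
Set Implicit Arguments.
Unset Strict Implicit.
Unset Printing Implicit Defensive.
Import Order.TTheory GRing.Theory Num.Theory.
Import numFieldNormedType.Exports.
Local Open Scope classical_set_scope.
Local Open Scope ring_scope.

(** The sigma-algebra of 'rV[R]_d is generated by the coordinates, hence it is
    the Borel one. *)

Definition rV_display : measure_display -> measure_display.
Proof. exact. Qed.

Section measurable_rV.
Context (R : realType) (d : nat).

Let coord (i : 'I_d) (x : 'rV[R]_d) : measurableTypeR R := x ord0 i.

Let rV_set0 : g_sigma_preimage coord set0.
Proof. exact: sigma_algebra0. Qed.

Let rV_setC A : g_sigma_preimage coord A -> g_sigma_preimage coord (~` A).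
Proof. exact: sigma_algebraC. Qed.

Let rV_bigcup (F : _^nat) : (forall i, g_sigma_preimage coord (F i)) ->
  g_sigma_preimage coord (\bigcup_i (F i)).
Proof. exact: sigma_algebra_bigcup. Qed.

HB.instance Definition _ := @isMeasurable.Build (rV_display default_measure_display)
  'rV[R]_d (g_sigma_preimage coord) rV_set0 rV_setC rV_bigcup.
End measurable_rV.

Section lebesgue_rV.
Context (R : realType).

Definition rV_cons d (p : measurableTypeR R * 'rV[R]_d) : 'rV[R]_d.+1 :=
  row_mx (p.1%:M : 'rV_1) p.2.

Lemma rV_cons0 d p : @rV_cons d p ord0 ord0 = p.1.
Proof.
rewrite (_ : ord0 = lshift d ord0 :> 'I_(1 + d)); last exact: val_inj.
by apply: etrans (row_mxEl _ _ _ _) _; rewrite mxE.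
Qed.

Lemma rV_consS d p j : @rV_cons d p ord0 (lift ord0 j) = p.2 ord0 j.
Proof.
rewrite (_ : lift ord0 j = rshift 1 j :> 'I_(1 + d)); last exact: val_inj.
exact: row_mxEr.
Qed.

Lemma measurable_coord d (i : 'I_d) :
  measurable_fun setT (fun x : 'rV[R]_d => x ord0 i : measurableTypeR R).
Proof.
move=> _ Y mY; rewrite setTI; apply: sub_sigma_algebra => /=.
rewrite -bigcup_seq/=; exists i => /=; first by rewrite mem_index_enum.
by exists Y => //; rewrite setTI.
Qed.

Lemma measurable_fun_rVP d0 (T : measurableType d0) d (f : T -> 'rV[R]_d) :
  (forall i, measurable_fun setT (fun t => f t ord0 i : measurableTypeR R)) ->
  measurable_fun setT f.
Proof.
move=> mf _ A mA; rewrite setTI.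
have : preimage_set_system [set: T] f
    (@g_sigma_preimage _ (measurableTypeR R) _ d (fun i (x : 'rV[R]_d) => x ord0 i))
    (f @^-1` A) by exists A => //; rewrite setTI.
rewrite -(@g_sigma_preimage_comp _ (measurableTypeR R) d 'rV[R]_d
  (fun i (x : 'rV[R]_d) => x ord0 i)).
apply: (@smallest_sub _ (sigma_algebra setT)).
  exact: sigma_algebra_measurable.
move=> B; rewrite -bigcup_seq/= => -[i _ [C mC <-]].
exact: mf.
Qed.

Lemma measurable_rV_cons d : measurable_fun setT (@rV_cons d).
Proof.
apply: measurable_fun_rVP => i; case: (unliftP ord0 i) => [j|] ->.
- rewrite (_ : (fun _ => _) = (fun x : 'rV[R]_d => x ord0 j) \o snd).
    by apply: measurableT_comp => //; exact: measurable_coord.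
  by apply/funext => p; rewrite rV_consS.
- rewrite (_ : (fun _ => _) = fst)//.
  by apply/funext => p; rewrite rV_cons0.
Qed.

Let rV_uncons d (x : 'rV[R]_d.+1) : measurableTypeR R * 'rV[R]_d :=
  (x ord0 ord0, \row_(i < d) x ord0 (lift ord0 i)).

Let rV_consK d : cancel (@rV_cons d) (@rV_uncons d).
Proof.
move=> [x y]; congr pair; first exact: rV_cons0.
by apply/rowP => i; rewrite mxE rV_consS.
Qed.

Let measurable_uncons d : measurable_fun setT (@rV_uncons d).
Proof.
apply: measurable_fun_pair; first exact: measurable_coord.
apply: measurable_fun_rVP => i; rewrite (_ : (fun _ => _) =
  (fun x : 'rV[R]_d.+1 => x ord0 (lift ord0 i))); first exact: measurable_coord.
by apply/funext => x; rewrite mxE.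
Qed.

Section step.
Context d (m : {sigma_finite_measure set 'rV[R]_d -> \bar R}).
Local Open Scope ereal_scope.

Definition lebesgue_rV_step : set 'rV[R]_d.+1 -> \bar R :=
  pushforward (@lebesgue_measure R \x m) (@rV_cons d).

Let pushm := measure_function_pushforward__canonical__measure_function_Measure
  (@lebesgue_measure R \x m) (@measurable_rV_cons d).

HB.instance Definition _ := isMeasure.Build _ _ _ lebesgue_rV_step
  (@measure0 _ _ _ pushm) (@measure_ge0 _ _ _ pushm)
  (@measure_semi_sigma_additive _ _ _ pushm).

Let step_sigma_finite : sigma_finite setT lebesgue_rV_step.
Proof.
have /sigma_finiteP[F [TF ndF Foo]] := sigma_finiteT (@lebesgue_measure R).
have /sigma_finiteP[G [TG ndG Goo]] := sigma_finiteT m.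
exists (fun n => @rV_uncons d @^-1` (F n `*` G n)).
  rewrite -preimage_bigcup (_ : \bigcup_i _ = setT) ?preimage_setT//.
  rewrite -setXTT TF TG predeqE => -[x y]; split.
    by move=> [n _ []/= ? ?]; split; exists n.
  move=> [/= [n _ Fnx] [k _ Gky]]; exists (maxn n k) => //; split.
  - by move: x Fnx; exact/subsetPset/ndF/leq_maxl.
  - by move: y Gky; exact/subsetPset/ndG/leq_maxr.
move=> n; have [mF Fn] := Foo n; have [mG Gn] := Goo n; split.
  rewrite -[X in measurable X]setTI; apply: measurable_uncons => //.
  exact: measurableX.
rewrite /lebesgue_rV_step/pushforward -comp_preimage (_ : _ \o _ = idfun).
  by rewrite product_measure1E// lte_mul_pinfty// ge0_fin_numE.
exact/funext/rV_consK.
Qed.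

HB.instance Definition _ := Measure_isSigmaFinite.Build _ _ _ lebesgue_rV_step
  step_sigma_finite.

End step.

Fixpoint lebesgue_rV d : {sigma_finite_measure set 'rV[R]_d -> \bar R} :=
  match d with
  | 0%N => @dirac _ 'rV[R]_0 0 R
  | d'.+1 => lebesgue_rV_step (lebesgue_rV d')
  end.

Lemma measurable_rV_box d (A : 'I_d -> set (measurableTypeR R)) :
  (forall i, measurable (A i)) ->
  measurable [set x : 'rV[R]_d | forall i, A i (x ord0 i)].
Proof.
move=> mA; rewrite (_ : mkset _ =
  \bigcap_(i in [set: 'I_d]) ((fun x : 'rV[R]_d => x ord0 i) @^-1` A i)).
  apply: fin_bigcap_measurable => // i _.
  by rewrite -[X in measurable X]setTI; exact: measurable_coord.
by apply/seteqP; split => [x h i _|x h i]; exact: h.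
Qed.

Lemma lebesgue_rV_box d (A : 'I_d -> set (measurableTypeR R)) :
  (forall i, measurable (A i)) ->
  (lebesgue_rV d [set x : 'rV[R]_d | forall i, A i (x ord0 i)] =
   \prod_(i < d) @lebesgue_measure R (A i))%E.
Proof.
elim: d A => [|d IH] A mA.
  by rewrite big_ord0 /= diracE mem_set// => -[m i]; have := i; rewrite ltn0.
have mB : measurable [set x : 'rV[R]_d | forall i, A (lift ord0 i) (x ord0 i)].
  by apply: (measurable_rV_box (A := fun i => A (lift ord0 i))).
rewrite big_ord_recl -(IH (fun i => A (lift ord0 i)))//.
rewrite -(product_measure1E _ _ (mA ord0) mB).
rewrite /= /lebesgue_rV_step /pushforward; congr (_ _).
apply/seteqP; split => [p h|p [hx hy] i] /=.
  by split => [|i] /=; [have := h ord0|have := h (lift ord0 i)];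
    rewrite ?rV_cons0 ?rV_consS.
by case: (unliftP ord0 i) => [j|] ->; rewrite ?rV_cons0 ?rV_consS//; exact: hy.
Qed.

End lebesgue_rV.

Local Open Scope complex_scope.

Local Notation re_fun f := (fun x => complex.Re (f x)).
Local Notation im_fun f := (fun x => complex.Im (f x)).

Section complex_calculus.
Context (R : realType).
Implicit Types (y : R -> R[i]).

Definition cis (theta : R) : R[i] := cos theta +i* sin theta.

Section integral.
Context d (T : measurableType d) (mu : {measure set T -> \bar R}).
Implicit Types (D : set T) (f : T -> R[i]).

Definition cintegrable D f : Prop :=
  mu.-integrable D (fun x => (complex.Re (f x))%:E) /\
  mu.-integrable D (fun x => (complex.Im (f x))%:E).

Definition cintegral D f : R[i] :=
  (\int[mu]_(x in D) complex.Re (f x)) +i* (\int[mu]_(x in D) complex.Im (f x)).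

End integral.

Definition cderivable y (t : R) : Prop :=
  derivable (re_fun y) t 1 /\ derivable (im_fun y) t 1.

Definition cderive y (t : R) : R[i] :=
  derive1 (re_fun y) t +i* derive1 (im_fun y) t.

Definition right_derivative0 (f : R -> R) (l : R) : Prop :=
  h^-1 * (f h - f 0) @[h --> 0^'+] --> l.

(** The initial value problem
      y'' + a(t) y' = - K y for t > 0,   y(0) = y0,   y'(0+) = 0,
    where a may be singular at t = 0. *)
Definition is_singular_ivp_solution (a : R -> R) (K : R) (y0 : R[i]) y : Prop :=
  [/\ forall t, 0 < t ->
        [/\ cderivable y t, cderivable (cderive y) t &
            cderive (cderive y) t + (a t)%:C * cderive y t = - K%:C * y t],
      y 0 = y0,
      right_derivative0 (re_fun y) 0 &
      right_derivative0 (im_fun y) 0].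

End complex_calculus.

Section euclidean_space.
Context (R : realType) (d : nat).
Implicit Types (x xi : 'rV[R]_d) (f F : 'rV[R]_d -> R[i]).

Definition dotr x xi : R := \sum_(i < d) x ord0 i * xi ord0 i.

(* The norm `|x| of the library on 'rV_d is the sup norm. *)
Definition enorm x : R := Num.sqrt (dotr x x).

Definition partials (s : seq 'I_d) (f : 'rV[R]_d -> R) : 'rV[R]_d -> R :=
  foldr (fun i g x => 'D_(delta_mx ord0 i) g x) f s.

Definition schwartz_real (f : 'rV[R]_d -> R) : Prop :=
  forall s : seq 'I_d,
    (forall x, differentiable (partials s f) x) /\
    (forall k : nat, exists C : R,
       forall x, enorm x ^+ k * `|partials s f x| <= C).

Definition schwartz f : Prop :=
  schwartz_real (re_fun f) /\ schwartz_real (im_fun f).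

Definition fourier f xi : R[i] :=
  cintegral (lebesgue_rV R d) setT (fun x => cis (dotr xi x) * f x).

Definition slowly_increasing_real (f : 'rV[R]_d -> R) : Prop :=
  continuous f /\
  exists (C : R) (k : nat), forall x, `|f x| <= C * (1 + enorm x) ^+ k.

Definition slowly_increasing f : Prop :=
  slowly_increasing_real (re_fun f) /\
  slowly_increasing_real (im_fun f).

(** F is the Fourier transform of f in the sense of tempered distributions: the
    integral defining [fourier f] need not converge for a bounded f. When f is
    integrable, this says that F = fourier f almost everywhere. *)
Definition is_fourier f F : Prop :=
  forall psi, schwartz psi ->
    [/\ cintegrable (lebesgue_rV R d) setT (fun x => f x * fourier psi x),
        cintegrable (lebesgue_rV R d) setT (fun xi => F xi * psi xi) &
        cintegral (lebesgue_rV R d) setT (fun x => f x * fourier psi x) =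
        cintegral (lebesgue_rV R d) setT (fun xi => F xi * psi xi)].

(** u is a solution of
      (d^2/dt^2 + (d + 2 gamma - 1)/t d/dt) u = - c^2 (-Delta)^(nu/2) u,
      u(x, 0) = phi(x),   (du/dt)(x, 0) = 0,
    read through the Fourier transform uhat of u in x, (-Delta)^(nu/2) being
    the Fourier multiplier of symbol |xi|^nu. The values u x t for t < 0 are
    irrelevant. *)
Definition is_cauchy_solution (gamma c nu : R) (phi : 'rV[R]_d -> R[i])
    (u : 'rV[R]_d -> R -> R[i]) : Prop :=
  [/\ forall x, u x 0 = phi x,
      forall t, 0 <= t -> slowly_increasing (u ^~ t) &
      exists uhat : 'rV[R]_d -> R -> R[i],
        (forall t, 0 <= t -> is_fourier (u ^~ t) (uhat ^~ t)) /\
        (forall xi,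
          is_singular_ivp_solution
            (fun t => (d%:R + 2 * gamma - 1) / t)
            (c ^+ 2 * enorm xi `^ nu) (fourier phi xi) (uhat xi))].

Definition p1 (nu : R) (phi : 'rV[R]_d -> R[i]) x (w : R) : R[i] :=
  (((2 * pi) ^+ d)^-1)%:C *
  cintegral (lebesgue_rV R d) setT
    (fun xi => cis (- dotr xi x) * cis (enorm xi `^ (nu / 2) * w) *
               fourier phi xi).

Definition p2 (nu : R) (phi : 'rV[R]_d -> R[i]) x (w : R) : R[i] :=
  (((2 * pi) ^+ d)^-1)%:C *
  cintegral (lebesgue_rV R d) setT
    (fun xi => cis (- dotr xi x) * cis (- (enorm xi `^ (nu / 2) * w)) *
               fourier phi xi).

End euclidean_space.

Section euler_poisson_darboux.
Context (R : realType).

Definition Gamma (s : R) : R :=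
  \int[lebesgue_measure]_(x in `]0, +oo[) (x `^ (s - 1) * expR (- x)).

(* (x)_+^a, vanishing for x <= 0 for every exponent a, whereas 0 `^ 0 = 1. *)
Definition pos_powR (x a : R) : R := if 0 < x then x `^ a else 0.

Definition epd_kernel (d : nat) (gamma c w t : R) : R :=
  Gamma (gamma + d%:R / 2) /
    (Num.sqrt pi * Gamma (d%:R / 2 + gamma - 2^-1) * (c * t)) *
  pos_powR (1 - w ^+ 2 / (c ^+ 2 * t ^+ 2)) (d%:R / 2 + gamma - 2^-1 - 1).

Definition test_function (psi : R -> R) : Prop :=
  (forall n x, derivable (derive1n n psi) x 1) /\
  exists M : R, forall x, M < `|x| -> psi x = 0.

Definition pairing (f psi : R -> R) : R := \int[lebesgue_measure]_w (f w * psi w).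

(** g is a solution of  g_tt + 2 lambda(t) g_t = c^2 g_ww  for t > 0, in the
    sense of distributions in w, with initial datum delta(w) and zero initial
    velocity. *)
Definition is_fundamental_solution (c : R) (lambda : R -> R) (g : R -> R -> R)
    : Prop :=
  (forall t, 0 < t -> locally_integrable setT (g ^~ t)) /\
  forall psi, test_function psi ->
    let G := fun t => pairing (g ^~ t) psi in
    [/\ forall t, 0 < t ->
          [/\ derivable G t 1, derivable (derive1 G) t 1 &
              derive1n 2 G t + 2 * lambda t * derive1 G t =
              c ^+ 2 * pairing (g ^~ t) (derive1n 2 psi)],
        G t @[t --> 0^'+] --> psi 0 &
        derive1 G t @[t --> 0^'+] --> 0].

End euler_poisson_darboux.

(* Main.v *)
(* On the Fourier side the problem decouples: for each xi the equation is a
   singular initial value problem for y'' + (2m/t) y' = - b^2 y with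
   m = d/2 + gamma - 1/2 and b = c |xi|^(nu/2). Its solution is y(0) times the
   average of cos (b t s) against the normalized weight (1 - s^2)_+^(m-1) on
   [-1, 1]: for any f, integrating the derivative of (1 - s^2)^m f (a t s) shows
   that the average of f (a t s) satisfies the Euler-Poisson-Darboux equation, and
   the total mass is computed by Tonelli's theorem from the Gamma function and the
   Gaussian integral. The same averages, with a test function for f, show that g
   is the fundamental solution. Uniqueness of y holds because the energy
   y'^2 + b^2 y^2 is nonincreasing and has limit 0 along a sequence tending to 0
   when y(0) = y'(0+) = 0. Since the transform of phi decays (by two applications
   of the product of the 1 - d_i^2), so does y, and Fourier inversion, proved for
   slowly increasing functions by pairing with modulated Gaussians, determines u;
   exchanging the integrals over s and xi gives the formula. *)
Require Import Defs.
From mathcomp Require Import all_boot all_order all_algebra.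
From mathcomp Require Import all_classical all_reals all_analysis.
From mathcomp Require Import complex.
From mathcomp Require Import measurable_realfun lebesgue_integral_under.
From mathcomp Require Import ring lra.
Set Implicit Arguments.
Unset Strict Implicit.
Unset Printing Implicit Defensive.
Import Order.TTheory GRing.Theory Num.Theory.
Import numFieldNormedType.Exports.
Local Open Scope classical_set_scope.
Local Open Scope ring_scope.

(** * Real integrals *)

(** For small [d] and [gamma] the exponent [m - 1] is negative and the kernel blows up at the ends
    of its support, so it is never differentiated in [t]. The substitution [w = c t s] fixes the
    weight and leaves [t] only inside the averaged function; each derivative then brings out a
    factor [s], and [(1 - s^2)^m] still vanishes at both ends because [m > 0]. In several variables,
    bounds are expressed with the product of the [1 / (1 + x_i^2)], which splits along coordinates
    and so passes through inductions on the dimension. Two powers of it are carried along: one makes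
    integrals converge, the other absorbs a coordinate [|x_i|] when a transform is compared at two
    points. A solution [u] is only known to be continuous with polynomial growth, so its transform
    is a distributional object. The differential equation fixes [uhat] at every frequency, hence
    gives it decay, and the continuity of [u] turns the distributional identity into a pointwise
    one. *)

Section real_integrable.
Context d (T : measurableType d) (R : realType) (mu : {measure set T -> \bar R}).
Implicit Types (f g : T -> R) (D : set T).

Lemma integrableZl_real D f r : measurable D -> mu.-integrable D (EFin \o f) ->
  mu.-integrable D (EFin \o (fun x => r * f x)).
Proof.
move=> mD /(integrableZl mD r); exact: eq_integrable.
Qed.

Lemma integrableB_real D f g : measurable D ->
  mu.-integrable D (EFin \o f) -> mu.-integrable D (EFin \o g) ->
  mu.-integrable D (EFin \o (fun x => f x - g x)).
Proof.
move=> mD fi gi; have := integrableB mD fi gi; exact: eq_integrable.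
Qed.

Lemma integrable_dominated D f g : measurable D -> measurable_fun D f ->
  (forall x, D x -> `|f x| <= g x) -> mu.-integrable D (EFin \o g) ->
  mu.-integrable D (EFin \o f).
Proof.
move=> mD mf fg gi; apply: le_integrable gi => //; first exact/measurable_EFinP.
by move=> x Dx; rewrite /= lee_fin (le_trans (fg x Dx))// ler_norm.
Qed.

End real_integrable.

Section derive_under_integral.
Context d (T : measurableType d) (R : realType) (mu : {measure set T -> \bar R}).

Lemma is_derive_Rintegral (f f' : R -> T -> R) (G : T -> R) :
  (forall x, mu.-integrable setT (EFin \o f x)) ->
  (forall (x : R) y, is_derive x 1 (f^~ y) (f' x y)) ->
  (forall x y, `|f' x y| <= G y) -> mu.-integrable setT (EFin \o G) ->
  forall x : R, is_derive x 1 (fun x => \int[mu]_y f x y) (\int[mu]_y f' x y).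
Proof.
move=> intf df f'G intG x.
(* [G] dominates for every parameter, so the radius 1 of this neighbourhood is arbitrary. *)
have xI : `]x - 1, x + 1[%classic x by rewrite /= in_itv/=; lra.
have intfI z : `]x - 1, x + 1[%classic z -> mu.-integrable setT (EFin \o f z) by [].
have derf z y : `]x - 1, x + 1[%classic z -> setT y -> derivable (f ^~ y) z 1.
  by move=> _ _; have [] := df z y.
have G0 y : 0 <= G y by apply: le_trans (f'G 0 y).
have dfE z y : partial1of2 f z y = f' z y.
  by rewrite partial1of2E; exact: derive_val.
have Gf z y : `]x - 1, x + 1[%classic z -> setT y -> `|partial1of2 f z y| <= G y.
  by move=> _ _; rewrite dfE.
apply: DeriveDef.
  exact: (derivable_under_integral measurableT xI intfI derf G0 intG Gf).
rewrite -derive1E (differentiation_under_integral measurableT xI intfI derf G0 intG Gf).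
by apply: eq_Rintegral => y _; exact: dfE.
Qed.

End derive_under_integral.

(** * Affine changes of variable on the line *)

Section affine.
Context (R : realType) (a b : R) (a_gt0 : 0 < a).
Notation mu := (@lebesgue_measure R).
Let phi (s : R) := a * s + b.

Let mphi : measurable_fun [set: measurableTypeR R] (phi : _ -> measurableTypeR R).
Proof. by apply: measurable_funD => //; exact: measurable_funM. Qed.

Let push := measure_function_pushforward__canonical__measure_function_Measure
  mu mphi.

(** By uniqueness of Lebesgue measure, it is enough to compare the rescaled image measure with it on
    half-open intervals. *)
Lemma lebesgue_measure_affine A : measurable A ->
  mu A = (a%:E * mu (phi @^-1` A))%E.
Proof.
apply: (lebesgue_measure_unique (mu := mscale (NngNum (ltW a_gt0)) push)).
move=> X [[l r] /= _ <-]; rewrite /mscale/=/pushforward.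
have -> : phi @^-1` `]l, r] = `](l - b) / a, (r - b) / a]%classic.
  apply/seteqP; split => x /=; rewrite !in_itv/= /phi ltr_pdivrMr// ler_pdivlMr//;
    by rewrite ltrBlDr lerBrDr mulrC.
rewrite !lebesgue_measure_itv/= !lte_fin ltr_pM2r ?invr_gt0// ltrD2r.
case: ifPn => _; last by rewrite mule0.
rewrite -!EFinD -EFinM; congr EFin; field; exact: lt0r_neq0.
Qed.

Lemma ge0_integral_affine (f : R -> \bar R) :
  measurable_fun [set: measurableTypeR R] f -> (forall x, 0 <= f x)%E ->
  (\int[mu]_s f (a * s + b)%R = (a^-1)%:E * \int[mu]_s f s)%E.
Proof.
move=> mf f0.
have -> : (\int[mu]_s f s = \int[mscale (NngNum (ltW a_gt0)) push]_s f s)%E.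
  by apply: eq_measure_integral => A mA _; exact: lebesgue_measure_affine.
rewrite ge0_integral_mscale// ge0_integral_pushforward//.
rewrite preimage_setT muleA -EFinM mulVf ?mul1e//; exact: lt0r_neq0.
Qed.

Lemma integrable_affine (f : R -> R) : mu.-integrable setT (EFin \o f) ->
  mu.-integrable setT (EFin \o (fun s => f (a * s + b))).
Proof.
move=> /integrableP[mf foo]; apply/integrableP; split.
  by apply: (measurableT_comp (f := EFin \o f)).
rewrite (ge0_integral_affine (f := fun s => `|(EFin \o f) s|%E))//.
  by rewrite lte_mul_pinfty// ?lee_fin ?invr_ge0// ltW.
exact: measurableT_comp.
Qed.

Lemma Rintegral_affine (f : R -> R) : mu.-integrable setT (EFin \o f) ->
  \int[mu]_s f (a * s + b) = a^-1 * \int[mu]_s f s.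
Proof.
move=> fi; rewrite /Rintegral.
have -> : (\int[mu]_s (f (a * s + b))%:E = a^-1%:E * \int[mu]_s (f s)%:E)%E.
  have mf := measurable_int _ fi.
  rewrite integralE [X in (_ * X)%E]integralE muleBr//; last first.
    exact: integrable_add_def.
  congr (_ - _)%E.
  - rewrite -(ge0_integral_affine (f := (EFin \o f)^\+%E))//.
      by apply: eq_integral => x _; rewrite !funeposE.
    exact: measurable_funepos.
  - rewrite -(ge0_integral_affine (f := (EFin \o f)^\-%E))//.
      by apply: eq_integral => x _; rewrite !funenegE.
    exact: measurable_funeneg.
by rewrite fineM//; exact: integrable_fin_num.
Qed.

End affine.

Lemma is_derive1_continuous (R : realType) (f : R -> R) (x df : R) :
  is_derive x 1 f df -> {for x, continuous f}.
Proof. by move=> [df' _]; apply/differentiable_continuous/derivable1_diffP. Qed.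

Lemma is_derive_powR_comp (R : realType) (f : R -> R) (s x df : R) :
  0 < f x -> is_derive x 1 f df ->
  is_derive x 1 (fun y => f y `^ s) (s * f x `^ (s - 1) * df).
Proof.
move=> fx0 dfx.
exact: (@is_derive1_comp _ (@powR R ^~ s) f x _ _ (is_derive1_powR s fx0) dfx).
Qed.

(** * The fundamental theorem of calculus on an open set exhausted by compact intervals *)

Section FTC_exhaustion.
Context (R : realType) (f F : R -> R) (D : set R) (a b : R^nat).
Notation mu := (@lebesgue_measure R).
Hypotheses (oD : open D)
  (ab : forall n, a n < b n)
  (abD : forall n x, x \in `[a n, b n] -> D x)
  (Dab : forall x, D x -> \forall n \near \oo, x \in `[a n, b n])
  (Ff : forall x : R, D x -> is_derive x 1 F (f x))
  (cf : forall x, D x -> {for x, continuous f}).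

Let FTC_ab n : (\int[mu]_(x in `[a n, b n]) (f x)%:E = (F (b n) - F (a n))%:E)%E.
Proof.
rewrite (@continuous_FTC2 _ f F)//.
- apply: continuous_in_subspaceT => x; rewrite inE/= => xab.
  by apply: cf; exact: abD xab.
- split.
  + by move=> x /subset_itv_oo_cc/abD/Ff[].
  + apply: cvg_at_right_filter; have := is_derive1_continuous (Ff (abD (n:=n) (x:=a n) _)).
    by apply; rewrite in_itv/= lexx ltW.
  + apply: cvg_at_left_filter; have := is_derive1_continuous (Ff (abD (n:=n) (x:=b n) _)).
    by apply; rewrite in_itv/= lexx ltW.
- move=> x /subset_itv_oo_cc/abD/Ff xF; rewrite derive1E; exact: derive_val.
Qed.

Let mD : measurable (D : set (measurableTypeR R)).
Proof. exact: open_measurable. Qed.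

Let mf : measurable_fun (D : set (measurableTypeR R)) f.
Proof.
by apply: open_continuous_measurable_fun => // x; rewrite inE => /cf.
Qed.

Let f_ n := (EFin \o f) \_ `[a n, b n].

Let mf_ n : measurable_fun D (f_ n).
Proof.
apply/(measurable_restrict _ _ _) => //.
by apply: measurable_funS (_ : measurable_fun D _) => //; exact/measurable_EFinP.
Qed.

Let f_cvg x : D x -> f_ n x @[n --> \oo] --> (f x)%:E.
Proof.
move=> Dx; apply: cvg_near_cst; have := Dab Dx; apply: filterS => n xab.
by rewrite /f_ patchE mem_set.
Qed.

Let int_f_ n : (\int[mu]_(x in D) f_ n x = (F (b n) - F (a n))%:E)%E.
Proof.
rewrite -FTC_ab -integral_mkcondr setIidr// => x /=; exact: abD.
Qed.

(** The truncations of [f] to [[a n, b n]] have integral [F (b n) - F (a n)] and converge to [f],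
    dominated by [|f|]. Nothing is asked of [f] and [F] at the ends of [D], so endpoint
    singularities are allowed. *)
Lemma FTC_exhaustion l : mu.-integrable D (EFin \o f) ->
  F (b n) - F (a n) @[n --> \oo] --> l -> \int[mu]_(x in D) f x = l.
Proof.
move=> fi Fl.
have [|||||_ _ H] := @dominated_convergence _ _ _ mu D mD f_ (EFin \o f)
  (abse \o (EFin \o f)).
- exact: mf_.
- exact: measurable_int fi.
- by apply: aeW => x; exact: f_cvg.
- exact: integrable_abse.
- apply: aeW => x n Dx; rewrite /f_ patchE; case: ifPn => // _.
  by rewrite (_ : point = 0%E)// abse0 abse_ge0.
have {}H : (F (b n) - F (a n))%:E @[n --> \oo] --> (\int[mu]_(x in D) f x)%:E.
  rewrite fineK; last exact: integrable_fin_num.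
  by under eq_cvg do rewrite -int_f_.
have H1 : F (b n) - F (a n) @[n --> \oo] --> \int[mu]_(x in D) f x.
  exact: fine_cvg H.
by rewrite -(cvg_lim _ H1)// -(cvg_lim _ Fl).
Qed.

(** Fatou's lemma: the integrals of the truncations are the increments of [F], all at most [M]. *)
Lemma ge0_FTC_exhaustion M : (forall x, D x -> 0 <= f x) ->
  (forall n, F (b n) - F (a n) <= M) -> mu.-integrable D (EFin \o f).
Proof.
move=> f0 FM; apply/integrableP; split; first exact/measurable_EFinP.
apply: (@le_lt_trans _ _ (\int[mu]_(x in D) limn_einf (f_^~ x))%E).
  rewrite le_eqVlt; apply/orP; left; apply/eqP; apply: eq_integral.
  move=> x; rewrite inE => Dx; rewrite is_cvg_limn_einfE; last first.
    by apply/cvg_ex; exists (f x)%:E; exact: f_cvg.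
  by rewrite (cvg_lim _ (f_cvg Dx))// /= ger0_norm// f0.
apply: (le_lt_trans (@fatou _ _ _ mu D mD f_ mf_ _)).
  move=> n x Dx; rewrite /f_ patchE; case: ifPn => // _.
  by rewrite lee_fin f0.
apply: (@le_lt_trans _ _ M%:E); last exact: ltry.
rewrite limn_einf_lim; apply: lime_le; first exact: is_cvg_einfs.
near=> n; apply: (@le_trans _ _ (\int[mu]_(x in D) f_ n x)%E).
  by apply: ereal_inf_lbound; exists n => //=.
by rewrite int_f_ lee_fin.
Unshelve. all: end_near. Qed.

End FTC_exhaustion.

Section FTC_applications.
Context (R : realType).
Notation mu := (@lebesgue_measure R).
Implicit Types f F : R -> R.

Lemma near_itv_nat (x : R) : \forall n \near \oo, x \in `[- (n.+1%:R : R), n.+1%:R].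
Proof.
near=> n; rewrite in_itv/= -ler_norml; apply: (@le_trans _ _ n%:R).
  by near: n; exact: nbhs_infty_ger.
by rewrite ler_nat.
Unshelve. all: end_near. Qed.

Lemma ge0_FTC_integrableT f F M :
  (forall x : R, is_derive x 1 F (f x)) -> continuous f ->
  (forall x, 0 <= f x) -> (forall x, `|F x| <= M) ->
  mu.-integrable setT (EFin \o f).
Proof.
move=> Ff cf f0 FM.
apply: (@ge0_FTC_exhaustion _ f F setT (fun n => - n.+1%:R) (fun n => n.+1%:R) _ _
  _ _ _ _ (M + M)) => //.
- exact: openT.
- by move=> n; rewrite gtrN.
- by move=> x _; exact: near_itv_nat.
- by move=> x _; exact: cf.
- move=> n; apply: le_trans (ler_norm _) _.
  by apply: le_trans (ler_normB _ _) _; exact: lerD.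
Qed.

(** The bound on [F] kills both boundary terms at infinity; its shape is that of one factor of
    [decay], so that it applies on the lines parallel to an axis. *)
Lemma FTC_Rintegral0 f F :
  (forall x : R, is_derive x 1 F (f x)) -> continuous f ->
  mu.-integrable setT (EFin \o f) -> (exists C, forall x, `|F x| <= C / (1 + x ^+ 2)) ->
  \int[mu]_x f x = 0.
Proof.
move=> Ff cf fi [C FC].
apply: (@FTC_exhaustion _ f F setT (fun n => - n.+1%:R) (fun n => n.+1%:R)) => //.
- exact: openT.
- by move=> n; rewrite gtrN.
- by move=> x _; exact: near_itv_nat.
- by move=> x _; exact: cf.
have C0 : 0 <= C by have := FC 0; rewrite expr0n addr0 divr1; apply: le_trans.
apply/cvgr0Pnorm_le => e e0; near=> n.
have ne : C / (1 + n.+1%:R ^+ 2) <= e / 2.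
  rewrite ler_pdivrMr; last by rewrite ltr_pwDl// sqr_ge0.
  have : 2 * C / e <= n%:R by near: n; exact: nbhs_infty_ger.
  rewrite ler_pdivrMr// => h.
  have : n%:R <= 1 + n.+1%:R ^+ 2 :> R.
    rewrite -natrX -(natrD _ 1) ler_nat.
    by rewrite (leq_trans (leqnSn n))// (leq_trans _ (leq_addl _ _))// leq_pmull.
  by move=> /(ler_wpM2r (ltW e0)); lra.
apply: le_trans (ler_normB _ _) _; have := FC n.+1%:R; have := FC (- n.+1%:R).
by rewrite sqrrN; lra.
Unshelve. all: end_near. Qed.

Lemma integrable_inv1Dsqr : mu.-integrable setT (EFin \o (fun x : R => (1 + x ^+ 2)^-1)).
Proof.
apply: (@ge0_FTC_integrableT (fun x => (1 + x ^+ 2)^-1) atan (pi / 2)).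
- exact: continuous_oneDsqrV.
- by move=> x; rewrite invr_ge0 addr_ge0// sqr_ge0.
- by move=> x; rewrite ler_norml !ltW// ?atan_ltpi2 ?atan_gtNpi2.
Qed.

(** For [y = (1 + x) / p], raising [y <= expR y] to the power [p] gives
    [(1 + x)^p <= p^p * expR (1 + x)]. *)
Lemma expR_powR_bound (p : R) : 0 < p ->
  forall x, 0 <= x -> (1 + x) `^ p * expR (- x) <= expR 1 * p `^ p.
Proof.
move=> p0 x x0; have x1 : 0 < 1 + x by lra.
rewrite expRN ler_pdivrMr ?expR_gt0// mulrAC -expRD.
have E : 1 + x = (1 + x) / p * p by rewrite mulfVK// gt_eqF.
have q0 : 0 <= (1 + x) / p by rewrite divr_ge0// ltW.
rewrite {1}E powRM ?(ltW p0)// ler_wpM2r ?powR_ge0// {2}E expRM.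
rewrite ge0_ler_powR ?nnegrE ?expR_ge0 ?(ltW p0)//.
by apply: (le_trans _ (expR_ge1Dx _)); lra.
Qed.

Lemma integrable_Gamma (s : R) : 0 < s ->
  mu.-integrable `]0, +oo[ (EFin \o (fun x => x `^ (s - 1) * expR (- x))).
Proof.
move=> s0.
(* The derivative of (x / (1 + x))^s dominates the integrand up to a constant. *)
pose f x : R := s * (x / (1 + x)) `^ (s - 1) * ((1 + x) ^- 2).
pose F x : R := (x / (1 + x)) `^ s.
have dq (x : R) : 1 + x != 0 -> is_derive x 1 (fun x : R => x / (1 + x)) ((1 + x) ^- 2).
  move=> x1; have d2 : is_derive x 1 (fun x : R => (1 + x)^-1) (- (1 + x) ^- 2).
    by apply: is_derive_eq; rewrite /GRing.scale/= add0r mulr1.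
  by apply: is_derive_eq; rewrite /GRing.scale/=; field.
have dF (x : R) : 0 < x -> is_derive x 1 F (f x).
  move=> x0; have x1 : 1 + x != 0 by lra.
  have y0 : 0 < x / (1 + x) by rewrite divr_gt0//; lra.
  by apply: is_derive_eq; [exact: is_derive_powR_comp (dq _ x1)|rewrite /f; ring].
have fi : mu.-integrable `]0, +oo[ (EFin \o f).
  apply: (@ge0_FTC_exhaustion _ f F `]0, +oo[ (fun n => n.+2%:R^-1) (fun n => n.+1%:R) _ _
    _ _ _ _ 1) => //.
  - by move=> n; rewrite invf_plt ?posrE//; rewrite (@le_lt_trans _ _ 1) ?invf_le1 ?ler1n ?ltr1n.
  - move=> n x; rewrite in_itv/= => /andP[nx _]; rewrite in_itv/= andbT.
    by apply: lt_le_trans nx; rewrite invr_gt0.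
  - move=> x; rewrite /= in_itv/= andbT => x0; near=> n; rewrite in_itv/=; apply/andP; split.
      rewrite -[leRHS]invrK lef_pV2 ?posrE ?invr_gt0//.
      apply: (@le_trans _ _ n%:R); last by rewrite ler_nat ltnW.
      by near: n; exact: nbhs_infty_ger.
    apply: (@le_trans _ _ n%:R); last by rewrite ler_nat.
    by near: n; exact: nbhs_infty_ger.
  - by move=> x; rewrite /= in_itv/= andbT; exact: dF.
  - move=> x; rewrite /= in_itv/= andbT => x0.
    have x1 : 1 + x != 0 by lra.
    have y0 : 0 < x / (1 + x) by rewrite divr_gt0//; lra.
    have d3 := is_derive_powR_comp (f := fun x => x / (1 + x)) (s - 1) y0 (dq _ x1).
    have d4 : is_derive x 1 (fun x : R => (1 + x) ^- 2) (- (1 + x) ^+ 2 ^- 2 * (2 * (1 + x))).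
      by apply: is_derive_eq; [apply: is_deriveV; rewrite expf_neq0|rewrite /GRing.scale/=; ring].
    have d5 : is_derive x 1 f _ := is_deriveM (is_deriveZ s d3) d4.
    exact: is_derive1_continuous d5.
  - move=> x; rewrite /= in_itv/= andbT => x0; rewrite /f.
    by rewrite mulr_ge0 ?mulr_ge0 ?powR_ge0 ?invr_ge0 ?exprn_ge0// ?ltW//; lra.
  - move=> n; rewrite /F lerBlDr; apply: (@le_trans _ _ 1); last by rewrite lerDl powR_ge0.
    apply: (@le_trans _ _ (1 `^ s)); last by rewrite powR1.
    rewrite ge0_ler_powR ?nnegrE ?(ltW s0)// ?divr_ge0// ?addr_ge0//.
    by rewrite ler_pdivrMr ?mul1r ?lerDr// addr_gt0.
(* The exponent [s + 1] is the one for which [expR (- x) <= C / (1 + x)^(s + 1)] turns the integrand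
   into [C / s] times [f], since [f x = s x^(s - 1) / (1 + x)^(s + 1)]. *)
set C := expR 1 * (s + 1) `^ (s + 1).
have mI : measurable (`]0, +oo[%classic : set (measurableTypeR R)) by exact: measurable_itv.
have := integrableZl mI (C / s) fi.
apply: le_integrable => //.
- apply/measurable_EFinP; apply: measurable_funTS; apply: measurable_funM.
    exact: measurable_powR.
  by apply: measurableT_comp => //; exact: measurableT_comp.
- move=> x; rewrite /= in_itv/= andbT => x0.
  rewrite lee_fin (ger0_norm (mulr_ge0 (powR_ge0 _ _) (expR_ge0 _))).
  apply: le_trans (ler_norm _); rewrite /f.
  have x1 : 0 < 1 + x by lra.
  have s1 : 0 < s + 1 by lra.
  have := expR_powR_bound s1 (ltW x0); rewrite -/C.
  have -> : C / s * (s * (x / (1 + x)) `^ (s - 1) / (1 + x) ^+ 2) =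
    x `^ (s - 1) * (C / (1 + x) `^ (s + 1)).
    rewrite powRM ?(ltW x0) ?invr_ge0 ?(ltW x1)// -[(1 + x)^-1]powR_inv1 ?(ltW x1)// -powRrM.
    have -> : s + 1 = (s - 1) + 2 by ring.
    rewrite (@powRD _ (1 + x)); last by rewrite (gt_eqF x1) implybT.
    rewrite mulN1r powRN powR_mulrn ?(ltW x1)//.
    field; rewrite !lt0r_neq0 //. exact: powR_gt0.
  by move=> h; rewrite ler_wpM2l ?powR_ge0// ler_pdivlMr ?powR_gt0// mulrC.
Unshelve. all: end_near. Qed.

End FTC_applications.

(** * Uniqueness for the singular equation *)

Section singular_ode.
Context (R : realType).
Implicit Types z : R -> R.

Lemma MVT_pos z z1 (s t : R) : 0 < s -> s < t ->
  (forall x : R, 0 < x -> is_derive x 1 z (z1 x)) ->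
  exists2 x, s < x < t & z t - z s = z1 x * (t - s).
Proof.
move=> s0 st zz1.
have [||x] := @MVT R z z1 s t st.
- by move=> x; rewrite in_itv/= => /andP[sx _]; apply: zz1; exact: lt_trans sx.
- apply: derivable_within_continuous => x; rewrite in_itv/= => /andP[sx _].
  by have [] := zz1 x (lt_le_trans s0 sx).
- by rewrite in_itv/= => sxt ?; exists x.
Qed.

(* The mean value theorem on [k/2, k] makes the energy small at points close to 0. *)
Lemma singular_ode_zero (m K : R) z z1 : 0 <= m -> 0 <= K ->
  (forall t : R, 0 < t -> is_derive t 1 z (z1 t)) ->
  (forall t : R, 0 < t -> is_derive t 1 z1 (- (m / t * z1 t) - K * z t)) ->
  z 0 = 0 -> right_derivative0 z 0 -> forall t, 0 < t -> z t = 0.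
Proof.
move=> m0 K0 dz dz1 z0 z'0.
pose E t := z1 t ^+ 2 + K * z t ^+ 2.
have zsmall e : 0 < e -> exists2 h, 0 < h & forall s, 0 < s -> s < h -> `|z s| <= e * s.
  move=> e0; have /cvgrPdist_le/(_ _ e0) := z'0.
  rewrite near_withinE => -[h /= h0 hP]; exists h => // s s0 sh.
  have := hP s; rewrite /ball_/= !sub0r !normrN z0 subr0 gtr0_norm// => /(_ sh s0).
  rewrite normrM normfV (gtr0_norm s0) => H; rewrite -ler_pdivrMr// mulrC; exact: H.
have Edec s t : 0 < s -> s < t -> E t <= E s.
  move=> s0 st; have dE (x : R) : 0 < x -> is_derive x 1 E (- (2 * (m / x) * z1 x ^+ 2)).
    move=> x0; have d1 := dz _ x0; have d2 := dz1 _ x0.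
    rewrite /E; apply: is_derive_eq; rewrite /GRing.scale/=; ring.
  have [x /andP[sx xt] Ex] := MVT_pos s0 st dE.
  rewrite -subr_le0 Ex mulr_le0_ge0//; last by lra.
  rewrite oppr_le0 mulr_ge0 ?sqr_ge0// mulr_ge0// divr_ge0//.
  exact: ltW (lt_trans s0 sx).
(* The increment of [z] over [[k/2, k]] is at most [e k + e k/2 = 3 e (k/2)], so [|z1| <= 3 e] at
   some point, where also [|z| <= e] because [k < 1]. Hence the constant [9 + K]. *)
have Esmall t e : 0 < t -> 0 < e -> E t <= (9 + K) * e ^+ 2.
  move=> t0 e0; have [h h0 hP] := zsmall _ e0.
  pose k := Num.min (Num.min h t) 1 / 2.
  have k0 : 0 < k by rewrite divr_gt0// !lt_min h0 t0/= ltr01.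
  have [kh kt k1] : [/\ k < h, k < t & k < 1].
    have km : k < Num.min (Num.min h t) 1 by rewrite /k; rewrite /k in k0; lra.
    by split; apply: (lt_le_trans km); rewrite ?ge_min ?lexx ?orbT.
  have k20 : 0 < k / 2 by lra.
  have k2k : k / 2 < k by lra.
  have [x /andP[kx xk] zx] := MVT_pos k20 k2k dz.
  have x0 : 0 < x by lra.
  apply: (le_trans (Edec x t _ _)) => //; first by lra.
  have := hP x x0; have := hP k k0 kh; have := hP (k/2) ltac:(lra) ltac:(lra).
  move=> h1 h2 /(_ ltac:(lra)) h3.
  have z1x : `|z1 x| <= 3 * e.
    have : `|z1 x * (k - k/2)| <= e * k + e * (k/2).
      by rewrite -zx; apply: (le_trans (ler_normB _ _)); exact: lerD.
    rewrite normrM (_ : k - k/2 = k/2); last by lra.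
    rewrite (@gtr0_norm _ (k/2)); last by lra.
    by move: k0 => k0 ?; rewrite -(ler_pM2r (_ : 0 < k/2)); lra.
  have zx' : `|z x| <= e by apply: (le_trans h3); rewrite ler_piMr; lra.
  rewrite /E -(real_normK (num_real (z1 x))) -(real_normK (num_real (z x))).
  have -> : (9 + K) * e ^+ 2 = (3 * e) ^+ 2 + K * e ^+ 2 by ring.
  by rewrite lerD// ?ler_wpM2l// lerXn2r// nnegrE; lra.
have E0 t : 0 < t -> z1 t = 0.
  move=> t0; apply/eqP; rewrite -sqrf_eq0 eq_le sqr_ge0 andbT.
  apply/ler_addgt0Pr => e e0; rewrite add0r.
  have e1 : 0 < Num.sqrt (e / (9 + K)) by rewrite sqrtr_gt0 divr_gt0//; lra.
  have := Esmall _ _ t0 e1; rewrite sqr_sqrtr; last by rewrite divr_ge0; lra.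
  rewrite mulrCA divff ?mulr1; last by rewrite gt_eqF//; lra.
  by apply: le_trans; rewrite /E lerDl mulr_ge0// sqr_ge0.
(* [K] may be 0, as happens at frequency 0, and then the energy says nothing about [z]. Instead,
   [z1 = 0] makes [z] constant for positive times, and [z] is small near 0. *)
move=> t t0; apply/eqP; rewrite -normr_eq0 eq_le normr_ge0 andbT.
apply/ler_addgt0Pr => e e0; rewrite add0r.
have [h h0 hP] := zsmall _ e0.
pose k := Num.min (Num.min h t) 1 / 2.
have k0 : 0 < k by rewrite divr_gt0// !lt_min h0 t0/= ltr01.
have [kh kt k1] : [/\ k < h, k < t & k < 1].
  have km : k < Num.min (Num.min h t) 1 by rewrite /k; rewrite /k in k0; lra.
  by split; apply: (lt_le_trans km); rewrite ?ge_min ?lexx ?orbT.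
have [x /andP[kx _] zx] := MVT_pos k0 kt dz.
have -> : z t = z k by move: zx; rewrite E0 ?mul0r; lra.
by apply: (le_trans (hP k k0 kh)); rewrite ler_piMr; lra.
Qed.

End singular_ode.

(** * Integration over row vectors *)

Section rV_topology.
Context (R : realType).

Lemma cvg_rV (T : Type) (F : set_system T) (FF : Filter F) d (u : T -> 'rV[R]_d) (l : 'rV[R]_d) :
  (forall i, u t ord0 i @[t --> F] --> l ord0 i) -> u t @[t --> F] --> l.
Proof.
move=> ul; apply/cvg_ballP => e e0.
have : \forall t \near F, forall i, ball (l ord0 i) e (u t ord0 i).
  by apply: filter_forall => i; have /cvg_ballP := ul i; exact.
by apply: filterS => t h; split => // i j; rewrite (ord1 i).
Qed.

Lemma continuous_rV_measurable d (f : 'rV[R]_d -> R) : continuous f ->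
  measurable_fun setT f.
Proof.
move=> cf.
(* f is the limit of its values on the grid of mesh 1/(n+1), and the cells of the grid are boxes. *)
pose q n (x : 'rV[R]_d) : 'rV[R]_d :=
  \row_i ((Num.floor (n.+1%:R * x ord0 i))%:~R / n.+1%:R).
apply: (@measurable_fun_cvg _ _ _ _ (fun n => f \o q n)).
  move=> n _ A mA; rewrite setTI.
  pose pt (z : {ffun 'I_d -> int}) : 'rV[R]_d := \row_i ((z i)%:~R / n.+1%:R).
  pose box (z : {ffun 'I_d -> int}) := [set x : 'rV[R]_d | forall i,
    `[(z i)%:~R / n.+1%:R, (z i + 1)%:~R / n.+1%:R[%classic (x ord0 i)].
  have bP x z : box z x <-> z = [ffun i => Num.floor (n.+1%:R * x ord0 i)].
    split => [bx|-> i /=].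
      apply/ffunP => i; rewrite ffunE; apply/esym/eqP; rewrite floor_eq.
      have := bx i; rewrite /= in_itv/= ler_pdivrMr// ltr_pdivlMr//.
      by rewrite ![_ * x _ _]mulrC.
    rewrite ffunE in_itv/= ler_pdivrMr// ltr_pdivlMr// ![x _ _ * _]mulrC.
    exact: floor_itv.
  have -> : (f \o q n) @^-1` A = \bigcup_z (if `[< A (f (pt z)) >] then box z else set0).
    apply/seteqP; split => [x /= Ax|x [z _]/=].
      exists [ffun i => Num.floor (n.+1%:R * x ord0 i)] => //.
      rewrite asboolT; first exact/bP.
      move: Ax; rewrite (_ : pt _ = q n x)//.
      by apply/rowP => i; rewrite !mxE ffunE.
    case: ifPn => // /asboolP Az /bP zE; rewrite (_ : q n x = pt z)//.
    by apply/rowP => i; rewrite !mxE zE ffunE.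
  apply: countable_bigcupT_measurable => // z; case: ifPn => // _.
  by apply: (@measurable_rV_box R d (fun i => `[(z i)%:~R / n.+1%:R, (z i + 1)%:~R / n.+1%:R[%classic)).
move=> x _; apply: (cvg_comp (q ^~ x) f); last exact: cf.
apply: cvg_rV => i; apply/cvgrPdist_le => e e0; near=> n.
rewrite mxE ger0_norm; last first.
  rewrite subr_ge0 ler_pdivrMr// mulrC.
  by have /andP[] := floor_itv (x ord0 i * n.+1%:R).
have /andP[_] := floor_itv (n.+1%:R * x ord0 i).
rewrite intrD mulr1z mulrC -ltr_pdivlMr// mulrDl mul1r.
move: (_ / _) => z h; apply: (@le_trans _ _ (n.+1%:R^-1)).
  by move: (_^-1) h => y h; lra.
rewrite -[leRHS]invrK lef_pV2 ?posrE ?invr_gt0//.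
apply: (@le_trans _ _ n%:R); last by rewrite ler_nat.
by near: n; exact: nbhs_infty_ger.
Unshelve. all: end_near. Qed.

End rV_topology.

(** * Fubini's theorem for real-valued integrals *)

Section Rfubini.
Context d1 d2 (T1 : measurableType d1) (T2 : measurableType d2) (R : realType)
  (m1 : {sigma_finite_measure set T1 -> \bar R})
  (m2 : {sigma_finite_measure set T2 -> \bar R}) (f : T1 * T2 -> R).
Hypothesis fi : (m1 \x m2)%E.-integrable setT (EFin \o f).

(** An inner integral is finite only almost everywhere, and [fine] sends infinite values to 0; the
    integrand changes on a null set only. *)
Let ae_fineK d (T : measurableType d) (m : {measure set T -> \bar R}) (F : T -> \bar R) :
  m.-integrable setT F -> (\int[m]_x (fine (F x))%:E = \int[m]_x F x)%E.
Proof.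
move=> Fi; have mF := measurable_int _ Fi; apply: ae_eq_integral => //.
  exact/measurable_EFinP/measurableT_comp.
have := integrable_ae measurableT Fi; apply: filterS => x h /h h2.
by rewrite fineK.
Qed.

Lemma Rintegral_prod1 :
  \int[(m1 \x m2)%E]_z f z = \int[m1]_x \int[m2]_y f (x, y).
Proof.
rewrite /Rintegral -integral12_prod_meas1//; congr fine.
by rewrite -(ae_fineK (integrable_fubini_F fi)).
Qed.

Lemma Rintegral_prod2 :
  \int[(m1 \x m2)%E]_z f z = \int[m2]_y \int[m1]_x f (x, y).
Proof.
rewrite /Rintegral -integral21_prod_meas1//; congr fine.
rewrite -(ae_fineK (F := fun y => \int[m1]_x (f (x, y))%:E)%E)//.
have mf := measurable_int _ fi.
have mG := measurable_fubini_G fi.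
apply/integrableP; split; first exact: mG.
apply: le_lt_trans ((integrable21ltyP m1 m2 mf).1 fi).
apply: ge0_le_integral => //.
- exact: measurableT_comp.
- apply: (measurable_fun_fubini_tonelli_G (abse \o (EFin \o f))).
    exact: measurableT_comp.
  by move=> z; exact: abse_ge0.
- move=> y _; apply: le_abse_integral => //.
  by apply: (measurableT_comp mf); exact: measurable_pair2.
Qed.

End Rfubini.

Section rV_integral.
Context (R : realType).
Notation mu := (@lebesgue_measure R).
Notation lam := (lebesgue_rV R).

Lemma ge0_integral_rV_cons d (f : 'rV[R]_d.+1 -> \bar R) :
  measurable_fun setT f -> (forall x, 0 <= f x)%E ->
  (\int[lam d.+1]_x f x = \int[mu]_s \int[lam d]_y f (rV_cons (s, y)))%E.
Proof.
move=> mf f0.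
have -> : (\int[lam d.+1]_x f x =
    \int[pushforward (mu \x lam d)%E (@rV_cons R d)]_x f x)%E by [].
rewrite ge0_integral_pushforward//; last exact: measurable_rV_cons.
have mfc : measurable_fun setT (f \o @rV_cons R d).
  by apply: measurableT_comp => //; exact: measurable_rV_cons.
by rewrite preimage_setT (fubini_tonelli1 _ mfc)// => x; exact: f0.
Qed.

Lemma integrable_rV_cons d (f : 'rV[R]_d.+1 -> R) :
  (lam d.+1).-integrable setT (EFin \o f) ->
  (mu \x lam d)%E.-integrable setT (EFin \o (fun z => f (rV_cons z))).
Proof.
move=> /integrableP[mf foo]; apply/integrableP; split.
  by apply: (measurableT_comp mf); exact: measurable_rV_cons.
move: foo; rewrite ge0_integral_rV_cons//; last exact: measurableT_comp.
rewrite (fubini_tonelli1 (fun z => `|(f (rV_cons z))%:E|%E))//.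
by apply: measurableT_comp => //; apply: (measurableT_comp mf); exact: measurable_rV_cons.
Qed.

Lemma Rintegral_rV_cons d (f : 'rV[R]_d.+1 -> R) :
  (lam d.+1).-integrable setT (EFin \o f) ->
  \int[lam d.+1]_x f x = \int[(mu \x lam d)%E]_z f (rV_cons z).
Proof.
move=> fi; rewrite /Rintegral; congr fine.
have -> : (\int[lam d.+1]_x (f x)%:E =
    \int[pushforward (mu \x lam d)%E (@rV_cons R d)]_x (f x)%:E)%E by [].
rewrite (@integral_pushforward _ _ _ _ _ _ _ _ setT (EFin \o f))//.
- exact: measurable_rV_cons.
- exact: measurable_int fi.
- by rewrite preimage_setT; exact: integrable_rV_cons.
Qed.

Lemma measurable_rV_affine d (a : R) (b : 'rV[R]_d) :
  measurable_fun setT (fun x : 'rV[R]_d => a *: x + b).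
Proof.
apply: measurable_fun_rVP => i.
rewrite (_ : (fun _ => _) = (fun x : 'rV[R]_d => a * x ord0 i + b ord0 i)); last first.
  by apply/funext => x; rewrite !mxE.
by apply: measurable_funD => //; apply: measurable_funM => //; exact: measurable_coord.
Qed.

(** Each coordinate contributes a factor [a^-1]: the first by the substitution on the line, the
    others by induction. In dimension 0 all row vectors are equal. *)
Lemma ge0_integral_rV_affine d (a : R) (b : 'rV[R]_d) (f : 'rV[R]_d -> \bar R) :
  0 < a -> measurable_fun setT f -> (forall x, 0 <= f x)%E ->
  (\int[lam d]_x f (a *: x + b)%R = (a ^- d)%:E * \int[lam d]_x f x)%E.
Proof.
move=> a0; elim: d b f => [|d IH] b f mf f0.
  rewrite expr0 invr1 mul1e; apply: eq_integral => x _; congr f.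
  by apply/rowP => -[].
pose b' : 'rV[R]_d := \row_i b ord0 (lift ord0 i).
have E s y : a *: rV_cons (s, y) + b = rV_cons (a * s + b ord0 ord0, a *: y + b').
  apply/rowP => i; rewrite [LHS]mxE [X in X + _]mxE.
  case: (unliftP ord0 i) => [j|] ->; last by rewrite !rV_cons0.
  by rewrite !rV_consS !mxE.
have mfc : measurable_fun setT (fun z : measurableTypeR R * 'rV[R]_d => f (rV_cons z)).
  by apply: (measurableT_comp mf); exact: measurable_rV_cons.
have mF : measurable_fun setT (fun s => \int[lam d]_y f (rV_cons (s, y)))%E.
  exact: (measurable_fun_fubini_tonelli_F (fun z => f (rV_cons z))).
have mfs s : measurable_fun setT (fun y => f (rV_cons (s, y))).
  by apply: (measurableT_comp mfc); exact: measurable_pair1.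
have maff : measurable_fun setT (fun x : 'rV[R]_d.+1 => a *: x + b).
  exact: measurable_rV_affine.
have H0 s : (0 <= \int[lam d]_y f (rV_cons (s, y)))%E by exact: integral_ge0.
rewrite (ge0_integral_rV_cons mf f0).
rewrite (ge0_integral_rV_cons (measurableT_comp mf maff) (fun x => f0 _)).
set H := fun s => (\int[lam d]_y f (rV_cons (s, y)))%E.
transitivity (\int[mu]_s ((a ^- d)%:E * H (a * s + b ord0 ord0)%R))%E.
  apply: eq_integral => s _.
  apply: etrans (IH b' (fun y => f (rV_cons (a * s + b ord0 ord0, y))) _ _) => //.
  by apply: eq_integral => y _ /=; rewrite E.
have mHa : measurable_fun [set: measurableTypeR R] (fun s => H (a * s + b ord0 ord0)).
  apply: (measurableT_comp mF (g := fun s => a * s + b ord0 ord0)).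
  by apply: measurable_funD => //; exact: measurable_funM.
have ad : (0 <= (a ^- d)%:E)%E by rewrite lee_fin invr_ge0 exprn_ge0 ?ltW.
rewrite (ge0_integralZl mu measurableT mHa (fun s _ => H0 _) ad).
rewrite (ge0_integral_affine (b ord0 ord0) a0 mF H0) muleA -EFinM.
by rewrite exprSr invfM.
Qed.

Lemma integrable_rV_affine d (a : R) (b : 'rV[R]_d) (f : 'rV[R]_d -> R) : 0 < a ->
  (lam d).-integrable setT (EFin \o f) ->
  (lam d).-integrable setT (EFin \o (fun x => f (a *: x + b))) /\
  \int[lam d]_x f (a *: x + b) = a ^- d * \int[lam d]_x f x.
Proof.
move=> a0 fi; have /integrableP[mf foo] := fi.
have maff : measurable_fun setT (fun x : 'rV[R]_d => a *: x + b).
  exact: measurable_rV_affine.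
split.
  apply/integrableP; split; first exact: (measurableT_comp mf maff).
  have mabs : measurable_fun setT (abse \o (EFin \o f)) by exact: measurableT_comp.
  have -> := ge0_integral_rV_affine b a0 mabs (fun x => abse_ge0 _).
  by rewrite lte_mul_pinfty ?lee_fin ?invr_ge0 ?exprn_ge0 ?(ltW a0).
have E : (\int[lam d]_x (f (a *: x + b))%:E = (a ^- d)%:E * \int[lam d]_x (f x)%:E)%E.
  rewrite integralE [X in (_ * X)%E]integralE muleBr//; last first.
    exact: integrable_add_def.
  congr (_ - _)%E.
  - have -> := esym (ge0_integral_rV_affine b a0 (measurable_funepos mf) (funepos_ge0 _)).
    by apply: eq_integral => x _; rewrite !funeposE.
  - have -> := esym (ge0_integral_rV_affine b a0 (measurable_funeneg mf) (funeneg_ge0 _)).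
    by apply: eq_integral => x _; rewrite !funenegE.
by rewrite /Rintegral E fineM//; exact: integrable_fin_num.
Qed.

Lemma measurable_prod_coord d (h : 'I_d -> R -> R) :
  (forall i, measurable_fun [set: measurableTypeR R] (h i)) ->
  measurable_fun [set: 'rV[R]_d] (fun x : 'rV[R]_d => \prod_(i < d) h i (x ord0 i)).
Proof.
move=> mh; apply: measurable_prod => i _.
by apply: (measurableT_comp (mh i)); exact: measurable_coord.
Qed.

(** Tonelli splits off one factor at a time; the induction starts from the Dirac mass of dimension
    0, whose total mass is 1. *)
Lemma integrable_prod_coord d (h : 'I_d -> R -> R) :
  (forall i x, 0 <= h i x) -> (forall i, mu.-integrable setT (EFin \o h i)) ->
  (lam d).-integrable setT (EFin \o (fun x : 'rV[R]_d => \prod_(i < d) h i (x ord0 i))).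
Proof.
move=> h0 hi.
have mh i : measurable_fun [set: measurableTypeR R] (h i).
  by apply/measurable_EFinP; exact: measurable_int (hi i).
elim: d h h0 hi mh => [|d IH] h h0 hi mh.
  apply/integrableP; split.
    by apply/measurable_EFinP; exact: measurable_prod_coord.
  under eq_integral do rewrite /= big_ord0 normr1.
  by rewrite integral_cst//= diracE in_setT mule1 ltry.
have := IH (fun i => h (lift ord0 i)) (fun i => h0 _) (fun i => hi _) (fun i => mh _).
set P' := fun x : 'rV[R]_d => \prod_(i < d) h (lift ord0 i) (x ord0 i) => iP'.
have P'0 x : 0 <= P' x by exact: prodr_ge0.
have mP' := measurable_prod_coord (fun i => mh (lift ord0 i)).
have mP := measurable_prod_coord mh.
apply/integrableP; split; first exact/measurable_EFinP.
have mabs : measurable_fun setT (abse \o (EFin \o (fun x : 'rV[R]_d.+1 =>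
    \prod_(i < d.+1) h i (x ord0 i)))).
  by apply: measurableT_comp => //; exact/measurable_EFinP.
have -> := ge0_integral_rV_cons mabs (fun x => abse_ge0 _).
have fin (T : Type) (e : measure_display) (X : measurableType e)
    (m : {measure set X -> \bar R}) (g : X -> R) : (forall x, 0 <= g x) ->
    m.-integrable setT (EFin \o g) -> exists r : R, (\int[m]_x (g x)%:E = r%:E)%E.
  move=> g0 /integrable_fin_num gfin; exists (fine (\int[m]_x (g x)%:E)).
  by rewrite fineK//; exact: gfin.
have [r Er] := fin unit _ _ (lam d) P' P'0 iP'.
have [q Eq] := fin unit _ _ mu (h ord0) (h0 _) (hi _).
have r0 : 0 <= r by rewrite -lee_fin -Er; apply: integral_ge0 => x _; rewrite lee_fin.
rewrite (_ : (\int[_]_s _)%E = (\int[mu]_s (r%:E * (h ord0 s)%:E))%E).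
  rewrite (ge0_integralZl mu measurableT _ _ _) ?Eq -?EFinM ?ltry//.
  - exact/measurable_EFinP.
  - by move=> x _; rewrite lee_fin.
apply: eq_integral => s _.
transitivity (\int[lam d]_y ((h ord0 s)%:E * (P' y)%:E))%E.
  apply: eq_integral => y _ /=; rewrite ger0_norm ?prodr_ge0//.
  rewrite big_ord_recl rV_cons0 EFinM; congr (_ * (_)%:E)%E.
  by apply: eq_bigr => i _; rewrite rV_consS.
rewrite (ge0_integralZl (lam d) measurableT) ?Er 1?muleC//.
- exact/measurable_EFinP.
- by move=> x _; rewrite lee_fin.
- by rewrite lee_fin.
Qed.

(** A product over coordinates is preferred to a power of the norm: it is integrable in every
    dimension for a one-dimensional reason, and it splits along [rV_cons]. *)
Definition decay d (x : 'rV[R]_d) : R := \prod_(i < d) (1 + x ord0 i ^+ 2)^-1.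

Lemma decay_ge0 d (x : 'rV[R]_d) : 0 <= decay x.
Proof. by apply: prodr_ge0 => i _; rewrite invr_ge0 addr_ge0// sqr_ge0. Qed.

Lemma decay_cons d s (y : 'rV[R]_d) : decay (rV_cons (s, y)) = (1 + s ^+ 2)^-1 * decay y.
Proof.
rewrite /decay big_ord_recl rV_cons0; congr (_ * _).
by apply: eq_bigr => i _; rewrite rV_consS.
Qed.

Lemma integrable_decay d : (lam d).-integrable setT (EFin \o @decay d).
Proof.
apply: (integrable_prod_coord (h := fun _ x => (1 + x ^+ 2)^-1)) => [i x|i].
  by rewrite invr_ge0 addr_ge0// sqr_ge0.
exact: integrable_inv1Dsqr.
Qed.

(** If [i] is the first coordinate, Fubini integrates along it first and the fundamental theorem of
    calculus gives 0 on each line. Otherwise the first coordinate [t] is frozen and the induction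
    hypothesis applies to the slice, with constant [C / (1 + t^2)]. *)
Lemma Rintegral_derive0 d (i : 'I_d) (F G : 'rV[R]_d -> R) (C : R) :
  measurable_fun setT G ->
  (forall (x : 'rV[R]_d) (s : R), is_derive s 1 (fun s : R => F (s *: delta_mx ord0 i + x))
    (G (s *: delta_mx ord0 i + x))) ->
  (forall x : 'rV[R]_d, continuous (fun s : R => G (s *: delta_mx ord0 i + x))) ->
  (forall x, `|F x| <= C * decay x) -> (forall x, `|G x| <= C * decay x) ->
  \int[lam d]_x G x = 0.
Proof.
elim: d i F G C => [[]//|d IH] i F G C mG dF cG FC GC.
have iG : (lam d.+1).-integrable setT (EFin \o G).
  apply: (@integrable_dominated _ _ _ (lam d.+1) setT G (fun x => C * decay x)) => //.
  by apply: integrableZl_real => //; exact: integrable_decay.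
have iGc := integrable_rV_cons iG.
have mGc : measurable_fun setT (fun z => G (rV_cons z)).
  by apply: (measurableT_comp mG); exact: measurable_rV_cons.
rewrite Rintegral_rV_cons//; case: (unliftP ord0 i) dF cG => [j|] -> dF cG.
  rewrite (Rintegral_prod1 iGc).
  have E s t y : s *: delta_mx ord0 (lift ord0 j) + rV_cons (t, y) =
      rV_cons (t, s *: delta_mx ord0 j + y) :> 'rV[R]_d.+1.
    apply/rowP => l; rewrite [LHS]mxE [X in X + _]mxE.
    case: (unliftP ord0 l) => [l'|] ->.
      by rewrite !rV_consS !mxE (inj_eq lift_inj).
    by rewrite !rV_cons0 mxE/= mulr0 add0r.
  transitivity (\int[mu]_s (0 : R)); last by rewrite Rintegral_cst// mul0r.
  apply: eq_Rintegral => t _.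
  apply: (IH j (fun y => F (rV_cons (t, y))) _ (C * (1 + t ^+ 2)^-1)).
  - by apply: (measurableT_comp mGc); exact: measurable_pair1.
  - move=> y s; have := dF (rV_cons (t, y)) s; rewrite E.
    by under eq_fun do rewrite E.
  - by move=> y; have := cG (rV_cons (t, y)); under eq_fun do rewrite E.
  - by move=> y; rewrite -mulrA -decay_cons.
  - by move=> y; rewrite -mulrA -decay_cons.
rewrite (Rintegral_prod2 iGc).
have E s y : s *: delta_mx ord0 ord0 + rV_cons (0, y) = rV_cons (s, y) :> 'rV[R]_d.+1.
  apply/rowP => l; rewrite [LHS]mxE [X in X + _]mxE.
  case: (unliftP ord0 l) => [l'|] ->.
    by rewrite !rV_consS !mxE/= mulr0 add0r.
  by rewrite !rV_cons0 mxE/= mulr1 addr0.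
transitivity (\int[lam d]_y (0 : R)); last by rewrite Rintegral_cst// mul0r.
apply: eq_Rintegral => y _.
apply: (@FTC_Rintegral0 _ _ (fun s => F (rV_cons (s, y)))).
- move=> s; have := dF (rV_cons (0, y)) s; rewrite E.
  by under eq_fun do rewrite E.
- by have := cG (rV_cons (0, y)); under eq_fun do rewrite E.
- apply: (@integrable_dominated _ _ _ mu setT _ (fun s => C * decay y * (1 + s ^+ 2)^-1)) => //.
  + by apply: (measurableT_comp mGc); exact: measurable_pair2.
  + by move=> s _; rewrite -mulrA [_ * _^-1]mulrC -decay_cons.
  + by apply: integrableZl_real => //; exact: integrable_inv1Dsqr.
- by exists (C * decay y) => s; rewrite -mulrA [_ * _^-1]mulrC -decay_cons.
Qed.

End rV_integral.

(** * The Euler-Poisson-Darboux kernel *)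

Section Beta.
Context (R : realType).
Notation mu := (@lebesgue_measure R).

Lemma measurable_pos_powR (a : R) :
  measurable_fun [set: measurableTypeR R] (fun x => pos_powR x a).
Proof.
apply: measurable_fun_ifT => //; exact: measurable_fun_ltr.
Qed.

Lemma pos_powR_ge0 (x a : R) : 0 <= pos_powR x a.
Proof. by rewrite /pos_powR; case: ifP => // _; exact: powR_ge0. Qed.

Lemma ge0_integralZl_real (f : R -> R) (r : R) : 0 <= r ->
  measurable_fun [set: measurableTypeR R] f -> (forall x, 0 <= f x) ->
  (\int[mu]_x (r * f x)%:E = r%:E * \int[mu]_x (f x)%:E)%E.
Proof.
move=> r0 mf f0; under eq_integral do rewrite EFinM.
rewrite ge0_integralZl//; first exact/measurable_EFinP.
by move=> x _; rewrite lee_fin.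
Qed.

(** The Gamma integrand extended by 0 to the whole line, where the affine substitutions are
    available. *)
Let gam (s x : R) : R := pos_powR x (s - 1) * expR (- x).

Let mgam s : measurable_fun [set: measurableTypeR R] (gam s).
Proof.
apply: measurable_funM; first exact: measurable_pos_powR.
by apply: measurableT_comp => //; exact: measurableT_comp.
Qed.

Let gam_ge0 s x : 0 <= gam s x.
Proof. by rewrite mulr_ge0 ?pos_powR_ge0 ?expR_ge0. Qed.

Lemma GammaE (s : R) : 0 < s -> (\int[mu]_x (gam s x)%:E = (Gamma s)%:E)%E.
Proof.
move=> s0; rewrite /Gamma /Rintegral fineK; last first.
  apply: integrable_fin_num; [exact: measurable_itv|exact: integrable_Gamma].
rewrite [RHS]integral_mkcond; apply: eq_integral => x _.
rewrite patchE mem_setE in_itv/= andbT /gam /pos_powR; case: ifP => // _.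
by rewrite mul0r.
Qed.

(** A zero integral would make the nonnegative integrand vanish almost everywhere, yet it is
    positive on []0, 1]], a set of measure 1. *)
Lemma Gamma_gt0 (s : R) : 0 < s -> 0 < Gamma s.
Proof.
move=> s0; rewrite lt_neqAle Rintegral_ge0 ?andbT; last first.
  by move=> x _; rewrite mulr_ge0 ?powR_ge0 ?expR_ge0.
apply/eqP => G0; have := GammaE s0; rewrite -G0 => int0.
have [|] := @ae_eq_integral_abs _ _ _ mu setT measurableT (EFin \o gam s).
  exact/measurable_EFinP.
move=> /(_ _)[|N [mN N0 sub] _].
  rewrite -[RHS]int0; apply: eq_integral => x _ /=.
  by rewrite ger0_norm.
have : (mu `]0%R, 1%R] <= mu N)%E.
  apply: le_measure; rewrite ?inE//.
  move=> x; rewrite /= in_itv/= => /andP[x0 _]; apply: sub => /= /(_ I).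
  move=> /eqP; rewrite eqe /gam /pos_powR x0 => /eqP.
  by apply/eqP; rewrite mulf_neq0 ?gt_eqF ?expR_gt0 ?powR_gt0.
by rewrite N0 lebesgue_measure_itv/= lte_fin ltr01 oppr0 adde0 lee_fin ler10.
Qed.

Section fixed.
Variable m : R.
Hypothesis m0 : 0 < m.

(** The Gegenbauer weight, a semicircle for [m = 3/2]. Through [pos_powR] it vanishes at -1 and 1
    even when [m <= 1]. *)
Definition semicircle_weight (s : R) : R := pos_powR (1 - s ^+ 2) (m - 1).
Local Notation k := semicircle_weight.

Lemma measurable_semicircle_weight :
  measurable_fun [set: measurableTypeR R] k.
Proof.
apply: (measurableT_comp (measurable_pos_powR _)).
by apply: measurable_funB => //; exact: measurable_funX.
Qed.

Lemma semicircle_weight_ge0 s : 0 <= k s.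
Proof. exact: pos_powR_ge0. Qed.

(* The double integral of h is Gamma m times the Gaussian integral when integrated
   first in z.1, and Gamma (m + 1/2) times the total weight when first in z.2. *)
Let h (z : measurableTypeR R * measurableTypeR R) : R :=
  pos_powR (z.1 - z.2 ^+ 2) (m - 1) * expR (- z.1).

Let mh : measurable_fun setT h.
Proof.
apply: measurable_funM.
  apply: (measurableT_comp (measurable_pos_powR _)).
  by apply: measurable_funB => //; apply: measurable_funX.
by apply: measurableT_comp => //; exact: measurableT_comp.
Qed.

Let h_ge0 z : 0 <= h z.
Proof. by rewrite mulr_ge0 ?pos_powR_ge0 ?expR_ge0. Qed.

Let mh1 y : measurable_fun [set: measurableTypeR R] (fun r => (h (r, y))%:E).
Proof.
by apply/measurable_EFinP; apply: (measurableT_comp mh); exact: measurable_pair2.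
Qed.

Let mh2 r : measurable_fun [set: measurableTypeR R] (fun y => (h (r, y))%:E).
Proof.
by apply/measurable_EFinP; apply: (measurableT_comp mh); exact: measurable_pair1.
Qed.

Let int_r y : (\int[mu]_r (h (r, y))%:E = (Gamma m * expR (- y ^+ 2))%:E)%E.
Proof.
have := @ge0_integral_affine R 1 (y ^+ 2) ltr01 _ (mh1 y).
rewrite invr1 mul1e => <-//; last by move=> x; rewrite lee_fin.
rewrite EFinM -GammaE// muleC -ge0_integralZl_real ?expR_ge0//.
apply: eq_integral => x _; rewrite /h/= mul1r addrK /gam opprD expRD.
by congr EFin; ring.
Qed.

(** The substitution [y = sqrt r * s] turns [(r - y^2)^(m - 1) dy] into
    [r^(m - 1/2) (1 - s^2)^(m - 1) ds], and [m - 1/2] is the exponent of the Gamma integrand at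
    [m + 1/2]. *)
Let int_y r : (\int[mu]_y (h (r, y))%:E =
  (gam (m + 2^-1) r)%:E * \int[mu]_s (k s)%:E)%E.
Proof.
have [r0|r0] := ltP 0 r; last first.
  rewrite /gam {1}/pos_powR ltNge r0/= mul0r mul0e integral0_eq// => y _.
  rewrite /h/= /pos_powR ifF ?mul0r//; apply/negbTE; rewrite -leNgt.
  by rewrite subr_le0 (le_trans r0)// sqr_ge0.
have sr0 : 0 < Num.sqrt r by rewrite sqrtr_gt0.
have := @ge0_integral_affine R (Num.sqrt r) 0 sr0 _ (mh2 r).
move=> /(_ _)/(congr1 (fun x => (Num.sqrt r)%:E * x)%E).
rewrite muleA -EFinM divff ?gt_eqF// mul1e => <-//; last by move=> x; rewrite lee_fin.
have mk := measurable_semicircle_weight.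
have /measurable_EFinP/= mh2r := mh2 r.
have mh2s : measurable_fun [set: measurableTypeR R] (fun s => h (r, Num.sqrt r * s + 0)).
  apply: (@measurableT_comp _ _ _ _ _ _ (fun y : measurableTypeR R => h (r, y))) => //.
  by apply: measurable_funD => //; exact: measurable_funM.
rewrite -(ge0_integralZl_real (sqrtr_ge0 r) mh2s); last by move=> x; exact: h_ge0.
rewrite -(ge0_integralZl_real (gam_ge0 _ _) mk); last by move=> x; exact: pos_powR_ge0.
apply: eq_integral => s _; congr EFin.
rewrite /h/= /gam /k addr0 exprMn sqr_sqrtr ?(ltW r0)//.
rewrite -[X in X - r * _]mulr1 -mulrBr /pos_powR r0 pmulr_rgt0//.
case: ifPn => s1; last by rewrite mul0r !mulr0.
rewrite powRM ?(ltW r0) ?(ltW s1)//.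
have -> : m + 2^-1 - 1 = 2^-1 + (m - 1) by ring.
rewrite (@powRD _ r 2^-1 (m - 1)) ?(gt_eqF r0) ?implybT// powR12_sqrt ?(ltW r0)//.
by ring.
Qed.

Lemma Beta_semicircle :
  ((Gamma (m + 2^-1))%:E * \int[mu]_s (k s)%:E = (Num.sqrt pi * Gamma m)%:E)%E.
Proof.
have m2 : 0 < m + 2^-1 by rewrite addr_gt0.
have mk := measurable_semicircle_weight.
have k0 : (0 <= \int[mu]_s (k s)%:E)%E.
  by apply: integral_ge0 => x _; rewrite lee_fin pos_powR_ge0.
have E : (\int[mu]_r \int[mu]_y (h (r, y))%:E = \int[mu]_y \int[mu]_r (h (r, y))%:E)%E.
  apply: (@fubini_tonelli _ _ _ _ _ mu mu (EFin \o h)) => //.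
    exact/measurable_EFinP.
transitivity (\int[mu]_r \int[mu]_y (h (r, y))%:E)%E.
  under [RHS]eq_integral do rewrite int_y.
  rewrite -(GammaE m2) muleC.
  have mg : measurable_fun [set: measurableTypeR R] (EFin \o gam (m + 2^-1)).
    exact/measurable_EFinP.
  have g0 x : setT x -> (0 <= (EFin \o gam (m + 2^-1)) x)%E by rewrite lee_fin.
  rewrite -(ge0_integralZl mu measurableT mg g0 k0).
  by apply: eq_integral => x _; rewrite muleC.
rewrite E; under eq_integral do rewrite int_r.
have g0 x : 0 <= @gauss_fun R x by exact: expR_ge0.
rewrite (ge0_integralZl_real (ltW (Gamma_gt0 m0)) (@measurable_gauss_fun R) g0).
by rewrite integralT_gauss -EFinM mulrC.
Qed.

(** Finiteness is read off [Beta_semicircle], which is stated in the extended reals for this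
    purpose: an infinite mass times the positive [Gamma (m + 2^-1)] could not equal a real
    number. *)
Lemma integrable_semicircle_weight : mu.-integrable setT (EFin \o k).
Proof.
have mk := measurable_semicircle_weight.
apply/integrableP; split; first exact/measurable_EFinP.
apply: (@le_lt_trans _ _ (\int[mu]_s (k s)%:E)%E).
  rewrite le_eqVlt; apply/orP; left; apply/eqP; apply: eq_integral => x _ /=.
  by rewrite ger0_norm// pos_powR_ge0.
have k0 : (0 <= \int[mu]_s (k s)%:E)%E.
  by apply: integral_ge0 => x _; rewrite lee_fin pos_powR_ge0.
have G0 : 0 < Gamma (m + 2^-1) by rewrite Gamma_gt0// addr_gt0.
have := Beta_semicircle; case: (\int[mu]_s (k s)%:E)%E k0 => //=.
- by move=> r _ _; exact: ltry.
- by move=> _; rewrite mulry gtr0_sg// mul1e.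
Qed.

Lemma Rintegral_semicircle_weight :
  \int[mu]_s k s = Num.sqrt pi * Gamma m / Gamma (m + 2^-1).
Proof.
have G0 : 0 < Gamma (m + 2^-1) by rewrite Gamma_gt0// addr_gt0.
apply: (mulfI (lt0r_neq0 G0)); rewrite mulrCA divff ?gt_eqF// mulr1.
have fk : (\int[mu]_s (k s)%:E)%E \is a fin_num.
  exact: integrable_fin_num integrable_semicircle_weight.
by have := Beta_semicircle; rewrite -(fineK fk) -EFinM => -[].
Qed.

End fixed.
End Beta.

(** * Averages against the weight and the Euler-Poisson-Darboux equation *)

Section averages.
Context (R : realType) (m : R).
Hypothesis m0 : 0 < m.
Notation mu := (@lebesgue_measure R).
Notation k := (semicircle_weight m).
Implicit Types f g : R -> R.

(** The power [s ^+ j] records the derivatives taken in [t]: each of them brings out a factor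
    [a * s]. *)
Definition weighted_average (j : nat) (a : R) f (t : R) : R :=
  \int[mu]_s (k s * s ^+ j * f (a * t * s)).
Local Notation J := weighted_average.

Lemma semicircle_weight_out s : 1 <= `|s| -> k s = 0.
Proof.
move=> s1; rewrite /semicircle_weight /pos_powR ifF//; apply/negbTE.
rewrite -leNgt subr_le0 -(real_normK (num_real s)).
by rewrite exprn_ege1.
Qed.

Lemma semicircle_weight_bound s j (M x : R) : `|x| <= M ->
  `|k s * s ^+ j * x| <= M * k s.
Proof.
move=> xM; have k0 := semicircle_weight_ge0 m s.
have [s1|s1] := leP 1 `|s|; first by rewrite semicircle_weight_out// !mul0r normr0 mulr0.
rewrite !normrM (ger0_norm k0) normrX mulrC ler_pM//.
  by rewrite mulr_ge0// exprn_ge0.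
by rewrite ler_piMr// exprn_ile1// ltW.
Qed.

Lemma measurable_average j a f t : continuous f ->
  measurable_fun [set: measurableTypeR R] (fun s => k s * s ^+ j * f (a * t * s)).
Proof.
move=> cf; apply: measurable_funM.
  by apply: measurable_funM; [exact: measurable_semicircle_weight|exact: measurable_funX].
apply: (@measurableT_comp _ _ _ _ _ _ f); first exact: continuous_measurable_fun.
exact: measurable_funM.
Qed.

Lemma integrable_average j a f t (M : R) : continuous f -> (forall x, `|f x| <= M) ->
  mu.-integrable setT (EFin \o (fun s => k s * s ^+ j * f (a * t * s))).
Proof.
move=> cf fM.
refine (@integrable_dominated _ _ _ mu setT (fun s => k s * s ^+ j * f (a * t * s)) (fun s => M * k s) measurableT _ _ _).
- exact: measurable_average.
- by move=> s _; exact: semicircle_weight_bound.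
- by apply: integrableZl_real => //; exact: integrable_semicircle_weight.
Qed.

(** The derivative falls on [f] alone, so the weight, integrable but possibly unbounded, provides
    the dominating function [|a| * M * k]. *)
Lemma is_derive_average j a f f' (M : R) :
  (forall x : R, is_derive x 1 f (f' x)) -> continuous f' ->
  (forall x, `|f x| <= M) -> (forall x, `|f' x| <= M) ->
  forall t : R, is_derive t 1 (J j a f) (a * J j.+1 a f' t).
Proof.
move=> ff' cf' fM f'M t.
have cf : continuous f by move=> x; exact: is_derive1_continuous (ff' x).
have M0 : 0 <= M by exact: le_trans (fM 0).
pose F (t s : R) := k s * s ^+ j * f (a * t * s).
pose G (s : R) := `|a| * M * k s.
have dF (x s : R) : is_derive x 1 (F^~ s) (a * (k s * s ^+ j.+1 * f' (a * x * s))).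
  have d1 : is_derive x 1 (fun x : R => a * x * s) (a * s).
    by apply: is_derive_eq; rewrite /GRing.scale/=; ring.
  have d2 := @is_derive1_comp R f (fun x => a * x * s) x _ _ (ff' _) d1.
  have d3 := is_deriveZ (k s * s ^+ j) d2.
  by apply: is_derive_eq; rewrite /GRing.scale/= exprS; ring.
have -> : a * J j.+1 a f' t = \int[mu]_s (a * (k s * s ^+ j.+1 * f' (a * t * s))).
  by rewrite RintegralZl//; exact: integrable_average cf' f'M.
apply: (@is_derive_Rintegral _ _ R mu F
  (fun x s => a * (k s * s ^+ j.+1 * f' (a * x * s))) G) => //.
- by move=> x; exact: integrable_average cf fM.
- move=> x s; rewrite normrM /G -[leRHS]mulrA ler_wpM2l//.
  exact: semicircle_weight_bound.
- by apply: integrableZl_real => //; exact: integrable_semicircle_weight.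
Qed.

(** The function [(1 - s^2)^m f (a t s)] vanishes at -1 and 1. Its derivative is
    [a t (1 - s^2) k f' - 2 m s k f], because [(1 - s^2)^m = (1 - s^2) k], and this has integral
    0. *)
Lemma average_ibp a f f' (M : R) :
  (forall x : R, is_derive x 1 f (f' x)) -> continuous f' ->
  (forall x, `|f x| <= M) -> (forall x, `|f' x| <= M) ->
  forall t, 2 * m * J 1 a f t = a * t * (J 0 a f' t - J 2 a f' t).
Proof.
move=> ff' cf' fM f'M t.
have cf : continuous f by move=> x; exact: is_derive1_continuous (ff' x).
have M0 : 0 <= M by exact: le_trans (fM 0).
pose F (s : R) := (1 - s ^+ 2) `^ m * f (a * t * s).
pose F' (s : R) := a * t * (k s * s ^+ 0 * f' (a * t * s) - k s * s ^+ 2 * f' (a * t * s))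
                   - 2 * m * (k s * s ^+ 1 * f (a * t * s)).
have s1 (s : R) : -1 < s < 1 -> 0 < 1 - s ^+ 2.
  move=> /andP[s1 s2]; have -> : 1 - s ^+ 2 = (1 - s) * (1 + s) by ring.
  by rewrite mulr_gt0//; lra.
pose D : set R := `]-1, 1[%classic.
have dq (s : R) : is_derive s 1 (fun s : R => 1 - s ^+ 2) (- (2 * s)).
  by apply: is_derive_eq; rewrite /GRing.scale/=; ring.
have df (s : R) : is_derive s 1 (fun s : R => f (a * t * s)) (f' (a * t * s) * (a * t)).
  apply: (@is_derive1_comp R f (fun s => a * t * s) s _ _ (ff' _)).
  by apply: is_derive_eq; rewrite /GRing.scale/=; ring.
have kE (s : R) : -1 < s < 1 -> k s = (1 - s ^+ 2) `^ (m - 1).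
  by move=> /s1 h; rewrite /semicircle_weight /pos_powR h.
have dF (s : R) : D s -> is_derive s 1 F (F' s).
  rewrite /D/= in_itv/= => sI; have h := s1 _ sI.
  have dp := @is_derive_powR_comp R (fun s => 1 - s ^+ 2) m s _ h (dq s).
  have dm := is_deriveM dp (df s).
  apply: (is_derive_eq dm); rewrite /GRing.scale/= /F' !(kE _ sI).
  have -> : (1 - s ^+ 2) `^ m = (1 - s ^+ 2) * (1 - s ^+ 2) `^ (m - 1).
    by rewrite mulr_powRB1// ltW.
  by ring.
have iF' : mu.-integrable setT (EFin \o F').
  apply: integrableB_real => //; apply: integrableZl_real => //; last first.
    exact: integrable_average fM.
  by apply: integrableB_real => //; exact: integrable_average f'M.
(* [F2] equals [F'] on the open interval, but is free of the case distinction in [pos_powR], so its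
   continuity there is immediate. *)
pose F2 (s : R) := (1 - s ^+ 2) `^ (m - 1) *
  (a * t * (f' (a * t * s) - s ^+ 2 * f' (a * t * s)) - 2 * m * (s * f (a * t * s))).
have F2E s : D s -> F' s = F2 s.
  by rewrite /D/= in_itv/= => sI; rewrite /F' /F2 (kE _ sI) expr0; ring.
have mD : measurable (D : set (measurableTypeR R)) by exact: measurable_itv.
have int0 : \int[mu]_s F' s = 0.
  have -> : \int[mu]_s F' s = \int[mu]_(s in D) F2 s.
    rewrite [RHS]Rintegral_mkcond; apply: eq_Rintegral => s _; rewrite patchE.
    case: ifPn => [/set_mem/F2E//|]; rewrite notin_setE /D/= in_itv/= => sD.
    have k0 : k s = 0.
      by apply: semicircle_weight_out; rewrite leNgt ltr_norml; apply/negP.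
    by rewrite /F' k0 !mul0r subrr !mulr0 subrr.
  apply: (@FTC_exhaustion R F2 F D (fun n => -1 + n.+2%:R^-1) (fun n => 1 - n.+2%:R^-1)).
  - exact: interval_open.
  - move=> n; have : (n.+2%:R^-1 : R) <= 2^-1 by rewrite lef_pV2 ?posrE// ler_nat.
    by set y := _^-1 => ?; lra.
  - move=> n x; have : 0 < (n.+2%:R^-1 : R) by rewrite invr_gt0.
    rewrite /D/= !in_itv/=; set y := _^-1.
    by move=> ? /andP[? ?]; apply/andP; split; lra.
  - move=> x; rewrite /D/= in_itv/= => /andP[x1 x2].
    have y0 : 0 < Num.min (x + 1) (1 - x) by rewrite lt_min; apply/andP; split; lra.
    near=> n.
    have : n.+2%:R^-1 <= Num.min (x + 1) (1 - x).
      rewrite -[leRHS]invrK lef_pV2 ?posrE ?invr_gt0//.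
      apply: (@le_trans _ _ n%:R); last by rewrite ler_nat -addn2 leq_addr.
      by near: n; exact: nbhs_infty_ger.
    rewrite le_min in_itv/=; set y := _^-1.
    by move=> /andP[? ?]; apply/andP; split; lra.
  - by move=> s Ds; rewrite -F2E//; exact: dF.
  - move=> s; rewrite /D/= in_itv/= => sI; have h := s1 _ sI.
    have cp : {for s, continuous (fun s : R => (1 - s ^+ 2) `^ (m - 1))}.
      apply: is_derive1_continuous.
      exact: (@is_derive_powR_comp R (fun s => 1 - s ^+ 2) (m - 1) s _ h (dq s)).
    have cf2 g : continuous g -> {for s, continuous (fun s : R => g (a * t * s))}.
      move=> cg; apply: continuous_comp; last exact: cg.
      by apply: continuousM => //; exact: cst_continuous.
    have cid : {for s, continuous (fun s : R => s)} by [].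
    apply: continuousM => //; apply: continuousB.
      apply: continuousM; first exact: cst_continuous.
      apply: continuousB; first exact: cf2.
      by apply: continuousM; [exact: exprn_continuous|exact: cf2].
    apply: continuousM; first exact: cst_continuous.
    by apply: continuousM => //; exact: cf2.
  - have iF'D : mu.-integrable D (EFin \o F') by exact: integrableS iF'.
    by apply: eq_integrable iF'D => // s /set_mem/F2E /= ->.
  - apply/cvgr0Pnorm_le => e e0.
    (* At distance [y] from an endpoint, [1 - s^2 = 2 y - y^2 <= 2 y], so [|F| <= (2 y)^m M]. The
       two endpoints together cost [2 M] times the bound on [(2 y)^m]; the [+ 1] covers [M = 0]. *)
    have M1 : 0 < 2 * M + 1 by lra.
    have /cvgr0Pnorm_le/(_ _ (divr_gt0 e0 M1)) := powR_cvg0 m0.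
    rewrite near_withinE => -[r /= r0 rP].
    near=> n; set y : R := n.+2%:R^-1.
    have y0 : 0 < y by rewrite invr_gt0.
    have y2 : y <= 2^-1 by rewrite lef_pV2 ?posrE// ler_nat.
    have yr : 2 * y < r.
      rewrite mulrC -ltr_pdivlMr// -[ltRHS]invrK ltf_pV2 ?posrE ?invr_gt0 ?divr_gt0//.
      apply: (@le_lt_trans _ _ n%:R); last by rewrite ltr_nat leqW.
      by near: n; exact: nbhs_infty_ger.
    have zp : `|(2 * y) `^ m| <= e / (2 * M + 1).
      by apply: rP => //=; [rewrite sub0r normrN gtr0_norm//; lra|lra].
    have Fb x : 1 - x ^+ 2 <= 2 * y -> 0 <= 1 - x ^+ 2 -> `|F x| <= e / (2 * M + 1) * M.
      move=> h1 h2; rewrite /F normrM ler_pM// (le_trans _ zp)//.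
      by rewrite !ger0_norm ?powR_ge0// ge0_ler_powR ?nnegrE ?(ltW m0)//; lra.
    apply: le_trans (ler_normB _ _) _.
    have := Fb (1 - y); have -> : 1 - (1 - y) ^+ 2 = 2 * y - y * y by ring.
    have := Fb (-1 + y); have -> : 1 - (-1 + y) ^+ 2 = 2 * y - y * y by ring.
    have yy : 0 <= y * y by rewrite mulr_ge0// ltW.
    have yy2 : y * y <= 2 * y by rewrite ler_pM2r//; lra.
    move=> /(_ ltac:(lra) ltac:(lra)) h1 /(_ ltac:(lra) ltac:(lra)) h2.
    apply: (le_trans (lerD h2 h1)).
    rewrite -mulrDr mulrAC ler_pdivrMr// ler_pM2l//; lra.
have iA j g : continuous g -> (forall x, `|g x| <= M) ->
    mu.-integrable setT (EFin \o (fun s => k s * s ^+ j * g (a * t * s))).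
  by move=> cg gM; exact: integrable_average cg gM.
move: int0; rewrite /F' RintegralB//; last 2 first.
- by apply: integrableZl_real => //; apply: integrableB_real => //; exact: iA.
- by apply: integrableZl_real => //; exact: iA.
rewrite !RintegralZl//; last 2 first.
- exact: iA.
- by apply: integrableB_real => //; exact: iA.
rewrite RintegralB//; [|exact: iA..].
by move=> /eqP; rewrite subr_eq0 => /eqP.
Unshelve. all: end_near. Qed.

(** [average_ibp] for [f1] reads [2 m J 1 f1 = a t (J 0 f2 - J 2 f2)]. Multiplied by [a / t] it is
    the equation; at [t = 0] its right side vanishes, which gives the zero initial velocity. *)
Lemma average_epd a f f1 f2 (M : R) :
  (forall x : R, is_derive x 1 f (f1 x)) -> (forall x : R, is_derive x 1 f1 (f2 x)) ->
  continuous f2 -> (forall x, `|f x| <= M) -> (forall x, `|f1 x| <= M) ->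
  (forall x, `|f2 x| <= M) -> forall t : R,
  [/\ is_derive t 1 (J 0 a f) (a * J 1 a f1 t),
      is_derive t 1 (fun t => a * J 1 a f1 t) (a ^+ 2 * J 2 a f2 t),
      J 1 a f1 0 = 0 &
      t != 0 -> a ^+ 2 * J 2 a f2 t + 2 * m / t * (a * J 1 a f1 t) = a ^+ 2 * J 0 a f2 t].
Proof.
move=> ff1 ff2 cf2 fM f1M f2M t.
have cf1 : continuous f1 by move=> x; exact: is_derive1_continuous (ff2 x).
split.
- exact: is_derive_average fM f1M _.
- have d := is_deriveZ a (is_derive_average 1 a ff2 cf2 f1M f2M t).
  by apply: is_derive_eq; rewrite /GRing.scale/=; ring.
- have /eqP := average_ibp a ff2 cf2 f1M f2M 0.
  by rewrite mulr0 mul0r mulf_eq0 gt_eqF ?mulr_gt0// => /eqP.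
- move=> t0; have := average_ibp a ff2 cf2 f1M f2M t => ibp.
  have -> : 2 * m / t * (a * J 1 a f1 t) = a / t * (2 * m * J 1 a f1 t) by ring.
  rewrite ibp; field; exact: t0.
Qed.

End averages.

(** * The kernel as a fundamental solution *)

Section epd.
Context (R : realType) (d : nat) (gamma c : R).
Hypotheses (d_ge1 : (1 <= d)%N) (gamma_gt0 : 0 < gamma) (c_gt0 : 0 < c).
Notation mu := (@lebesgue_measure R).

(** [2 * m = d + 2 * gamma - 1] is the coefficient of the singular term, and [m - 1] is the exponent
    in the kernel. *)
Let m : R := d%:R / 2 + gamma - 2^-1.

Lemma epd_exponent_gt0 : 0 < m.
Proof.
have : 1 <= d%:R :> R by rewrite ler1n.
by rewrite /m; move: gamma_gt0; lra.
Qed.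

Let m0 := epd_exponent_gt0.
Notation k := (semicircle_weight m).
Notation J := (weighted_average m).

(** The reciprocal of the total mass found in [Rintegral_semicircle_weight]. *)
Definition epd_const : R := Gamma (m + 2^-1) / (Num.sqrt pi * Gamma m).
Notation A := epd_const.

Lemma epd_const_average a t : A * J 0 a (cst 1) t = 1.
Proof.
have -> : J 0 a (cst 1) t = \int[mu]_s k s.
  by apply: eq_Rintegral => s _; rewrite expr0 !mulr1.
rewrite Rintegral_semicircle_weight// /A.
have G1 := Gamma_gt0 m0.
have G2 : 0 < Gamma (m + 2^-1) by apply: Gamma_gt0; rewrite addr_gt0.
have sp : 0 < Num.sqrt pi :> R by rewrite sqrtr_gt0 pi_gt0.
move: (Gamma m) (Gamma _) (Num.sqrt pi) G1 G2 sp => x y z x0 y0 z0.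
by field; rewrite !gt_eqF.
Qed.

(** The trailing [+ 0] gives the argument the shape [a * w + b] of the affine change of variable. *)
Lemma epd_kernelE w t : 0 < t ->
  epd_kernel d gamma c w t = A / (c * t) * k ((c * t)^-1 * w + 0).
Proof.
move=> t0; rewrite /epd_kernel /semicircle_weight -/m.
have -> : gamma + d%:R / 2 = m + 2^-1 by rewrite /m; ring.
have -> : 1 - w ^+ 2 / (c ^+ 2 * t ^+ 2) = 1 - ((c * t)^-1 * w + 0) ^+ 2.
  by field; rewrite !gt_eqF.
by rewrite /A [in LHS]invfM mulrA.
Qed.

Lemma integrable_epd_kernel t : 0 < t ->
  mu.-integrable setT (EFin \o epd_kernel d gamma c ^~ t).
Proof.
move=> t0; have ct : 0 < (c * t)^-1 by rewrite invr_gt0 mulr_gt0.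
have := integrable_affine 0 ct (integrable_semicircle_weight m0).
move=> /(@integrableZl_real _ _ _ mu _ _ (A / (c * t)) measurableT).
by apply: eq_integrable => // w _; rewrite /= epd_kernelE.
Qed.

(** The substitution [w = c t s] moves the dependence on [t] from the kernel into [f], where it can
    be differentiated. *)
Lemma epd_kernel_pairing (f : R -> R) (M t : R) : 0 < t -> continuous f ->
  (forall x, `|f x| <= M) -> \int[mu]_w (epd_kernel d gamma c w t * f w) = A * J 0 c f t.
Proof.
move=> t0 cf fM; have ct0 : 0 < c * t by rewrite mulr_gt0.
have ct : 0 < (c * t)^-1 by rewrite invr_gt0.
have gi := integrable_average m0 0 c t cf fM.
have := Rintegral_affine 0 ct gi; rewrite invrK => E.
have -> : \int[mu]_w (epd_kernel d gamma c w t * f w) =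
  \int[mu]_w (A / (c * t) * (k ((c * t)^-1 * w + 0) * ((c * t)^-1 * w + 0) ^+ 0 *
                             f (c * t * ((c * t)^-1 * w + 0)))).
  apply: eq_Rintegral => w _; rewrite epd_kernelE// expr0 mulr1 -mulrA.
  by congr (_ * (_ * f _)); rewrite addr0 mulVKf// gt_eqF.
rewrite (RintegralZl (mu := mu) _ measurableT (integrable_affine 0 ct gi)) E.
by rewrite mulrA divfK// gt_eqF.
Qed.

(** Unlike the kernel, the average makes sense at [t = 0], where it is differentiable and equals
    [f 0] by the normalization. *)
Lemma epd_kernel_continuous_at0 (f f1 : R -> R) (M : R) :
  (forall x : R, is_derive x 1 f (f1 x)) -> continuous f1 ->
  (forall x, `|f x| <= M) -> (forall x, `|f1 x| <= M) ->
  A * J 0 c f t @[t --> 0^'+] --> f 0.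
Proof.
move=> ff1 cf1 fM f1M; apply: cvg_at_right_filter.
have -> : f 0 = A * J 0 c f 0.
  rewrite -[LHS]mulr1 -(epd_const_average c 0) mulrCA; congr (_ * _).
  rewrite /weighted_average -RintegralZl//; last first.
    by apply: (@integrable_average _ _ m0 _ _ _ _ 1) => x; [exact: cst_continuous|rewrite normr1].
  by apply: eq_Rintegral => s _; rewrite mulr0 mul0r mulrC mulr1.
apply: is_derive1_continuous (is_deriveZ A (is_derive_average m0 0 c ff1 cf1 fM f1M 0)).
Qed.

Lemma test_function_bounded (psi : R -> R) : test_function psi ->
  exists M : R, forall n, (n <= 2)%N -> forall x, `|derive1n n psi x| <= M.
Proof.
move=> [dpsi [M0 psiM]].
(* The maximum with 0 makes [[- M, M]] nonempty, as the extreme value theorem requires. *)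
pose M := Num.max M0 0.
have dM n x : M < `|x| -> derive1n n psi x = 0.
  elim: n x => [|n IH] x Mx.
    by rewrite derive1n0; apply: psiM; apply: le_lt_trans Mx; rewrite le_max lexx.
  (* The set where [M < |x|] is open, so the previous derivative vanishes on a neighbourhood of
     [x]. *)
  rewrite derive1nS derive1E (@near_eq_derive _ _ _ _ (cst 0)) ?derive_cst//.
  have := @norm_continuous R R x.
  move=> /cvgr_gt/(_ _ Mx); apply: filterS => y; exact: IH.
have cn n : continuous (derive1n n psi).
  by move=> x; apply/differentiable_continuous/derivable1_diffP; exact: dpsi.
have bd n : exists C, forall x, `|derive1n n psi x| <= C.
  have MM : - M <= M by rewrite ge0_cp// le_max lexx orbT.
  have cabs : {within `[- M, M], continuous (fun x => `|derive1n n psi x|)}.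
    apply: continuous_subspaceT => x; apply: continuous_comp; first exact: cn.
    exact: norm_continuous.
  have [x0 _ x0P] := EVT_max MM cabs.
  exists (`|derive1n n psi x0|) => x; have [xM|xM] := ltP M `|x|.
    by rewrite dM// normr0.
  by apply: x0P; rewrite in_itv/= -ler_norml.
have [C0 h0] := bd 0%N; have [C1 h1] := bd 1%N; have [C2 h2] := bd 2%N.
exists (Num.max C0 (Num.max C1 C2)) => -[|[|[|//]]] _ x; rewrite !le_max.
- by rewrite h0.
- by rewrite h1 orbT.
- by rewrite h2 !orbT.
Qed.

Theorem epd_kernel_fundamental :
  is_fundamental_solution c (fun t => (gamma + d%:R / 2 - 2^-1) / t) (epd_kernel d gamma c).
Proof.
split.
  move=> t t0; apply: open_integrable_locally; first exact: openT.
  exact: integrable_epd_kernel.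
move=> psi tpsi G; have [M psiM] := test_function_bounded tpsi.
have [dpsi _] := tpsi.
have ff1 (x : R) : is_derive x 1 psi (derive1n 1 psi x).
  by apply: DeriveDef; [exact: (dpsi 0%N)|rewrite -derive1E].
have ff2 (x : R) : is_derive x 1 (derive1n 1 psi) (derive1n 2 psi x).
  by apply: DeriveDef; [exact: (dpsi 1%N)|rewrite -derive1E].
have cf1 : continuous (derive1n 1 psi).
  by move=> x; apply/differentiable_continuous/derivable1_diffP; exact: dpsi.
have cf2 : continuous (derive1n 2 psi).
  by move=> x; apply/differentiable_continuous/derivable1_diffP; exact: dpsi.
have cf : continuous psi by move=> x; exact: is_derive1_continuous (ff1 x).
have psi0 := psiM 0%N isT; have psi1 := psiM 1%N isT; have psi2 := psiM 2%N isT.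
have EPD := average_epd m0 c ff1 ff2 cf2 psi0 psi1 psi2.
have GE t : 0 < t -> G t = A * J 0 c psi t.
  by move=> t0; exact: (epd_kernel_pairing t0 cf psi0).
(* [G] agrees with the average for positive times only; since these form an open set, derivatives
   carry over from the average to [G]. *)
have near_pos (t : R) (P : R -> Prop) : 0 < t -> (forall s, 0 < s -> P s) -> \near t, P t.
  by move=> t0 hP; near=> s; apply: hP; near: s; exact: lt_nbhsr.
have dG (t : R) : 0 < t -> is_derive t 1 G (A * (c * J 1 c (derive1n 1 psi) t)).
  move=> t0; have [d1 _ _ _] := EPD t.
  apply: near_eq_is_derive (is_deriveZ A d1).
  by apply: near_pos => // s s0; rewrite GE.
have G1E (t : R) : 0 < t -> derive1 G t = A * (c * J 1 c (derive1n 1 psi) t).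
  by move=> t0; rewrite derive1E; apply: derive_val; exact: dG.
have dG1 (t : R) : 0 < t ->
    is_derive t 1 (derive1 G) (A * (c ^+ 2 * J 2 c (derive1n 2 psi) t)).
  move=> t0; have [_ d1 _ _] := EPD t.
  apply: near_eq_is_derive (is_deriveZ A d1).
  by apply: near_pos => // s s0; rewrite G1E.
split.
- move=> t t0; have [dGt dG1t] := (dG t t0, dG1 t t0).
  split; [by case: dGt|by case: dG1t|].
  rewrite derive1nS derive1n1 [X in X + _]derive1E (derive_val (is_derive := dG1t)) G1E//.
  rewrite /pairing (epd_kernel_pairing t0 cf2 psi2).
  have [_ _ _ /(_ (lt0r_neq0 t0)) E] := EPD t.
  rewrite [RHS]mulrCA -E /m.
  move: (J 2 _ _ _) (J 1%N _ _ _) A => j2 j1 a; ring.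
- apply: cvg_trans (epd_kernel_continuous_at0 ff1 cf1 psi0 psi1).
  apply: near_eq_cvg; near=> t; rewrite GE//; near: t; exact: nbhs_right_gt.
- have [_ _ J10 _] := EPD 0.
  have [_ d2 _ _] := EPD 0.
  have h : A * (c * J 1 c (derive1n 1 psi) t) @[t --> 0^'+] -->
      A * (c * J 1 c (derive1n 1 psi) 0).
    apply: cvg_at_right_filter.
    exact: is_derive1_continuous (is_deriveZ A d2).
  rewrite J10 !mulr0 in h; apply: cvg_trans h; apply: near_eq_cvg.
  near=> t; rewrite G1E//; near: t; exact: nbhs_right_gt.
Unshelve. all: end_near. Qed.

End epd.

(** * Gaussian integrals *)

Section gaussian.
Context (R : realType).
Notation mu := (@lebesgue_measure R).

Definition gaussian (del s : R) : R := expR (- (del * s) ^+ 2).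

Lemma gaussian_ge0 del s : 0 <= gaussian del s.
Proof. exact: expR_ge0. Qed.

Lemma is_derive_gaussian del (s : R) :
  is_derive s 1 (gaussian del) (- (2 * del ^+ 2 * s) * gaussian del s).
Proof.
have d1 : is_derive s 1 (fun s : R => - (del * s) ^+ 2) (- (2 * del ^+ 2 * s)).
  by apply: is_derive_eq; rewrite /GRing.scale/=; ring.
have := is_derive1_comp (is_derive_expR _) d1.
by rewrite mulrC.
Qed.

Lemma continuous_gaussian del : continuous (gaussian del).
Proof. by move=> s; exact: is_derive1_continuous (is_derive_gaussian del s). Qed.

(* (1 + |s|)^k <= e^(k |s|), then complete the square. *)
Lemma gaussian_poly_bound del k : 0 < del ->
  exists C : R, forall s, (1 + `|s|) ^+ k * gaussian del s <= C.
Proof.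
move=> d0; exists (expR (k%:R ^+ 2 / (2 * del) ^+ 2)) => s.
apply: (@le_trans _ _ (expR (k%:R * `|s|) * gaussian del s)).
  rewrite ler_wpM2r ?gaussian_ge0// mulrC expRM_natr lerXn2r ?nnegrE ?expR_ge0 ?addr_ge0//.
  exact: expR_ge1Dx.
rewrite -expRD ler_expR -subr_ge0 -(real_normK (num_real (del * s))) normrM (gtr0_norm d0).
have -> : k%:R ^+ 2 / (2 * del) ^+ 2 - (k%:R * `|s| - (del * `|s|) ^+ 2) =
  (k%:R / (2 * del) - del * `|s|) ^+ 2 by field; rewrite gt_eqF.
exact: sqr_ge0.
Qed.

(** Two spare powers of [1 + |s|] pay for the factor [1 + s^2]. *)
Lemma gaussian_decay_bound del k : 0 < del ->
  exists C : R, forall s, (1 + `|s|) ^+ k * gaussian del s <= C * (1 + s ^+ 2)^-1.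
Proof.
move=> d0; have [C CP] := gaussian_poly_bound k.+2 d0; exists C => s.
rewrite ler_pdivlMr; last by rewrite ltr_pwDl// sqr_ge0.
apply: le_trans (CP s).
have h : 1 + s ^+ 2 <= (1 + `|s|) ^+ 2.
  by rewrite -(real_normK (num_real s)); have := normr_ge0 s; nra.
have -> : (1 + `|s|) ^+ k.+2 * gaussian del s =
  (1 + `|s|) ^+ k * gaussian del s * (1 + `|s|) ^+ 2 by rewrite !exprS; ring.
by rewrite ler_wpM2l// mulr_ge0 ?gaussian_ge0// exprn_ge0// addr_ge0.
Qed.

Lemma integrable_gaussian_poly del k : 0 < del ->
  mu.-integrable setT (EFin \o (fun s => (1 + `|s|) ^+ k * gaussian del s)).
Proof.
move=> d0; have [C CP] := gaussian_decay_bound k d0.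
apply: (@integrable_dominated _ _ _ mu setT _ (fun s => C * (1 + s ^+ 2)^-1)) => //.
- apply: measurable_funM; last exact: continuous_measurable_fun (@continuous_gaussian _).
  by apply: measurable_funX; exact: measurable_funD.
- move=> s _; rewrite ger0_norm ?CP// mulr_ge0 ?gaussian_ge0// exprn_ge0// addr_ge0//.
- by apply: integrableZl_real => //; exact: integrable_inv1Dsqr.
Qed.

Lemma integrable_gaussian_mul del k (f : R -> R) : 0 < del ->
  continuous f -> (forall s, `|f s| <= (1 + `|s|) ^+ k) ->
  mu.-integrable setT (EFin \o (fun s => f s * gaussian del s)).
Proof.
move=> d0 cf fk.
apply: (@integrable_dominated _ _ _ mu setT _ (fun s => (1 + `|s|) ^+ k * gaussian del s)) => //.
- apply: measurable_funM; first exact: continuous_measurable_fun.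
  exact: continuous_measurable_fun (@continuous_gaussian _).
- by move=> s _; rewrite normrM (ger0_norm (gaussian_ge0 _ _)) ler_wpM2r ?gaussian_ge0.
- exact: integrable_gaussian_poly.
Qed.

Lemma Rintegral_gaussian del : 0 < del ->
  \int[mu]_s gaussian del s = Num.sqrt pi / del.
Proof.
move=> d0; have gi : mu.-integrable setT (EFin \o @gauss_fun R).
  have := @integrableT_gauss R; exact.
have := Rintegral_affine 0 d0 gi.
have -> : \int[mu]_s gauss_fun s = Num.sqrt pi :> R by rewrite /Rintegral integralT_gauss.
by rewrite mulrC => <-; apply: eq_Rintegral => s _; rewrite addr0.
Qed.

Section transform.
Variables (del : R) (d0 : 0 < del).
Notation g := (gaussian del).

Let lin_cont (f : R -> R) (z : R) : continuous f -> continuous (fun s => f (z * s)).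
Proof.
move=> cf s; apply: continuous_comp; last exact: cf.
by apply: continuousM => //; exact: cst_continuous.
Qed.

Let cos1 (x : R) : `|cos x| <= 1. Proof. by rewrite ler_norml cos_geN1 cos_le1. Qed.
Let sin1 (x : R) : `|sin x| <= 1. Proof. by rewrite ler_norml sin_geN1 sin_le1. Qed.

Let icos z : mu.-integrable setT (EFin \o (fun s => cos (z * s) * g s)).
Proof.
apply: (integrable_gaussian_mul (k := 0)) => //; first exact/lin_cont/continuous_cos.
Qed.

Let isin z : mu.-integrable setT (EFin \o (fun s => sin (z * s) * g s)).
Proof.
apply: (integrable_gaussian_mul (k := 0)) => //; first exact/lin_cont/continuous_sin.
Qed.

Let s_bound (s x : R) : `|x| <= 1 -> `|s * x| <= (1 + `|s|) ^+ 1.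
Proof. by move=> x1; rewrite normrM expr1 (@le_trans _ _ `|s|)// ?ler_piMr// lerDr. Qed.

Let iscos z : mu.-integrable setT (EFin \o (fun s => s * cos (z * s) * g s)).
Proof.
apply: (integrable_gaussian_mul (k := 1)) => // [s|s]; last exact: s_bound.
have cid : {for s, continuous (fun s : R => s)} by [].
by apply: continuousM; [exact: cid|have := @lin_cont _ z (@continuous_cos R) s; exact].
Qed.

Let issin z : mu.-integrable setT (EFin \o (fun s => s * sin (z * s) * g s)).
Proof.
apply: (integrable_gaussian_mul (k := 1)) => // [s|s]; last exact: s_bound.
have cid : {for s, continuous (fun s : R => s)} by [].
by apply: continuousM; [exact: cid|have := @lin_cont _ z (@continuous_sin R) s; exact].
Qed.

Let dcos (z s : R) : is_derive s 1 (fun s : R => cos (z * s)) (- sin (z * s) * z).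
Proof.
apply: (@is_derive1_comp R cos (fun s => z * s) s _ _ (is_derive_cos _)).
by apply: is_derive_eq; rewrite /GRing.scale/= mulr1.
Qed.

Let dsin (z s : R) : is_derive s 1 (fun s : R => sin (z * s)) (cos (z * s) * z).
Proof.
apply: (@is_derive1_comp R sin (fun s => z * s) s _ _ (is_derive_sin _)).
by apply: is_derive_eq; rewrite /GRing.scale/= mulr1.
Qed.

(** The derivative of [f g] is [f' g - 2 del^2 s f g], and [f g] is small enough at infinity for its
    integral to be 0. *)
Let ibp (f f' : R -> R) : (forall s : R, is_derive s 1 f (f' s)) -> continuous f' ->
  (forall s, `|f s| <= 1) ->
  mu.-integrable setT (EFin \o (fun s => f' s * g s)) ->
  mu.-integrable setT (EFin \o (fun s => s * f s * g s)) ->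
  2 * del ^+ 2 * \int[mu]_s (s * f s * g s) = \int[mu]_s (f' s * g s).
Proof.
move=> df cf' f1 if' isf.
have cf : continuous f by move=> s; exact: is_derive1_continuous (df s).
have [C CP] := gaussian_decay_bound 0 d0.
have : \int[mu]_s (f' s * g s - 2 * del ^+ 2 * (s * f s * g s)) = 0.
  apply: (@FTC_Rintegral0 _ _ (fun s => f s * g s)).
  - move=> s; have := is_deriveM (df s) (is_derive_gaussian del s) => dm.
    by apply: (is_derive_eq dm); rewrite /GRing.scale/=; ring.
  - move=> s; have cg := @continuous_gaussian del s.
    have cid : {for s, continuous (fun s : R => s)} by [].
    suff : {for s, continuous (fun s => f' s * g s - 2 * del ^+ 2 * (s * f s * g s))} by [].
    apply: continuousB; first by apply: continuousM; [exact: cf'|exact: cg].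
    apply: continuousM; first exact: cst_continuous.
    apply: continuousM => //; apply: continuousM => //; exact: cf.
  - by apply: integrableB_real => //; exact: integrableZl_real.
  - exists C => s; rewrite normrM (ger0_norm (gaussian_ge0 _ _)).
    by apply: le_trans (CP s); rewrite ler_wpM2r ?gaussian_ge0.
rewrite RintegralB//; last exact: integrableZl_real.
by rewrite RintegralZl// => /eqP; rewrite subr_eq0 => /eqP.
Qed.

(** Multiplication by the integrating factor [expR ((z / (2 del))^2)] produces a function with zero
    derivative. *)
Let transform_ode (f : R -> R) :
  (forall z : R, is_derive z 1 f (- (z / (2 * del ^+ 2)) * f z)) ->
  forall z, f z = f 0 * expR (- (z / (2 * del)) ^+ 2).
Proof.
move=> df z; pose h (z : R) := f z * expR ((z / (2 * del)) ^+ 2).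
have dh (x : R) : is_derive x 1 h 0.
  have d1 : is_derive x 1 (fun z : R => (z / (2 * del)) ^+ 2) (x / (2 * del ^+ 2)).
    by apply: is_derive_eq; rewrite /GRing.scale/=; field; rewrite gt_eqF.
  have := is_derive1_comp (is_derive_expR _) d1 => d2.
  have dm := is_deriveM (df x) d2.
  by apply: (is_derive_eq dm); rewrite /GRing.scale/=; ring.
have : h z = h 0 by exact: is_derive_0_is_cst.
rewrite /h mul0r expr0n/= expR0 mulr1 => <-.
by rewrite -mulrA -expRD subrr expR0 mulr1.
Qed.

(** Differentiating in [z] gives [- s sin (z s)] against the Gaussian, which [ibp] converts back
    into a multiple of the cosine integral. This is the equation solved by [transform_ode]. *)
Lemma Rintegral_cos_gaussian z :
  \int[mu]_s (cos (z * s) * g s) = Num.sqrt pi / del * expR (- (z / (2 * del)) ^+ 2).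
Proof.
have dF (x : R) : is_derive x 1 (fun z => \int[mu]_s (cos (z * s) * g s))
    (- (x / (2 * del ^+ 2)) * \int[mu]_s (cos (x * s) * g s)).
  have -> : - (x / (2 * del ^+ 2)) * \int[mu]_s (cos (x * s) * g s) =
      \int[mu]_s (- (s * sin (x * s) * g s)).
    under [RHS]eq_Rintegral do rewrite -mulN1r.
    rewrite RintegralZl//.
    have icx : mu.-integrable setT (EFin \o (fun s => cos (x * s) * x * g s)).
      by have := integrableZl_real x measurableT (icos x);
        apply: eq_integrable => // s _ /=; congr EFin; ring.
    have cf' : continuous (fun s => cos (x * s) * x).
      move=> s; apply: continuousM; last exact: cst_continuous.
      have := @lin_cont _ x (@continuous_cos R) s; exact.
    have := ibp (dsin x) cf' (fun s => sin1 _) icx (issin x).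
    have -> : \int[mu]_s (cos (x * s) * x * g s) = x * \int[mu]_s (cos (x * s) * g s).
      by rewrite -RintegralZl//; apply: eq_Rintegral => s _; ring.
    move=> E; have -> : x / (2 * del ^+ 2) = (2 * del ^+ 2)^-1 * x by rewrite mulrC.
    rewrite mulNr -mulrA -E mulrA mulVf ?mul1r ?mulN1r// mulf_neq0// expf_neq0// gt_eqF//.
  apply: (@is_derive_Rintegral _ _ R mu (fun x s => cos (x * s) * g s)
    (fun x s => - (s * sin (x * s) * g s)) (fun s => (1 + `|s|) ^+ 1 * g s)) => //.
  - move=> y s; have d1 := dcos s y.
    have : is_derive y 1 (fun y : R => cos (y * s)) (- sin (y * s) * s).
      by have := dcos s y; under eq_fun do rewrite mulrC; rewrite [s * y]mulrC.
    move=> d2; have dm := is_deriveM d2 (is_derive_cst (g s) y 1).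
    by apply: (is_derive_eq dm); rewrite /GRing.scale/=; ring.
  - move=> y s; rewrite normrN normrM (ger0_norm (gaussian_ge0 _ _)).
    by rewrite ler_wpM2r ?gaussian_ge0 ?s_bound.
  - exact: integrable_gaussian_poly.
rewrite (transform_ode dF).
congr (_ * _); rewrite -Rintegral_gaussian//.
by apply: eq_Rintegral => s _; rewrite mul0r cos0 mul1r.
Qed.

(** The sine integral satisfies the same linear equation as the cosine integral and vanishes at
    [z = 0]. *)
Lemma Rintegral_sin_gaussian z : \int[mu]_s (sin (z * s) * g s) = 0.
Proof.
have dF (x : R) : is_derive x 1 (fun z => \int[mu]_s (sin (z * s) * g s))
    (- (x / (2 * del ^+ 2)) * \int[mu]_s (sin (x * s) * g s)).
  have -> : - (x / (2 * del ^+ 2)) * \int[mu]_s (sin (x * s) * g s) =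
      \int[mu]_s (s * cos (x * s) * g s).
    have isx : mu.-integrable setT (EFin \o (fun s => - sin (x * s) * x * g s)).
      by have := integrableZl_real (- x) measurableT (isin x);
        apply: eq_integrable => // s _ /=; congr EFin; ring.
    have cf' : continuous (fun s => - sin (x * s) * x).
      move=> s; suff : {for s, continuous (fun s => - sin (x * s) * x)} by [].
      apply: continuousM; last exact: cst_continuous.
      by apply: continuousN; have := @lin_cont _ x (@continuous_sin R) s; exact.
    have := ibp (dcos x) cf' (fun s => cos1 _) isx (iscos x).
    have -> : \int[mu]_s (- sin (x * s) * x * g s) = - x * \int[mu]_s (sin (x * s) * g s).
      by rewrite -RintegralZl//; apply: eq_Rintegral => s _; ring.
    move=> E; have -> : - (x / (2 * del ^+ 2)) = (2 * del ^+ 2)^-1 * - x by ring.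
    by rewrite -mulrA -E mulrA mulVf ?mul1r// mulf_neq0// expf_neq0// gt_eqF.
  apply: (@is_derive_Rintegral _ _ R mu (fun x s => sin (x * s) * g s)
    (fun x s => s * cos (x * s) * g s) (fun s => (1 + `|s|) ^+ 1 * g s)) => //.
  - move=> y s; have d2 : is_derive y 1 (fun y : R => sin (y * s)) (cos (y * s) * s).
      have := dsin s y; under eq_fun do rewrite mulrC; by rewrite [s * y]mulrC.
    have dm := is_deriveM d2 (is_derive_cst (g s) y 1).
    by apply: (is_derive_eq dm); rewrite /GRing.scale/=; ring.
  - move=> y s; rewrite normrM (ger0_norm (gaussian_ge0 _ _)).
    by rewrite ler_wpM2r ?gaussian_ge0 ?s_bound.
  - exact: integrable_gaussian_poly.
rewrite (transform_ode dF).
have -> : \int[mu]_s (sin (0 * s) * g s) = \int[mu]_s (0 : R).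
  by apply: eq_Rintegral => s _; rewrite mul0r sin0 mul0r.
by rewrite Rintegral_cst// !mul0r.
Qed.

End transform.
End gaussian.

Local Open Scope complex_scope.
Import ComplexField.Normc.
Local Notation Re := complex.Re.
Local Notation Im := complex.Im.

(** * Complex-valued integrals *)

Section complex_basics.
Context (R : realType).
Implicit Types (x y z : R[i]).

Lemma complex_eq x y : Re x = Re y -> Im x = Im y -> x = y.
Proof. by case: x y => [a b] [c d] /= -> ->. Qed.

Lemma ReD x y : Re (x + y) = Re x + Re y.
Proof. by case: x y => [a b] [c d]. Qed.

Lemma ImD x y : Im (x + y) = Im x + Im y.
Proof. by case: x y => [a b] [c d]. Qed.

Lemma ReM x y : Re (x * y) = Re x * Re y - Im x * Im y.
Proof. by case: x y => [a b] [c d]. Qed.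

Lemma ImM x y : Im (x * y) = Re x * Im y + Im x * Re y.
Proof. by case: x y => [a b] [c d] /=; rewrite addrC. Qed.

Lemma Re_realM (a : R) z : Re (a%:C * z) = a * Re z.
Proof. by rewrite ReM/= mul0r subr0. Qed.

Lemma Im_realM (a : R) z : Im (a%:C * z) = a * Im z.
Proof. by rewrite ImM/= mul0r addr0. Qed.

Lemma normc_ge_absRe z : `|Re z| <= normc z.
Proof. by case: z => a b /=; rewrite -sqrtr_sqr ler_wsqrtr// lerDl sqr_ge0. Qed.

Lemma normc_ge_absIm z : `|Im z| <= normc z.
Proof. by case: z => a b /=; rewrite -sqrtr_sqr ler_wsqrtr// lerDr sqr_ge0. Qed.

Lemma normc_ge0 z : 0 <= normc z.
Proof. by case: z => a b; exact: sqrtr_ge0. Qed.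

Lemma normc_le_abs z : normc z <= `|Re z| + `|Im z|.
Proof.
have -> : normc z = normc ((Re z)%:C + (Im z)%:C * 'i) by rewrite mulrC -complexE.
apply: le_trans (le_normcD _ _) _; rewrite normcM lerD//=.
  by rewrite expr0n addr0 sqrtr_sqr.
by rewrite !expr0n /= addr0 add0r expr1n sqrtr1 mulr1 sqrtr_sqr.
Qed.

Lemma normc_real (a : R) : normc a%:C = `|a|.
Proof. by rewrite /= expr0n addr0 sqrtr_sqr. Qed.

Lemma cisD (a b : R) : cis (a + b) = cis a * cis b.
Proof. by apply: complex_eq; rewrite /cis/= ?cosD ?sinD// addrC mulrC [X in _ + X]mulrC addrC. Qed.

Lemma cis0 : cis (0 : R) = 1.
Proof. by rewrite /cis cos0 sin0. Qed.

Lemma normc_cis (a : R) : normc (cis a) = 1.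
Proof. by rewrite /= cos2Dsin2 sqrtr1. Qed.

End complex_basics.

Section complex_integral.
Context d (T : measurableType d) (R : realType).

Definition cmeasurable (f : T -> R[i]) : Prop :=
  measurable_fun setT (fun x => Re (f x)) /\ measurable_fun setT (fun x => Im (f x)).

Lemma cmeasurableM f g : cmeasurable f -> cmeasurable g -> cmeasurable (fun x => f x * g x).
Proof.
move=> [mf mf'] [mg mg']; split.
  under eq_fun do rewrite ReM.
  by apply: measurable_funB; exact: measurable_funM.
under eq_fun do rewrite ImM.
by apply: measurable_funD; exact: measurable_funM.
Qed.

Lemma cmeasurable_real (f : T -> R) : measurable_fun setT f -> cmeasurable (fun x => (f x)%:C).
Proof. by []. Qed.

Lemma cmeasurable_cis (f : T -> R) : measurable_fun setT f -> cmeasurable (fun x => cis (f x)).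
Proof.
move=> mf; split.
  exact: measurableT_comp (continuous_measurable_fun (@continuous_cos R)) mf.
exact: measurableT_comp (continuous_measurable_fun (@continuous_sin R)) mf.
Qed.

Section fixed_measure.
Context (mu : {measure set T -> \bar R}).

Lemma cintegrable_dominated f (g : T -> R) : cmeasurable f ->
  (forall x, normc (f x) <= g x) -> mu.-integrable setT (EFin \o g) ->
  cintegrable mu setT f.
Proof.
move=> [mf mf'] fg gi; split; apply: (integrable_dominated _ _ _ gi) => // x _.
  by apply: le_trans (fg x); exact: normc_ge_absRe.
by apply: le_trans (fg x); exact: normc_ge_absIm.
Qed.

Lemma eq_cintegral (f g : T -> R[i]) : f =1 g -> cintegral mu setT f = cintegral mu setT g.
Proof. by move=> fg; apply: complex_eq => /=; apply: eq_Rintegral => x _; rewrite fg. Qed.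

Lemma cintegralZl (c : R[i]) f : cintegrable mu setT f ->
  cintegral mu setT (fun x => c * f x) = c * cintegral mu setT f.
Proof.
move=> [fi fi']; apply: complex_eq; rewrite ?ReM ?ImM /=.
  under eq_Rintegral do rewrite ReM.
  rewrite RintegralB// ?RintegralZl//; exact: integrableZl_real.
under eq_Rintegral do rewrite ImM.
rewrite RintegralD// ?RintegralZl//; exact: integrableZl_real.
Qed.

Lemma cintegralZr (c : R[i]) f : cintegrable mu setT f ->
  cintegral mu setT (fun x => f x * c) = cintegral mu setT f * c.
Proof. by move=> fi; rewrite mulrC -cintegralZl//; apply: eq_cintegral => x; rewrite mulrC. Qed.

Lemma cintegralB f g : cintegrable mu setT f -> cintegrable mu setT g ->
  cintegral mu setT (fun x => f x - g x) = cintegral mu setT f - cintegral mu setT g.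
Proof.
move=> [fi fi'] [gi gi']; apply: complex_eq => /=.
  rewrite -RintegralB//; apply: eq_Rintegral => x _.
  by case: (f x) (g x) => a b [].
rewrite -RintegralB//; apply: eq_Rintegral => x _.
by case: (f x) (g x) => a b [].
Qed.

Lemma cintegralD f g : cintegrable mu setT f -> cintegrable mu setT g ->
  cintegral mu setT (fun x => f x + g x) = cintegral mu setT f + cintegral mu setT g.
Proof.
move=> [fi fi'] [gi gi']; apply: complex_eq => /=.
  rewrite -RintegralD//; apply: eq_Rintegral => x _.
  by case: (f x) (g x) => a b [].
rewrite -RintegralD//; apply: eq_Rintegral => x _.
by case: (f x) (g x) => a b [].
Qed.

Lemma cintegral_real (f : T -> R) :
  cintegral mu setT (fun x => (f x)%:C) = (\int[mu]_x f x)%:C.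
Proof.
apply: complex_eq => //=; have -> : 0 = fine 0%E :> R by [].
by rewrite /Rintegral integral0.
Qed.

Lemma cintegral_out (D : set T) f : (forall x, ~ D x -> f x = 0) ->
  cintegral mu D f = cintegral mu setT f.
Proof.
move=> f0; apply: complex_eq => /=; rewrite Rintegral_mkcond; apply: eq_Rintegral => x _;
  by rewrite patchE; case: ifPn => // /negP xD; rewrite f0// => Dx; apply: xD; exact: mem_set.
Qed.

(** Each component is bounded separately, which avoids a triangle inequality for the modulus of an
    integral and costs a factor 2 in [fourier_bounded]. *)
Lemma normc_cintegral_le f (g : T -> R) : cmeasurable f ->
  (forall x, normc (f x) <= g x) -> mu.-integrable setT (EFin \o g) ->
  `|Re (cintegral mu setT f)| <= \int[mu]_x g x /\
  `|Im (cintegral mu setT f)| <= \int[mu]_x g x.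
Proof.
move=> mf fg gi; have [fi fi'] := cintegrable_dominated mf fg gi.
split; rewrite /=.
  apply: le_trans (le_normr_Rintegral measurableT fi) _.
  apply: le_Rintegral => //; first exact: integrable_norm.
  by move=> x _; apply: le_trans (fg x); exact: normc_ge_absRe.
apply: le_trans (le_normr_Rintegral measurableT fi') _.
apply: le_Rintegral => //; first exact: integrable_norm.
by move=> x _; apply: le_trans (fg x); exact: normc_ge_absIm.
Qed.

Lemma Rintegral_dominated_cvg (f_ : nat -> T -> R) (f g : T -> R) :
  (forall n, measurable_fun setT (f_ n)) -> (forall x, f_ n x @[n --> \oo] --> f x) ->
  (forall n x, `|f_ n x| <= g x) -> mu.-integrable setT (EFin \o g) ->
  \int[mu]_x f_ n x @[n --> \oo] --> \int[mu]_x f x.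
Proof.
move=> mf_ f_f fg gi.
have mf : measurable_fun setT f by apply: (measurable_fun_cvg mf_) => x _; exact: f_f.
have [|||||fi _ H] := @dominated_convergence _ _ _ mu setT measurableT
  (fun n => EFin \o f_ n) (EFin \o f) (EFin \o g).
- by move=> n; exact/measurable_EFinP.
- exact/measurable_EFinP.
- by apply: aeW => x _; apply: cvg_EFin; [exact: nearW|exact: f_f].
- exact: gi.
- by apply: aeW => x n _ /=; rewrite lee_fin.
have {}H : (\int[mu]_x (EFin \o f_ n) x)%E @[n --> \oo] --> (\int[mu]_x f x)%:E.
  by rewrite fineK; [exact: H|exact: integrable_fin_num fi].
exact: fine_cvg H.
Qed.

Lemma cintegral_dominated_cvg (f_ : nat -> T -> R[i]) (f : T -> R[i]) (g : T -> R) :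
  (forall n, cmeasurable (f_ n)) ->
  (forall x, Re (f_ n x) @[n --> \oo] --> Re (f x)) ->
  (forall x, Im (f_ n x) @[n --> \oo] --> Im (f x)) ->
  (forall n x, normc (f_ n x) <= g x) -> mu.-integrable setT (EFin \o g) ->
  Re (cintegral mu setT (f_ n)) @[n --> \oo] --> Re (cintegral mu setT f) /\
  Im (cintegral mu setT (f_ n)) @[n --> \oo] --> Im (cintegral mu setT f).
Proof.
move=> mf_ rf imf fg gi; split=> /=.
  apply: Rintegral_dominated_cvg gi => // [n|n x]; first by case: (mf_ n).
  by apply: le_trans (fg n x); exact: normc_ge_absRe.
apply: Rintegral_dominated_cvg gi => // [n|n x]; first by case: (mf_ n).
by apply: le_trans (fg n x); exact: normc_ge_absIm.
Qed.

End fixed_measure.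
End complex_integral.

Lemma cmeasurable_comp d1 d2 (T1 : measurableType d1) (T2 : measurableType d2) (R : realType)
  (f : T2 -> R[i]) (h : T1 -> T2) : cmeasurable f -> measurable_fun setT h ->
  cmeasurable (fun x => f (h x)).
Proof. by move=> [mf mf'] mh; split; [exact: measurableT_comp mf mh|exact: measurableT_comp mf' mh]. Qed.

Section complex_fubini.
Context d1 d2 (T1 : measurableType d1) (T2 : measurableType d2) (R : realType)
  (m1 : {sigma_finite_measure set T1 -> \bar R})
  (m2 : {sigma_finite_measure set T2 -> \bar R}).

Lemma integrable_prodM (f : T1 -> R) (g : T2 -> R) :
  (forall x, 0 <= f x) -> (forall x, 0 <= g x) ->
  m1.-integrable setT (EFin \o f) -> m2.-integrable setT (EFin \o g) ->
  (m1 \x m2)%E.-integrable setT (EFin \o (fun z => f z.1 * g z.2)).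
Proof.
move=> f0 g0 fi gi.
have /measurable_EFinP mf := measurable_int _ fi.
have /measurable_EFinP mg := measurable_int _ gi.
have mfg : measurable_fun setT (fun z : T1 * T2 => f z.1 * g z.2).
  apply: measurable_funM.
    exact: measurableT_comp mf measurable_fst.
  exact: measurableT_comp mg measurable_snd.
apply/(integrable12ltyP _ _ _).
  exact/measurable_EFinP.
have Eg : (\int[m2]_y (g y)%:E = (\int[m2]_y g y)%:E)%E.
  by rewrite fineK//; exact: integrable_fin_num gi.
have Ef : (\int[m1]_x (f x)%:E = (\int[m1]_x f x)%:E)%E.
  by rewrite fineK//; exact: integrable_fin_num fi.
have -> : (\int[m1]_x \int[m2]_y `|(EFin \o (fun z => f z.1 * g z.2)%R) (x, y)| =
   \int[m1]_x ((\int[m2]_y g y)%:E * (f x)%:E))%E.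
  apply: eq_integral => x _; rewrite muleC -Eg -ge0_integralZl//; last 3 first.
  - exact/measurable_EFinP.
  - by move=> y _; rewrite lee_fin.
  - by rewrite lee_fin.
  by apply: eq_integral => y _ /=; rewrite ger0_norm ?mulr_ge0// EFinM.
rewrite ge0_integralZl//.
- by rewrite Ef -EFinM ltry.
- exact/measurable_EFinP.
- by move=> x _; rewrite lee_fin.
- by rewrite lee_fin Rintegral_ge0.
Qed.

Lemma cintegral_prod (f : T1 * T2 -> R[i]) : cintegrable (m1 \x m2)%E setT f ->
  cintegral (m1 \x m2)%E setT f =
    cintegral m1 setT (fun x => cintegral m2 setT (fun y => f (x, y))) /\
  cintegral (m1 \x m2)%E setT f =
    cintegral m2 setT (fun y => cintegral m1 setT (fun x => f (x, y))).
Proof.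
move=> [fi fi']; split; apply: complex_eq => /=.
- exact: (Rintegral_prod1 fi).
- exact: (Rintegral_prod1 fi').
- exact: (Rintegral_prod2 fi).
- exact: (Rintegral_prod2 fi').
Qed.

Lemma cfubini (f : T1 * T2 -> R[i]) (g : T1 -> R) (h : T2 -> R) : cmeasurable f ->
  (forall x y, normc (f (x, y)) <= g x * h y) ->
  (forall x, 0 <= g x) -> (forall x, 0 <= h x) ->
  m1.-integrable setT (EFin \o g) -> m2.-integrable setT (EFin \o h) ->
  cintegral m1 setT (fun x => cintegral m2 setT (fun y => f (x, y))) =
  cintegral m2 setT (fun y => cintegral m1 setT (fun x => f (x, y))).
Proof.
move=> mf fgh g0 h0 gi hi.
have [] := @cintegral_prod f; last by move=> <-.
apply: (cintegrable_dominated mf) (integrable_prodM g0 h0 gi hi) => -[x y].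
exact: fgh.
Qed.

End complex_fubini.

(** * Fourier transforms of Schwartz functions *)

Section euclidean.
Context (R : realType) (d : nat).
Implicit Types (x y xi : 'rV[R]_d).

Lemma dotrC x y : dotr x y = dotr y x.
Proof. by apply: eq_bigr => i _; rewrite mulrC. Qed.

Lemma dotrDl x y z : dotr (x + y) z = dotr x z + dotr y z.
Proof. by rewrite -big_split; apply: eq_bigr => i _; rewrite !mxE mulrDl. Qed.

Lemma dotrZl a x y : dotr (a *: x) y = a * dotr x y.
Proof. by rewrite /dotr mulr_sumr; apply: eq_bigr => i _; rewrite mxE mulrA. Qed.

Lemma dotrBl x y z : dotr (x - y) z = dotr x z - dotr y z.
Proof. by rewrite dotrDl -scaleN1r dotrZl mulN1r. Qed.

Lemma dotrDr x y z : dotr z (x + y) = dotr z x + dotr z y.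
Proof. by rewrite dotrC dotrDl ![dotr _ z]dotrC. Qed.

Lemma dotrZr a x y : dotr y (a *: x) = a * dotr y x.
Proof. by rewrite dotrC dotrZl dotrC. Qed.

Lemma dotr_delta i x : dotr (delta_mx ord0 i) x = x ord0 i.
Proof.
rewrite /dotr (bigD1 i)//= mxE !eqxx mul1r big1 ?addr0// => j /negbTE ji.
by rewrite mxE ji andbF mul0r.
Qed.

Lemma dotr_ge0 x : 0 <= dotr x x.
Proof. by apply: sumr_ge0 => i _; rewrite -expr2 sqr_ge0. Qed.

Lemma enorm_ge0 x : 0 <= enorm x.
Proof. exact: sqrtr_ge0. Qed.

Lemma sqr_enorm x : enorm x ^+ 2 = dotr x x.
Proof. by rewrite sqr_sqrtr ?dotr_ge0. Qed.

Lemma sqr_coord_le_dotr i x : x ord0 i ^+ 2 <= dotr x x.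
Proof.
by rewrite /dotr (bigD1 i)//= -expr2 lerDl sumr_ge0// => j _; rewrite -expr2 sqr_ge0.
Qed.

Lemma measurable_dotr d' (T : measurableType d') (f g : T -> 'rV[R]_d) :
  measurable_fun setT f -> measurable_fun setT g ->
  measurable_fun setT (fun z => dotr (f z) (g z)).
Proof.
move=> mf mg; apply: measurable_sum => i; apply: measurable_funM.
  exact: measurableT_comp (measurable_coord i) mf.
exact: measurableT_comp (measurable_coord i) mg.
Qed.

Lemma measurable_enorm : measurable_fun setT (@enorm R d).
Proof.
apply: measurableT_comp (continuous_measurable_fun (@sqrt_continuous R)) _.
exact: measurable_dotr.
Qed.

Lemma le_dotr x y : `|dotr x y| <= \sum_(i < d) `|x ord0 i| * `|y ord0 i|.
Proof.
by apply: le_trans (ler_norm_sum _ _ _) _; apply: ler_sum => i _; rewrite normrM.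
Qed.

Lemma inv1Dsqr_bounds (s : R) : 0 < (1 + s ^+ 2)^-1 <= 1.
Proof.
have h : 1 <= 1 + s ^+ 2 by rewrite lerDl sqr_ge0.
by rewrite invr_gt0 (lt_le_trans _ h)//= invf_le1// (lt_le_trans _ h).
Qed.

Lemma decay_gt0 x : 0 < decay x.
Proof. by apply: prodr_gt0 => i _; have /andP[] := inv1Dsqr_bounds (x ord0 i). Qed.

Lemma decay_le1 x : decay x <= 1.
Proof.
apply: prodr_ile1 => i _; have /andP[h ->] := inv1Dsqr_bounds (x ord0 i).
by rewrite ltW.
Qed.

Lemma coord_decay_le1 i x : `|x ord0 i| * decay x <= 1.
Proof.
rewrite /decay (bigD1 i)//= mulrA mulr_ile1//.
- by rewrite mulr_ge0// ltW//; have /andP[] := inv1Dsqr_bounds (x ord0 i).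
- by apply: prodr_ge0 => j _; have /andP[/ltW] := inv1Dsqr_bounds (x ord0 j).
- rewrite ler_pdivrMr; last by rewrite ltr_pwDl// sqr_ge0.
  rewrite mul1r -(real_normK (num_real (x ord0 i))).
  by have := normr_ge0 (x ord0 i); nra.
- apply: prodr_ile1 => j _; have /andP[h ->] := inv1Dsqr_bounds (x ord0 j).
  by rewrite ltW.
Qed.

Lemma sqr_decay_le x : decay x ^+ 2 <= decay x.
Proof. by rewrite expr2 ler_piMr ?decay_ge0// decay_le1. Qed.

(** Each [1 + x_i^2] is at most [1 + |x|^2]. This converts the norm powers in the definition of
    Schwartz functions into powers of [decay]. *)
Lemma decay_enorm_bound x : 1 <= (1 + enorm x ^+ 2) ^+ d * decay x.
Proof.
rewrite /decay -[X in _ ^+ X]card_ord -prodr_const -big_split/=.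
rewrite -[X in X <= _](big1_eq (idx := 1) (op := *%R) (index_enum 'I_d) predT).
apply: ler_prod => i _; rewrite ler01/= ler_pdivlMr; last by rewrite ltr_pwDl// sqr_ge0.
by rewrite mul1r lerD2l sqr_enorm sqr_coord_le_dotr.
Qed.

Lemma enorm_le_sum x : enorm x <= \sum_(i < d) `|x ord0 i|.
Proof.
have S0 : 0 <= \sum_(i < d) `|x ord0 i| by apply: sumr_ge0.
rewrite /enorm -[leRHS](ger0_norm S0) -sqrtr_sqr ler_wsqrtr// expr2 mulr_suml.
apply: ler_sum => i _; rewrite -expr2 -(real_normK (num_real (x ord0 i))) expr2.
by rewrite ler_wpM2l// (bigD1 i)//= lerDl sumr_ge0.
Qed.

End euclidean.

(** * Decay of Schwartz functions and integration by parts *)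

Section schwartz_decay.
Context (R : realType) (d : nat).
Notation lam := (lebesgue_rV R d).
Implicit Types (f g : 'rV[R]_d -> R) (x xi : 'rV[R]_d).

Lemma schwartz_real_continuous f : schwartz_real f -> continuous f.
Proof. by move=> sf x; apply: differentiable_continuous; have [+ _] := sf [::]; exact. Qed.

Lemma schwartz_real_decay f : schwartz_real f ->
  exists C, forall x, `|f x| <= C * decay x ^+ 2.
Proof.
move=> sf; have [_ fk] := sf [::].
(* Dividing by [decay x ^+ 2] costs [(1 + |x|^2)^(2 d)], which is at most [2^(2 d) (1 + |x|^(4 d))];
   hence the seminorms of orders 0 and [4 d]. *)
have [C0 h0] := fk 0%N; have [C1 h1] := fk (4 * d)%N.
exists (2 ^+ (2 * d) * (C0 + C1)) => x.
rewrite -[leLHS]mulr1 (le_trans (ler_wpM2l (normr_ge0 _) (exprn_ege1 2 (decay_enorm_bound x))))//.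
rewrite exprMn mulrA ler_wpM2r ?exprn_ge0 ?decay_ge0// -exprM [(d * 2)%N]mulnC.
have e0 := enorm_ge0 x.
have : (1 + enorm x ^+ 2) ^+ (2 * d) <= 2 ^+ (2 * d) * (1 + enorm x ^+ (4 * d)).
  have [e1|e1] := leP (enorm x) 1.
    apply: (@le_trans _ _ (2 ^+ (2 * d))); last by rewrite ler_peMr ?exprn_ge0// lerDl exprn_ge0.
    by rewrite lerXn2r ?nnegrE ?addr_ge0 ?sqr_ge0//; have := exprn_ile1 2 e0 e1; lra.
  apply: (@le_trans _ _ (2 ^+ (2 * d) * enorm x ^+ (4 * d))).
    have -> : (4 * d = 2 * (2 * d))%N by rewrite mulnA.
    rewrite (exprM (enorm x) 2) -exprMn.
    rewrite lerXn2r ?nnegrE ?addr_ge0 ?mulr_ge0 ?sqr_ge0//.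
    by have := exprn_ege1 2 (ltW e1); lra.
  by rewrite ler_wpM2l ?exprn_ge0// lerDr.
move=> /(ler_wpM2l (normr_ge0 (f x))) h; apply: (le_trans h).
rewrite mulrCA ler_wpM2l ?exprn_ge0// mulrDr mulr1 lerD//.
  by have := h0 x; rewrite expr0 mul1r.
by rewrite mulrC; exact: h1.
Qed.

Lemma partials_cat s t f : partials (s ++ t) f = partials s (partials t f).
Proof. by rewrite /partials foldr_cat. Qed.

Lemma schwartz_real_partials t f : schwartz_real f -> schwartz_real (partials t f).
Proof. by move=> sf s; have := sf (s ++ t); rewrite partials_cat. Qed.

Lemma partialsB s f g : schwartz_real f -> schwartz_real g ->
  partials s (fun x => f x - g x) = (fun x => partials s f x - partials s g x).
Proof.
move=> sf sg; elim: s => [//|i s IH]; rewrite /= -/(partials s _) IH.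
apply/funext => x; rewrite -deriveB//; apply: diff_derivable.
  by have [+ _] := sf s; exact.
by have [+ _] := sg s; exact.
Qed.

Lemma schwartz_realB f g : schwartz_real f -> schwartz_real g ->
  schwartz_real (fun x => f x - g x).
Proof.
move=> sf sg s; have [df fk] := sf s; have [dg gk] := sg s.
rewrite partialsB//; split => [x|k]; first exact: differentiableB.
have [C1 h1] := fk k; have [C2 h2] := gk k; exists (C1 + C2) => x.
apply: le_trans (lerD (h1 x) (h2 x)); rewrite -mulrDr ler_wpM2l ?exprn_ge0 ?enorm_ge0//.
exact: ler_normB.
Qed.

(** The difference quotient along the line is literally that of the directional derivative, so
    one-dimensional calculus applies to partial derivatives. *)
Lemma is_derive_line f (v x : 'rV[R]_d) (s : R) : (forall x, differentiable f x) ->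
  is_derive s 1 (fun s => f (s *: v + x)) ('D_v f (s *: v + x)).
Proof.
move=> df; have E : (fun h : R => h^-1 *: (((fun s => f (s *: v + x)) \o shift s) (h *: 1)
      - f (s *: v + x))) =
   (fun h => h^-1 *: ((f \o shift (s *: v + x)) (h *: v) - f (s *: v + x))).
  apply/funext => h; have h1 : h *: (1 : R) = h by rewrite /GRing.scale/= mulr1.
  by rewrite /= h1 scalerDl addrA.
apply: DeriveDef; last by rewrite /derive E.
rewrite /derivable E; have h := @diff_derivable _ _ _ f _ v (df (s *: v + x)); exact: h.
Qed.

Lemma integrable_schwartz_mul f (h : 'rV[R]_d -> R) : schwartz_real f ->
  measurable_fun setT h -> (forall x, `|h x| <= 1) ->
  lam.-integrable setT (EFin \o (fun x => h x * f x)).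
Proof.
move=> sf mh h1; have [C CP] := schwartz_real_decay sf.
apply: (@integrable_dominated _ _ _ lam setT _ (fun x => C * decay x)) => //.
- by apply: measurable_funM => //; apply: continuous_rV_measurable; exact: schwartz_real_continuous.
- move=> x _; rewrite normrM (@le_trans _ _ `|f x|)// ?ler_piMl//.
  apply: le_trans (CP x) _; rewrite ler_wpM2l ?sqr_decay_le//.
  have := le_trans (normr_ge0 _) (CP 0); rewrite pmulr_lge0// exprn_gt0// decay_gt0//.
- by apply: integrableZl_real => //; exact: integrable_decay.
Qed.

Definition cos_transform f xi := \int[lam]_x (cos (dotr xi x) * f x).
Definition sin_transform f xi := \int[lam]_x (sin (dotr xi x) * f x).

(** The derivative of [c (dotr xi x) * f x] in direction [i] integrates to 0. A general [c] covers
    the cosine and sine transforms at once. *)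
Lemma transform_ibp (c c' : R -> R) i f xi : schwartz_real f ->
  (forall s : R, is_derive s 1 c (c' s)) -> continuous c' ->
  (forall s, `|c s| <= 1) -> (forall s, `|c' s| <= 1) ->
  \int[lam]_x (c (dotr xi x) * partials [:: i] f x) =
  - xi ord0 i * \int[lam]_x (c' (dotr xi x) * f x).
Proof.
move=> sf dc cc' c1 c'1.
have cc : continuous c by move=> s; exact: is_derive1_continuous (dc s).
have mdot (e : R -> R) : continuous e -> measurable_fun setT (fun x => e (dotr xi x)).
  move=> ce; apply: measurableT_comp (continuous_measurable_fun ce) _.
  exact: measurable_dotr.
have i1 := integrable_schwartz_mul sf (mdot _ cc') (fun x => c'1 _).
have sf1 := schwartz_real_partials [:: i] sf.
have i2 := integrable_schwartz_mul sf1 (mdot _ cc) (fun x => c1 _).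
have df x : differentiable f x by have [+ _] := sf [::]; exact.
have cf := schwartz_real_continuous sf.
have cf1 := schwartz_real_continuous sf1.
have lineE s x : dotr xi (s *: delta_mx ord0 i + x) = xi ord0 i * s + dotr xi x.
  by rewrite dotrDr dotrZr dotrC dotr_delta mulrC.
have lc x : continuous (fun s : R => s *: delta_mx ord0 i + x : 'rV[R]_d).
  by move=> s; apply: cvgD; [exact: scalel_continuous|exact: cvg_cst].
have [C1 h1] := schwartz_real_decay sf; have [C2 h2] := schwartz_real_decay sf1.
have C10 : 0 <= C1.
  by have := le_trans (normr_ge0 _) (h1 0); rewrite pmulr_lge0// exprn_gt0// decay_gt0.
have C20 : 0 <= C2.
  by have := le_trans (normr_ge0 _) (h2 0); rewrite pmulr_lge0// exprn_gt0// decay_gt0.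
pose F x := c (dotr xi x) * f x.
pose G x := xi ord0 i * (c' (dotr xi x) * f x) + c (dotr xi x) * partials [:: i] f x.
have : \int[lam]_x G x = 0.
  (* One constant has to serve both functions: [C1] bounds [F], and [|xi_i| C1 + C2] bounds [G]. *)
  apply: (@Rintegral_derive0 R d i F G
    (C1 + `|xi ord0 i| * C1 + C2)).
  - apply: measurable_funD; last first.
      by apply: measurable_funM; [exact: mdot|exact: continuous_rV_measurable].
    apply: measurable_funM => //.
    by apply: measurable_funM; [exact: mdot|exact: continuous_rV_measurable].
  - move=> x s; have d1 := is_derive_line (delta_mx ord0 i) x s df.
    have d0 : is_derive s 1 (fun s : R => xi ord0 i * s + dotr xi x) (xi ord0 i).
      by apply: is_derive_eq; rewrite /GRing.scale/= mulr1 addr0.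
    have d2 := @is_derive1_comp R c (fun s => xi ord0 i * s + dotr xi x) s _ _ (dc _) d0.
    have dm := is_deriveM d2 d1.
    have -> : (fun s : R => F (s *: delta_mx ord0 i + x)) = (fun s : R => c (xi ord0 i * s + dotr xi x) *
      f (s *: delta_mx ord0 i + x)) by apply/funext => ?; rewrite /F lineE.
    by apply: (is_derive_eq dm); rewrite /G lineE /GRing.scale/=; ring.
  - move=> x; have -> : (fun s : R => G (s *: delta_mx ord0 i + x)) = (fun s : R =>
        xi ord0 i * (c' (xi ord0 i * s + dotr xi x) * f (s *: delta_mx ord0 i + x)) +
        c (xi ord0 i * s + dotr xi x) * partials [:: i] f (s *: delta_mx ord0 i + x)).
      by apply/funext => s; rewrite /G lineE.
    have cl (e : R -> R) : continuous e ->
        continuous (fun s : R => e (xi ord0 i * s + dotr xi x)).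
      move=> ce s; apply: (cvg_comp (fun s : R => xi ord0 i * s + dotr xi x) e); last exact: ce.
      by apply: cvgD; [apply: cvgM; [exact: cvg_cst|exact: cvg_id]|exact: cvg_cst].
    have cfl (e : 'rV[R]_d -> R) : continuous e ->
        continuous (fun s : R => e (s *: delta_mx ord0 i + x)).
      by move=> ce s; apply: (cvg_comp _ e); [exact: lc|exact: ce].
    move=> s; apply: cvgD.
      by apply: cvgM; [exact: cvg_cst|apply: cvgM; [exact: cl|exact: cfl]].
    by apply: cvgM; [exact: cl|exact: cfl].
  - move=> x; rewrite /F normrM (@le_trans _ _ `|f x|) ?ler_piMl//.
    apply: le_trans (h1 x) _; apply: (le_trans (ler_wpM2l C10 (sqr_decay_le x))).
    by rewrite ler_wpM2r ?decay_ge0//; have := mulr_ge0 (normr_ge0 (xi ord0 i)) C10; lra.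
  - move=> x; apply: le_trans (ler_normD _ _) _.
    apply: (@le_trans _ _ (`|xi ord0 i| * C1 * decay x + C2 * decay x)); last first.
      by rewrite -mulrDl ler_wpM2r ?decay_ge0//; lra.
    apply: lerD; rewrite !normrM.
      rewrite -mulrA ler_wpM2l// (@le_trans _ _ `|f x|) ?ler_piMl//.
      by apply: le_trans (h1 x) _; rewrite ler_wpM2l// sqr_decay_le.
    rewrite (@le_trans _ _ `|partials [:: i] f x|) ?ler_piMl//.
    by apply: le_trans (h2 x) _; rewrite ler_wpM2l// sqr_decay_le.
rewrite /G RintegralD//; last exact: integrableZl_real.
by rewrite RintegralZl// addrC => /eqP; rewrite addr_eq0 mulNr => /eqP.
Qed.

Lemma cos_transform_partial i f xi : schwartz_real f ->
  cos_transform (partials [:: i] f) xi = xi ord0 i * sin_transform f xi.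
Proof.
move=> sf; rewrite /cos_transform (@transform_ibp cos (fun s => - sin s))//.
- have -> : \int[lam]_x (- sin (dotr xi x) * f x) = - sin_transform f xi.
    rewrite -mulN1r -RintegralZl//; last first.
      apply: integrable_schwartz_mul => // [|x]; last by rewrite ler_norml sin_geN1 sin_le1.
      apply: measurableT_comp (continuous_measurable_fun (@continuous_sin R)) _.
      exact: measurable_dotr.
    by apply: eq_Rintegral => x _; ring.
  by rewrite mulrNN.
- by move=> s; apply: cvgN; exact: continuous_sin.
- by move=> s; rewrite ler_norml cos_geN1 cos_le1.
- by move=> s; rewrite normrN ler_norml sin_geN1 sin_le1.
Qed.

Lemma sin_transform_partial i f xi : schwartz_real f ->
  sin_transform (partials [:: i] f) xi = - xi ord0 i * cos_transform f xi.
Proof.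
move=> sf; rewrite /sin_transform (@transform_ibp sin cos)//.
- exact: continuous_cos.
- by move=> s; rewrite ler_norml sin_geN1 sin_le1.
- by move=> s; rewrite ler_norml cos_geN1 cos_le1.
Qed.

End schwartz_decay.

(** * Decay and regularity of Fourier transforms *)

Section fourier_decay.
Context (R : realType) (d : nat).
Notation lam := (lebesgue_rV R d).
Implicit Types (f g : 'rV[R]_d -> R) (x xi : 'rV[R]_d) (F : 'rV[R]_d -> R[i]).

Let cos1 (s : R) : `|cos s| <= 1. Proof. by rewrite ler_norml cos_geN1 cos_le1. Qed.
Let sin1 (s : R) : `|sin s| <= 1. Proof. by rewrite ler_norml sin_geN1 sin_le1. Qed.

Let mcis (e : R -> R) xi : continuous e -> measurable_fun setT (fun x => e (dotr xi x)).
Proof.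
move=> ce; apply: measurableT_comp (continuous_measurable_fun ce) _.
exact: measurable_dotr.
Qed.

Lemma integrable_cos_schwartz f xi : schwartz_real f ->
  lam.-integrable setT (EFin \o (fun x => cos (dotr xi x) * f x)).
Proof. by move=> sf; apply: integrable_schwartz_mul => //; apply: mcis; exact: continuous_cos. Qed.

Lemma integrable_sin_schwartz f xi : schwartz_real f ->
  lam.-integrable setT (EFin \o (fun x => sin (dotr xi x) * f x)).
Proof. by move=> sf; apply: integrable_schwartz_mul => //; apply: mcis; exact: continuous_sin. Qed.

(** One derivative exchanges the cosine and sine transforms, two restore them with the factor
    [- xi_i^2]. The symbol [1 + xi_i^2] of this operator is the inverse of one factor of [decay]. *)
Definition helmholtz (i : 'I_d) f := fun x => f x - partials [:: i; i] f x.

Lemma schwartz_helmholtz i f : schwartz_real f -> schwartz_real (helmholtz i f).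
Proof. by move=> sf; apply: schwartz_realB => //; exact: schwartz_real_partials. Qed.

Lemma cos_transform_helmholtz i f xi : schwartz_real f ->
  cos_transform (helmholtz i f) xi = (1 + xi ord0 i ^+ 2) * cos_transform f xi.
Proof.
move=> sf; have sf1 := schwartz_real_partials [:: i] sf.
have sf2 := schwartz_real_partials [:: i] sf1.
transitivity (cos_transform f xi - cos_transform (partials [:: i] (partials [:: i] f)) xi).
  rewrite /cos_transform -RintegralB//; [|exact: integrable_cos_schwartz..].
  by apply: eq_Rintegral => x _; rewrite mulrBr.
rewrite cos_transform_partial// sin_transform_partial//; ring.
Qed.

Lemma sin_transform_helmholtz i f xi : schwartz_real f ->
  sin_transform (helmholtz i f) xi = (1 + xi ord0 i ^+ 2) * sin_transform f xi.
Proof.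
move=> sf; have sf1 := schwartz_real_partials [:: i] sf.
have sf2 := schwartz_real_partials [:: i] sf1.
transitivity (sin_transform f xi - sin_transform (partials [:: i] (partials [:: i] f)) xi).
  rewrite /sin_transform -RintegralB//; [|exact: integrable_sin_schwartz..].
  by apply: eq_Rintegral => x _; rewrite mulrBr.
rewrite sin_transform_partial// cos_transform_partial//; ring.
Qed.

Definition helmholtz_prod (r : seq 'I_d) f := foldr helmholtz f r.

Lemma transform_helmholtz_prod r f : schwartz_real f ->
  [/\ schwartz_real (helmholtz_prod r f),
    forall xi, cos_transform (helmholtz_prod r f) xi =
      \prod_(i <- r) (1 + xi ord0 i ^+ 2) * cos_transform f xi &
    forall xi, sin_transform (helmholtz_prod r f) xi =
      \prod_(i <- r) (1 + xi ord0 i ^+ 2) * sin_transform f xi].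
Proof.
move=> sf; elim: r => [|i r [sr cr sir]] /=.
  by split=> // xi; rewrite big_nil mul1r.
split; first exact: schwartz_helmholtz.
  by move=> xi; rewrite cos_transform_helmholtz// cr big_cons mulrA.
by move=> xi; rewrite sin_transform_helmholtz// sir big_cons mulrA.
Qed.

(** The product of the operators over all coordinates has symbol [1 / decay]. Applied twice it gives
    a Schwartz function [h], whose transforms are bounded by the integral of [|h|]. *)
Lemma transform_decay f : schwartz_real f -> exists C, forall xi,
  `|cos_transform f xi| <= C * decay xi ^+ 2 /\ `|sin_transform f xi| <= C * decay xi ^+ 2.
Proof.
move=> sf; have [sg cg sg'] := transform_helmholtz_prod (index_enum 'I_d) sf.
set g := helmholtz_prod _ f in sg cg sg'.
have [sh ch sh'] := transform_helmholtz_prod (index_enum 'I_d) sg.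
set h := helmholtz_prod _ g in sh ch sh'.
have ih : lam.-integrable setT (EFin \o (fun x => `|h x|)).
  have i1 : lam.-integrable setT (EFin \o (fun x => cst 1 x * h x)).
    by apply: integrable_schwartz_mul => // x; rewrite /= normr1.
  have -> : (fun x => `|h x|) = (fun x => `|cst 1 x * h x|).
    by apply/funext => x /=; rewrite mul1r.
  exact: integrable_norm i1.
have P xi : decay xi * \prod_(i <- index_enum 'I_d) (1 + xi ord0 i ^+ 2) = 1.
  rewrite -big_split/= big1// => i _; rewrite mulVf// gt_eqF//.
  by rewrite ltr_pwDl// sqr_ge0.
have PP xi (z : R) : z = \prod_(i <- index_enum 'I_d) (1 + xi ord0 i ^+ 2) *
    (\prod_(i <- index_enum 'I_d) (1 + xi ord0 i ^+ 2) * z) * decay xi ^+ 2.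
  have := P xi; move: (\prod_(i <- _) _) => q E.
  have -> : q * (q * z) * decay xi ^+ 2 = (decay xi * q) ^+ 2 * z by ring.
  by rewrite E expr1n mul1r.
exists (\int[lam]_x `|h x|) => xi.
have bound (e : R -> R) : continuous e -> (forall s, `|e s| <= 1) ->
    `|\int[lam]_x (e (dotr xi x) * h x)| <= \int[lam]_x `|h x|.
  move=> ce e1; have ie := integrable_schwartz_mul sh (mcis xi ce) (fun x => e1 _).
  apply: le_trans (le_normr_Rintegral measurableT ie) _.
  apply: le_Rintegral => //; first exact: integrable_norm.
  by move=> x _; rewrite normrM ler_piMl.
have D0 : 0 <= decay xi ^+ 2 by rewrite exprn_ge0// decay_ge0.
split.
- have -> : cos_transform f xi = cos_transform h xi * decay xi ^+ 2.
    by rewrite ch cg; exact: PP.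
  by rewrite normrM (ger0_norm D0) ler_wpM2r//; exact: (bound _ (@continuous_cos R) cos1).
- have -> : sin_transform f xi = sin_transform h xi * decay xi ^+ 2.
    by rewrite sh' sg'; exact: PP.
  by rewrite normrM (ger0_norm D0) ler_wpM2r//; exact: (bound _ (@continuous_sin R) sin1).
Qed.

(** Of the two powers of [decay], one ensures integrability and the other absorbs a factor [|x_i|]
    in [fourier_lipschitz]. *)
Definition cdecay F : Prop :=
  cmeasurable F /\ exists2 C, 0 <= C & forall x, normc (F x) <= C * decay x ^+ 2.

Lemma decay_const_ge0 (C : R) F : (forall x, normc (F x) <= C * decay x ^+ 2) -> 0 <= C.
Proof.
move=> FC; have := le_trans (normc_ge0 _) (FC 0).
by rewrite pmulr_lge0// exprn_gt0// decay_gt0.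
Qed.

Lemma schwartz_cdecay F : schwartz F -> cdecay F.
Proof.
move=> [sr si]; split.
  by split; apply: continuous_rV_measurable; exact: schwartz_real_continuous.
have [C1 h1] := schwartz_real_decay sr; have [C2 h2] := schwartz_real_decay si.
have FC x : normc (F x) <= (C1 + C2) * decay x ^+ 2.
  by apply: le_trans (normc_le_abs _) _; rewrite mulrDl lerD.
by exists (C1 + C2) => //; exact: decay_const_ge0 FC.
Qed.

Lemma cdecay_dominated F : cdecay F ->
  exists2 C, 0 <= C & forall x, normc (F x) <= C * decay x.
Proof.
move=> [_ [C C0 FC]]; exists C => // x; apply: le_trans (FC x) _.
by rewrite ler_wpM2l// sqr_decay_le.
Qed.

Lemma integrable_Zdecay (C : R) : lam.-integrable setT (EFin \o (fun x => C * decay x)).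
Proof. by apply: integrableZl_real => //; exact: integrable_decay. Qed.

Lemma cmeasurable_cis_mul F xi : cmeasurable F -> cmeasurable (fun x => cis (dotr xi x) * F x).
Proof.
move=> mF; apply: cmeasurableM => //; apply: cmeasurable_cis.
exact: measurable_dotr.
Qed.

Lemma cintegrable_cdecay F : cdecay F -> cintegrable lam setT F.
Proof.
move=> dF; have [C C0 FC] := cdecay_dominated dF; have [mF _] := dF.
exact: (cintegrable_dominated mF FC (integrable_Zdecay C)).
Qed.

Lemma cdecayM F G (M : R) : cdecay F -> cmeasurable G -> (forall x, normc (G x) <= M) ->
  cdecay (fun x => G x * F x).
Proof.
move=> [mF [C C0 FC]] mG GM; split; first exact: cmeasurableM.
have M0 : 0 <= M by exact: le_trans (normc_ge0 _) (GM 0).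
exists (M * C) => [|x]; first exact: mulr_ge0.
by rewrite normcM -mulrA ler_pM// normc_ge0.
Qed.

Lemma fourier_bounded F : cdecay F -> exists M : R, forall xi, normc (fourier F xi) <= M.
Proof.
move=> dF; have [C C0 FC] := cdecay_dominated dF; have [mF _] := dF.
exists (\int[lam]_x (C * decay x) + \int[lam]_x (C * decay x)) => xi.
apply: le_trans (normc_le_abs _) _.
have [|||h1 h2] := @normc_cintegral_le _ _ _ lam (fun x => cis (dotr xi x) * F x)
  (fun x => C * decay x).
- exact: cmeasurable_cis_mul.
- by move=> x; rewrite normcM normc_cis mul1r.
- exact: integrable_Zdecay.
exact: lerD.
Qed.

Lemma cos_lipschitz (a b : R) : `|cos a - cos b| <= `|a - b|.
Proof.
wlog ab : a b / a <= b.
  by move=> h; have [/h//|/ltW/h] := leP a b; rewrite distrC [X in _ <= X -> _]distrC.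
have [|s _ E] := @MVT_segment R cos (fun s => - sin s) a b ab.
  by apply: continuous_subspaceT => s; exact: continuous_cos.
by rewrite distrC E normrM normrN [leRHS]distrC ler_piMl.
Qed.

Lemma sin_lipschitz (a b : R) : `|sin a - sin b| <= `|a - b|.
Proof.
wlog ab : a b / a <= b.
  by move=> h; have [/h//|/ltW/h] := leP a b; rewrite distrC [X in _ <= X -> _]distrC.
have [|s _ E] := @MVT_segment R sin cos a b ab.
  by apply: continuous_subspaceT => s; exact: continuous_sin.
by rewrite distrC E normrM [leRHS]distrC ler_piMl.
Qed.

Lemma normc_cis_sub (a b : R) : normc (cis a - cis b) <= 2 * `|a - b|.
Proof.
apply: le_trans (normc_le_abs _) _; rewrite mulr2n mulrDl mul1r lerD//=.
  exact: cos_lipschitz.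
exact: sin_lipschitz.
Qed.

(** The increment of the exponential is at most [2 |dotr (xi - xi') x|], a sum of terms
    [|xi_i - xi'_i| |x_i|]. One power of [decay] absorbs each [|x_i|]; the other is integrated and
    enters the constant. *)
Lemma fourier_lipschitz F : cdecay F -> exists2 M, 0 <= M & forall xi xi',
  `|Re (fourier F xi) - Re (fourier F xi')| <= M * \sum_(i < d) `|xi ord0 i - xi' ord0 i| /\
  `|Im (fourier F xi) - Im (fourier F xi')| <= M * \sum_(i < d) `|xi ord0 i - xi' ord0 i|.
Proof.
move=> dF; have [mF [C C0 FC]] := dF.
have D0 : 0 <= \int[lam]_x decay x by apply: Rintegral_ge0 => x _; exact: decay_ge0.
exists (2 * C * \int[lam]_x decay x) => [|xi xi']; first by rewrite !mulr_ge0.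
set S := \sum_(i < d) _; pose H x := (cis (dotr xi x) - cis (dotr xi' x)) * F x.
have S0 : 0 <= S by apply: sumr_ge0.
have i1 eta : cintegrable lam setT (fun x => cis (dotr eta x) * F x).
  apply: cintegrable_cdecay; apply: (cdecayM (M := 1)) => //.
    by apply: cmeasurable_cis; exact: measurable_dotr.
  by move=> x; rewrite normc_cis.
have HE : fourier F xi - fourier F xi' = cintegral lam setT H.
  by rewrite -cintegralB//; apply: eq_cintegral => x; rewrite /H mulrBl.
have HB x : normc (H x) <= 2 * C * S * decay x.
  rewrite /H normcM.
  have h1 : normc (cis (dotr xi x) - cis (dotr xi' x)) * decay x <= 2 * S.
    apply: (le_trans (ler_wpM2r (decay_ge0 x) (normc_cis_sub _ _))).
    rewrite -dotrBl -mulrA ler_wpM2l//.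
    apply: (le_trans (ler_wpM2r (decay_ge0 x) (le_dotr _ _))).
    rewrite mulr_suml ler_sum// => i _; rewrite -mulrA !mxE ler_piMr//.
    exact: coord_decay_le1.
  apply: (le_trans (ler_wpM2l (normc_ge0 _) (FC x))).
  move: (normc _) h1 => n h1.
  have -> : n * (C * decay x ^+ 2) = C * decay x * (n * decay x) by ring.
  have -> : 2 * C * S * decay x = C * decay x * (2 * S) by ring.
  by rewrite ler_wpM2l// mulr_ge0// decay_ge0.
have mH : cmeasurable H.
  apply: cmeasurableM => //; split; apply: measurable_funB.
  - by case: (cmeasurable_cis (measurable_dotr (measurable_cst xi) (@measurable_id _ _ setT))).
  - by case: (cmeasurable_cis (measurable_dotr (measurable_cst xi') (@measurable_id _ _ setT))).
  - by case: (cmeasurable_cis (measurable_dotr (measurable_cst xi) (@measurable_id _ _ setT))).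
  - by case: (cmeasurable_cis (measurable_dotr (measurable_cst xi') (@measurable_id _ _ setT))).
have [h1 h2] := normc_cintegral_le mH HB (integrable_Zdecay _).
have E : \int[lam]_x (2 * C * S * decay x) = 2 * C * \int[lam]_x decay x * S.
  by rewrite RintegralZl//; [ring|exact: integrable_decay].
rewrite -E; split.
  by have -> : Re (fourier F xi) - Re (fourier F xi') = Re (fourier F xi - fourier F xi');
    [by []|rewrite HE].
by have -> : Im (fourier F xi) - Im (fourier F xi') = Im (fourier F xi - fourier F xi');
  [by []|rewrite HE].
Qed.

Lemma lipschitz_continuous (f : 'rV[R]_d -> R) (M : R) : 0 <= M ->
  (forall xi xi', `|f xi - f xi'| <= M * \sum_(i < d) `|xi ord0 i - xi' ord0 i|) ->
  continuous f.
Proof.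
move=> M0 fM xi; suff : f @ (nbhs (xi : 'rV[R]_d)) --> f xi by [].
have FF : Filter (nbhs (xi : 'rV[R]_d)) by exact: nbhs_filter.
apply/(@cvgrPdist_le _ _ _ _ FF) => e e0.
(* The neighbourhood is a ball for the sup norm, so [d] coordinates add up; the [+ 1] covers [M = 0]
   and [d = 0]. *)
have k0 : 0 < M * d%:R + 1 by rewrite ltr_wpDl// mulr_ge0.
have r0 : 0 < e / (M * d%:R + 1) by rewrite divr_gt0.
apply/nbhs_ballP; exists (e / (M * d%:R + 1)) => //= eta [_ hb].
apply: le_trans (fM _ _) _.
have h i : `|xi ord0 i - eta ord0 i| <= e / (M * d%:R + 1) by apply: ltW; exact: hb.
apply: (@le_trans _ _ (M * \sum_(i < d) (e / (M * d%:R + 1)))).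
  by rewrite ler_wpM2l// ler_sum.
rewrite sumr_const card_ord -(mulr_natr (e / _)).
have -> : M * (e / (M * d%:R + 1) * d%:R) = M * d%:R * e / (M * d%:R + 1) by ring.
by rewrite ler_pdivrMr// mulrC ler_pM2l// lerDl.
Qed.

Lemma fourier_continuous F : cdecay F ->
  continuous (fun xi => Re (fourier F xi)) /\ continuous (fun xi => Im (fourier F xi)).
Proof.
move=> dF; have [M M0 h] := fourier_lipschitz dF.
by split; apply: (lipschitz_continuous M0) => xi xi'; have [] := h xi xi'.
Qed.

Lemma cmeasurable_fourier F : cdecay F -> cmeasurable (fourier F).
Proof.
by move=> /fourier_continuous[c1 c2]; split; exact: continuous_rV_measurable.
Qed.

Lemma fourier_schwartz_cdecay F : schwartz F -> cdecay (fourier F).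
Proof.
move=> sF; split; first exact/cmeasurable_fourier/schwartz_cdecay.
have [sr si] := sF; have [C1 h1] := transform_decay sr; have [C2 h2] := transform_decay si.
have FC xi : normc (fourier F xi) <= (C1 + C2 + (C1 + C2)) * decay xi ^+ 2.
  have [a1 a2] := h1 xi; have [b1 b2] := h2 xi.
  apply: le_trans (normc_le_abs _) _; rewrite mulrDl.
  have -> : Re (fourier F xi) = cos_transform (fun x => Re (F x)) xi -
                                sin_transform (fun x => Im (F x)) xi.
    rewrite /cos_transform /sin_transform -RintegralB//.
    - by apply: eq_Rintegral => x _; rewrite ReM.
    - exact: integrable_cos_schwartz.
    - exact: integrable_sin_schwartz.
  have -> : Im (fourier F xi) = cos_transform (fun x => Im (F x)) xi +
                                sin_transform (fun x => Re (F x)) xi.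
    rewrite /cos_transform /sin_transform -RintegralD//.
    - by apply: eq_Rintegral => x _; rewrite ImM.
    - exact: integrable_cos_schwartz.
    - exact: integrable_sin_schwartz.
  apply: lerD; first by apply: le_trans (ler_normB _ _) _; rewrite mulrDl lerD.
  by apply: le_trans (ler_normD _ _) _; rewrite addrC mulrDl lerD.
by exists (C1 + C2 + (C1 + C2)) => //; exact: decay_const_ge0 FC.
Qed.

End fourier_decay.

(** * Fourier inversion *)

Section gaussian_rV.
Context (R : realType) (d : nat) (del : R).
Hypothesis d0 : 0 < del.
Notation lam := (lebesgue_rV R d).
Implicit Types (f g : 'rV[R]_d -> R) (x y : 'rV[R]_d).

Definition gaussian_rV x : R := expR (- (del ^+ 2 * dotr x x)).

Lemma gaussian_rV_prod x : gaussian_rV x = \prod_(i < d) gaussian del (x ord0 i).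
Proof.
rewrite /gaussian_rV /gaussian -expR_sum; congr expR.
rewrite /dotr mulr_sumr -sumrN; apply: eq_bigr => i _; ring.
Qed.

Lemma gaussian_rV_ge0 x : 0 <= gaussian_rV x.
Proof. exact: expR_ge0. Qed.

(** The induction also carries [1 <=] the product, needed to bound [(1 + a i) v] below by
    [v + a i]. *)
Lemma prod_add1_ge (a : 'I_d -> R) : (forall i, 0 <= a i) ->
  1 + \sum_(i < d) a i <= \prod_(i < d) (1 + a i).
Proof.
move=> a0; have : 1 + \sum_(i < d) a i <= \prod_(i < d) (1 + a i) /\ 1 <= \prod_(i < d) (1 + a i).
  elim/big_rec2: _ => [|i u v _ [h1 h2]]; first by rewrite addr0.
  by have := a0 i; split; nra.
by case.
Qed.

Let n1 x : R := 1 + \sum_(i < d) `|x ord0 i|.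

Let n1_ge1 x : 1 <= n1 x.
Proof. by rewrite lerDl sumr_ge0. Qed.

(** [n1 x] is at most the product of the [1 + |x_i|], so the bound factors into its one-dimensional
    case, one constant [C] per coordinate. *)
Let n1_gaussian_bound k : exists C : R, forall x, n1 x ^+ k * gaussian_rV x <= C * decay x.
Proof.
have [C CP] := gaussian_decay_bound k d0; exists (C ^+ d) => x.
apply: (@le_trans _ _ ((\prod_(i < d) (1 + `|x ord0 i|)) ^+ k * gaussian_rV x)).
  rewrite ler_wpM2r ?gaussian_rV_ge0// lerXn2r ?nnegrE ?(le_trans ler01)//.
    by rewrite (le_trans _ (prod_add1_ge _))// lerDl sumr_ge0.
  exact: prod_add1_ge.
rewrite gaussian_rV_prod -prodrXl -big_split/= /decay -[X in C ^+ X]card_ord -prodr_const.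
rewrite -big_split/=; apply: ler_prod => i _; rewrite CP andbT.
by rewrite mulr_ge0 ?gaussian_ge0// exprn_ge0// addr_ge0.
Qed.

Let coord_n1 i x : `|x ord0 i| <= n1 x.
Proof. by rewrite /n1 (bigD1 i)//= addrCA lerDl addr_ge0// sumr_ge0. Qed.

Let enorm_n1 x : enorm x <= n1 x.
Proof.
by apply: le_trans (enorm_le_sum x) _; rewrite lerDr.
Qed.

Variable y : 'rV[R]_d.

(* Closed under partial derivatives, hence made of Schwartz functions. *)
Inductive gaussian_class : ('rV[R]_d -> R) -> Prop :=
| gaussian_cos : gaussian_class (fun x => cos (dotr x y) * gaussian_rV x)
| gaussian_sin : gaussian_class (fun x => sin (dotr x y) * gaussian_rV x)
| gaussian_coord i f : gaussian_class f -> gaussian_class (fun x => x ord0 i * f x)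
| gaussian_scale a f : gaussian_class f -> gaussian_class (fun x => a * f x)
| gaussian_add f g : gaussian_class f -> gaussian_class g ->
    gaussian_class (fun x => f x + g x).

Let dcoord i x : differentiable (fun x : 'rV[R]_d => x ord0 i) x.
Proof. exact: differentiable_coord. Qed.

Let ddotr x : differentiable (fun x => dotr x y) x.
Proof.
rewrite (_ : (fun x => dotr x y) = \sum_(i < d) (fun x : 'rV[R]_d => x ord0 i * y ord0 i)).
  by apply: differentiable_sum => i; apply: differentiableM.
by apply/funext => z; rewrite fct_sumE.
Qed.

Let dgauss x : differentiable gaussian_rV x.
Proof.
have dq : differentiable (fun x => - (del ^+ 2 * dotr x x)) x.
  rewrite (_ : (fun x => _) = \sum_(i < d) (fun x : 'rV[R]_d => - del ^+ 2 * (x ord0 i * x ord0 i))).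
    by apply: differentiable_sum => i; apply: differentiableM => //; apply: differentiableM.
  by apply/funext => z; rewrite fct_sumE /dotr -mulNr mulr_sumr.
apply: (differentiable_comp dq); apply/derivable1_diffP.
exact: derivable_expR.
Qed.

(** The converse direction of [is_derive_line]: a partial derivative is computed as an ordinary
    derivative at [s = 0]. *)
Let is_derive_of_line f x i (l : R) :
  is_derive (0 : R) 1 (fun s : R => f (s *: delta_mx ord0 i + x)) l ->
  'D_(delta_mx ord0 i) f x = l.
Proof.
set v := delta_mx _ _; move=> [_ <-].
have E : (fun h : R => h^-1 *: (((fun s : R => f (s *: v + x)) \o shift (0 : R)) (h *: 1)
      - f ((0 : R) *: v + x))) = (fun h => h^-1 *: ((f \o shift x) (h *: v) - f x)).
  apply/funext => h; have h1 : h *: (1 : R) = h by rewrite /GRing.scale/= mulr1.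
  by rewrite /= h1 scale0r add0r addr0.
by rewrite /derive E.
Qed.

Lemma gaussian_class_differentiable f : gaussian_class f -> forall x, differentiable f x.
Proof.
elim => [x|x|i g _ IH x|a g _ IH x|g h _ IHg _ IHh x].
- apply: differentiableM => //; apply: (differentiable_comp (ddotr x)).
  exact/derivable1_diffP.
- apply: differentiableM => //; apply: (differentiable_comp (ddotr x)).
  exact/derivable1_diffP.
- exact: differentiableM.
- exact: differentiableM.
- exact: differentiableD.
Qed.

Let gauss_line i x (s : R) : gaussian_rV (s *: delta_mx ord0 i + x) =
  expR (- (del ^+ 2 * (dotr x x + 2 * s * x ord0 i + s * s * (delta_mx ord0 i : 'rV[R]_d) ord0 i))).
Proof.
rewrite /gaussian_rV; congr (expR (- (_ * _))).
rewrite !dotrDl !dotrDr !dotrZl !dotrZr !(dotrC x) !dotr_delta; ring.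
Qed.

Let is_derive_gauss_line i x : is_derive (0 : R) 1
  (fun s : R => gaussian_rV (s *: delta_mx ord0 i + x)) (- (2 * del ^+ 2) * (x ord0 i * gaussian_rV x)).
Proof.
rewrite (_ : (fun s => _) = (fun s => expR (- (del ^+ 2 * (dotr x x + 2 * s * x ord0 i + s * s *
  (delta_mx ord0 i : 'rV[R]_d) ord0 i))))); last by apply/funext => s; rewrite gauss_line.
set u := (delta_mx ord0 i : 'rV[R]_d) ord0 i.
have d1 : is_derive (0 : R) 1 (fun s : R => - (del ^+ 2 * (dotr x x + 2 * s * x ord0 i + s * s * u)))
   (- (2 * del ^+ 2) * x ord0 i).
  by apply: is_derive_eq; rewrite /GRing.scale/=; ring.
have dd := is_derive1_comp (is_derive_expR _) d1.
apply: (is_derive_eq dd); rewrite (_ : expR _ = gaussian_rV x); first by ring.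
by congr expR; ring.
Qed.

Let is_derive_trig_line (e e' : R -> R) i x : (forall s : R, is_derive s 1 e (e' s)) ->
  is_derive (0 : R) 1 (fun s : R => e (dotr (s *: delta_mx ord0 i + x) y))
    (y ord0 i * e' (dotr x y)).
Proof.
move=> de; rewrite (_ : (fun s => _) = (fun s => e (s * y ord0 i + dotr x y))); last first.
  by apply/funext => s; rewrite dotrDl dotrZl dotr_delta.
have d1 : is_derive (0 : R) 1 (fun s : R => s * y ord0 i + dotr x y) (y ord0 i).
  by apply: is_derive_eq; rewrite /GRing.scale/=; ring.
have := @is_derive1_comp R e (fun s => s * y ord0 i + dotr x y) 0 _ _ (de _) d1.
by rewrite mul0r add0r mulrC.
Qed.

Let trig_gauss_partial (e e' : R -> R) i x : (forall s : R, is_derive s 1 e (e' s)) ->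
  'D_(delta_mx ord0 i) (fun x => e (dotr x y) * gaussian_rV x) x =
  y ord0 i * (e' (dotr x y) * gaussian_rV x) +
  - (2 * del ^+ 2) * (x ord0 i * (e (dotr x y) * gaussian_rV x)).
Proof.
move=> de; apply: is_derive_of_line.
have dm := is_deriveM (is_derive_trig_line i x de) (is_derive_gauss_line i x).
by apply: (is_derive_eq dm); rewrite !scale0r !add0r /GRing.scale/=; ring.
Qed.

Lemma gaussian_class_partial f i : gaussian_class f -> gaussian_class (partials [:: i] f).
Proof.
rewrite /partials/=; elim => [||j g gg IH|a g gg IH|g h gg IHg gh IHh].
- rewrite (_ : (fun x => _) = (fun x => - y ord0 i * (sin (dotr x y) * gaussian_rV x) +
    - (2 * del ^+ 2) * (x ord0 i * (cos (dotr x y) * gaussian_rV x)))).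
    by apply: gaussian_add; apply: gaussian_scale; [exact: gaussian_sin|
      apply: gaussian_coord; exact: gaussian_cos].
  apply/funext => x; rewrite (@trig_gauss_partial cos (fun s => - sin s)); ring.
- rewrite (_ : (fun x => _) = (fun x => y ord0 i * (cos (dotr x y) * gaussian_rV x) +
    - (2 * del ^+ 2) * (x ord0 i * (sin (dotr x y) * gaussian_rV x)))).
    by apply: gaussian_add; apply: gaussian_scale; [exact: gaussian_cos|
      apply: gaussian_coord; exact: gaussian_sin].
  by apply/funext => x; rewrite (@trig_gauss_partial sin cos).
- have dg := gaussian_class_differentiable gg.
  rewrite (_ : (fun x => _) = (fun x => x ord0 j * 'D_(delta_mx ord0 i) g x +
     (delta_mx ord0 i : 'rV[R]_d) ord0 j * g x)).
    by apply: gaussian_add; [exact: gaussian_coord|exact: gaussian_scale].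
  apply/funext => x; rewrite deriveM; [|exact: diff_derivable..].
  rewrite /GRing.scale/=; congr (_ + _); rewrite mulrC; congr (_ * _).
  apply: is_derive_of_line.
  rewrite (_ : (fun s => _) = (fun s : R => s * (delta_mx ord0 i : 'rV[R]_d) ord0 j + x ord0 j)).
    by apply: is_derive_eq; rewrite /GRing.scale/=; ring.
  by apply/funext => s; rewrite !mxE.
- have dg := gaussian_class_differentiable gg.
  rewrite (_ : (fun x => _) = (fun x => a * 'D_(delta_mx ord0 i) g x)).
    exact: gaussian_scale.
  apply/funext => x; have := @deriveZ R _ _ g a x (delta_mx ord0 i) => /(_ _)/wrap[].
    exact: diff_derivable.
  exact.
- have dg := gaussian_class_differentiable gg.
  have dh := gaussian_class_differentiable gh.
  rewrite (_ : (fun x => _) = (fun x => 'D_(delta_mx ord0 i) g x + 'D_(delta_mx ord0 i) h x)).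
    exact: gaussian_add.
  by apply/funext => x; rewrite -deriveD//; exact: diff_derivable.
Qed.

Lemma gaussian_class_bound f : gaussian_class f ->
  exists (k : nat) (C : R), 0 <= C /\ forall x, `|f x| <= C * (n1 x ^+ k * gaussian_rV x).
Proof.
elim => [||j g gg [k [C [C0 IH]]]|a g gg [k [C [C0 IH]]]|g h gg [k [C [C0 IH]]] gh [k' [C' [C'0 IH']]]].
- exists 0%N, 1; split => // x; rewrite expr0 !mul1r normrM (ger0_norm (gaussian_rV_ge0 _)).
  by rewrite ler_piMl ?gaussian_rV_ge0// ler_norml cos_geN1 cos_le1.
- exists 0%N, 1; split => // x; rewrite expr0 !mul1r normrM (ger0_norm (gaussian_rV_ge0 _)).
  by rewrite ler_piMl ?gaussian_rV_ge0// ler_norml sin_geN1 sin_le1.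
- exists k.+1, C; split=> // x; rewrite normrM exprS -mulrA mulrCA.
  by apply: ler_pM => //; exact: coord_n1.
- exists k, (`|a| * C); split=> [|x]; first by rewrite mulr_ge0.
  by rewrite normrM -mulrA ler_wpM2l.
- exists (k + k')%N, (C + C'); split=> [|x]; first by rewrite addr_ge0.
  apply: le_trans (ler_normD _ _) _; rewrite mulrDl lerD//.
    apply: le_trans (IH x) _; rewrite ler_wpM2l// ler_wpM2r ?gaussian_rV_ge0//.
    by rewrite ler_weXn2l// leq_addr.
  apply: le_trans (IH' x) _; rewrite ler_wpM2l// ler_wpM2r ?gaussian_rV_ge0//.
  by rewrite ler_weXn2l// leq_addl.
Qed.

Lemma gaussian_class_schwartz f : gaussian_class f -> schwartz_real f.
Proof.
move=> gf s; have gs : gaussian_class (partials s f).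
  by elim: s => [//|i s IH]; exact: (gaussian_class_partial i IH).
split; first exact: gaussian_class_differentiable.
move=> k; have [j [C [C0 CP]]] := gaussian_class_bound gs.
have [C' C'P] := n1_gaussian_bound (k + j); exists (C * C') => x.
have C'0 : 0 <= C'.
  have : 0 <= C' * decay x.
    apply: le_trans (C'P x).
    by rewrite mulr_ge0 ?gaussian_rV_ge0// exprn_ge0// (le_trans _ (n1_ge1 _)).
  by rewrite pmulr_lge0// decay_gt0.
apply: (@le_trans _ _ (n1 x ^+ k * (C * (n1 x ^+ j * gaussian_rV x)))).
  by rewrite ler_pM ?exprn_ge0 ?enorm_ge0// lerXn2r ?nnegrE ?enorm_ge0// (le_trans _ (n1_ge1 _)).
have -> : n1 x ^+ k * (C * (n1 x ^+ j * gaussian_rV x)) = C * (n1 x ^+ (k + j) * gaussian_rV x).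
  by rewrite exprD; ring.
rewrite ler_wpM2l//.
by apply: le_trans (C'P x) _; rewrite ler_piMr// decay_le1.
Qed.

(** The modulation by [y] translates the transform, a heat kernel, so that it is centred at [- y];
    pairing with this function therefore probes a neighbourhood of [- y]. *)
Definition gaussian_wave x : R[i] := cis (dotr x y) * (gaussian_rV x)%:C.

Lemma schwartz_gaussian_wave : schwartz gaussian_wave.
Proof.
split.
  rewrite (_ : (fun x => _) = (fun x => cos (dotr x y) * gaussian_rV x)).
    by apply: gaussian_class_schwartz; exact: gaussian_cos.
  by apply/funext => x; rewrite ReM/= mulr0 subr0.
rewrite (_ : (fun x => _) = (fun x => sin (dotr x y) * gaussian_rV x)).
  by apply: gaussian_class_schwartz; exact: gaussian_sin.
by apply/funext => x; rewrite ImM/= mulr0 add0r.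
Qed.

End gaussian_rV.

(** * The Fourier transform of a modulated Gaussian *)

Section gaussian_transform.
Context (R : realType) (del : R).
Hypothesis d0 : 0 < del.
Notation mu := (@lebesgue_measure R).
Notation lam := (lebesgue_rV R).

Lemma integrable_gaussian : mu.-integrable setT (EFin \o gaussian del).
Proof.
have := integrable_gaussian_poly 0 d0; apply: eq_integrable => // s _ /=.
by rewrite expr0 mul1r.
Qed.

Lemma integrable_prod_gaussian d : (lam d).-integrable setT
  (EFin \o (fun x : 'rV[R]_d => \prod_(i < d) gaussian del (x ord0 i))).
Proof.
apply: (integrable_prod_coord (h := fun _ => gaussian del)) => [i s|i].
  exact: gaussian_ge0.
exact: integrable_gaussian.
Qed.

Let K (z : R) : R := Num.sqrt pi / del * expR (- (z / (2 * del)) ^+ 2).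

Let cgauss d (z : 'rV[R]_d) (x : 'rV[R]_d) : R[i] :=
  cis (dotr z x) * (\prod_(i < d) gaussian del (x ord0 i))%:C.

Let cgauss_integrable d z : cintegrable (lam d) setT (cgauss z).
Proof.
apply: (cintegrable_dominated _ _ (integrable_prod_gaussian d)).
  apply: cmeasurableM; first by apply: cmeasurable_cis; exact: measurable_dotr.
  apply: cmeasurable_real; apply: (measurable_prod_coord (h := fun _ => gaussian del)) => _.
  exact: continuous_measurable_fun (@continuous_gaussian _ _).
move=> x; rewrite normcM normc_cis mul1r normc_real ger0_norm// prodr_ge0// => i _.
exact: gaussian_ge0.
Qed.

Let cgauss1_integrable z : cintegrable mu setT (fun s => cis (z * s) * (gaussian del s)%:C).
Proof.
apply: (cintegrable_dominated _ _ integrable_gaussian).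
  apply: cmeasurableM; first by apply: cmeasurable_cis; exact: measurable_funM.
  by apply: cmeasurable_real; exact: continuous_measurable_fun (@continuous_gaussian _ _).
by move=> s; rewrite normcM normc_cis mul1r normc_real ger0_norm// gaussian_ge0.
Qed.

Let cintegral_gauss1 z :
  cintegral mu setT (fun s => cis (z * s) * (gaussian del s)%:C) = (K z)%:C.
Proof.
apply: complex_eq => /=.
  rewrite -[RHS](Rintegral_cos_gaussian d0); apply: eq_Rintegral => s _.
  by rewrite mulr0 subr0.
rewrite -[RHS](Rintegral_sin_gaussian d0 z); apply: eq_Rintegral => s _.
by rewrite mulr0 add0r.
Qed.

(** Fubini splits off the first coordinate. In dimension 0 the total mass 1 matches the empty
    product. *)
Lemma cintegral_prod_gaussian d (z : 'rV[R]_d) :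
  cintegral (lam d) setT (cgauss z) = (\prod_(i < d) K (z ord0 i))%:C.
Proof.
elim: d z => [|d IH] z.
  have E x : cgauss z x = 1%:C.
    by rewrite /cgauss /dotr !big_ord0 cis0 mul1r.
  have l1 : lam 0 setT = 1%E by rewrite /= diracE in_setT.
  rewrite (eq_cintegral _ E) big_ord0; apply: complex_eq.
    transitivity (1 * fine (lam 0 setT)); last by rewrite l1 mulr1.
    exact: (Rintegral_cst (lam 0) measurableT 1).
  by rewrite [LHS]Rintegral_cst// mul0r.
pose z' : 'rV[R]_d := \row_i z ord0 (lift ord0 i).
have [ri ii] := cgauss_integrable z.
have pi' : cintegrable (mu \x lam d)%E setT (fun p => cgauss z (rV_cons p)).
  by split; [exact: (integrable_rV_cons ri)|exact: (integrable_rV_cons ii)].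
have -> : cintegral (lam d.+1) setT (cgauss z) =
    cintegral (mu \x lam d)%E setT (fun p => cgauss z (rV_cons p)).
  by apply: complex_eq => /=; [exact: Rintegral_rV_cons ri|exact: Rintegral_rV_cons ii].
rewrite (cintegral_prod pi').1.
have E s y : cgauss z (rV_cons (s, y)) =
    cis (z ord0 ord0 * s) * (gaussian del s)%:C * cgauss z' y.
  rewrite /cgauss /dotr !big_ord_recl !rV_cons0.
  have -> : \sum_(i < d) z ord0 (lift ord0 i) * rV_cons (s, y) ord0 (lift ord0 i) =
      \sum_(i < d) z' ord0 i * y ord0 i.
    by apply: eq_bigr => i _; rewrite rV_consS mxE.
  have -> : \prod_(i < d) gaussian del (rV_cons (s, y) ord0 (lift ord0 i)) =
      \prod_(i < d) gaussian del (y ord0 i).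
    by apply: eq_bigr => i _; rewrite rV_consS.
  by rewrite cisD rmorphM/= mulrACA.
transitivity (cintegral mu setT (fun s => cis (z ord0 ord0 * s) * (gaussian del s)%:C *
    (\prod_(i < d) K (z' ord0 i))%:C)).
  apply: eq_cintegral => s; rewrite -IH -cintegralZl; last exact: cgauss_integrable.
  by apply: eq_cintegral => y; exact: E.
rewrite cintegralZr; last exact: cgauss1_integrable.
have -> : \prod_(i < d) K (z' ord0 i) = \prod_(i < d) K (z ord0 (lift ord0 i)).
  by apply: eq_bigr => i _; rewrite mxE.
by rewrite cintegral_gauss1 big_ord_recl -rmorphM.
Qed.

(** The heat kernel at time [del^2] without its normalization: the total mass is [(2 pi)^d] for
    every [del]. *)
Definition heat_kernel d (z : 'rV[R]_d) : R := \prod_(i < d) K (z ord0 i).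

Lemma fourier_gaussian_wave d (y x : 'rV[R]_d) :
  fourier (gaussian_wave del y) x = (heat_kernel (x + y))%:C.
Proof.
rewrite /fourier -cintegral_prod_gaussian; apply: eq_cintegral => xi.
by rewrite /gaussian_wave /cgauss gaussian_rV_prod mulrA -cisD dotrDl [dotr xi y]dotrC.
Qed.

Lemma heat_kernelE d (z : 'rV[R]_d) : heat_kernel ((2 * del) *: z) =
  (Num.sqrt pi / del) ^+ d * \prod_(i < d) gaussian 1 (z ord0 i).
Proof.
rewrite /heat_kernel -[X in _ ^+ X]card_ord -prodr_const -big_split/=.
apply: eq_bigr => i _; rewrite /K mxE /gaussian mul1r; congr (_ * expR (- _ ^+ 2)).
by rewrite mulrC mulKf// mulf_neq0// gt_eqF.
Qed.

End gaussian_transform.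

(** * Gaussian averages of slowly increasing functions *)

Section approximate_identity.
Context (R : realType) (d : nat).
Notation lam := (lebesgue_rV R d).
Implicit Types (f : 'rV[R]_d -> R) (x y : 'rV[R]_d).

Lemma Rintegral_prod_gaussian1 :
  \int[lam]_x (\prod_(i < d) gaussian 1 (x ord0 i)) = Num.sqrt pi ^+ d :> R.
Proof.
have := cintegral_prod_gaussian (@ltr01 R) (0 : 'rV[R]_d).
move=> /(congr1 (@complex.Re R)) /=.
under eq_Rintegral.
  move=> x _; rewrite (_ : dotr 0 x = 0); last first.
    by rewrite -(scale0r x) dotrZl mul0r.
  rewrite cos0 sin0 mul1r mul0r subr0; over.
move=> ->; under eq_bigr do rewrite mxE mul0r expr0n/= oppr0 expR0 mulr1 divr1.
by rewrite prodr_const card_ord.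
Qed.

(** Dominated convergence. As [1 / (n + 1) <= 1], the growth factor [1 + enorm] at the shifted point
    is at most the product of the [(2 + |x_i|) (1 + |y_i|)], uniformly in [n], and its powers are
    integrable against the Gaussian. *)
Lemma approximate_identity f x : slowly_increasing_real f ->
  \int[lam]_y (f ((2 * n.+1%:R^-1) *: y + x) * \prod_(i < d) gaussian 1 (y ord0 i))
    @[n --> \oo] --> f x * Num.sqrt pi ^+ d.
Proof.
move=> [cf [C [k fC]]].
have C0 : 0 <= C.
  have := le_trans (normr_ge0 _) (fC 0); rewrite pmulr_lge0// exprn_gt0//.
  by rewrite ltr_pwDl// enorm_ge0.
rewrite -Rintegral_prod_gaussian1 -RintegralZl//; last exact: integrable_prod_gaussian.
pose g y := C * \prod_(i < d) (((2 + `|x ord0 i|) * (1 + `|y ord0 i|)) ^+ k * gaussian 1 (y ord0 i)).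
have gg y : 0 <= \prod_(i < d) gaussian 1 (y ord0 i) :> R.
  by apply: prodr_ge0 => i _; exact: gaussian_ge0.
have mg : measurable_fun setT (fun y => \prod_(i < d) gaussian 1 (y ord0 i) : R).
  apply: (measurable_prod_coord (h := fun _ => gaussian 1)) => _.
  exact: continuous_measurable_fun (@continuous_gaussian _ _).
apply: (@Rintegral_dominated_cvg _ _ _ lam _ _ g).
- move=> n; apply: measurable_funM => //.
  exact: measurableT_comp (continuous_rV_measurable cf) (measurable_rV_affine _ _).
- move=> y; apply: cvgM; last exact: cvg_cst.
  have hx : (2 * n.+1%:R^-1) *: y + x @[n --> \oo] --> x.
    apply: cvg_rV => i.
    have -> : (fun n => ((2 * n.+1%:R^-1) *: y + x) ord0 i) =
        (fun n => 2 * n.+1%:R^-1 * y ord0 i + x ord0 i) by apply/funext => n; rewrite !mxE.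
    have : 2 * n.+1%:R^-1 * y ord0 i + x ord0 i @[n --> \oo] --> 2 * 0 * y ord0 i + x ord0 i.
      apply: cvgD; last exact: cvg_cst.
      apply: cvgM; last exact: cvg_cst.
      by apply: cvgM; [exact: cvg_cst|exact: cvg_harmonic].
    by rewrite mulr0 mul0r add0r.
  exact: (cvg_comp _ f hx (cf x)).
- move=> n y; rewrite normrM (ger0_norm (gg y)) /g big_split/= mulrA ler_wpM2r//.
  apply: le_trans (fC _) _; rewrite ler_wpM2l// prodrXl lerXn2r ?nnegrE//.
  + by rewrite addr_ge0// enorm_ge0.
  + by apply: prodr_ge0 => i _; rewrite mulr_ge0// addr_ge0.
  + apply: (@le_trans _ _ (1 + \sum_(i < d) `|((2 * n.+1%:R^-1) *: y + x) ord0 i|)).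
      rewrite lerD2l; exact: enorm_le_sum.
    apply: le_trans (prod_add1_ge (fun i => normr_ge0 _)) _.
    apply: ler_prod => i _; rewrite addr_ge0//= !mxE.
    have n1 : n.+1%:R^-1 <= 1 :> R by rewrite invf_le1// ler1n.
    have n0 : 0 <= n.+1%:R^-1 :> R by rewrite invr_ge0.
    have h1 : `|2 * n.+1%:R^-1 * y ord0 i| <= 2 * `|y ord0 i|.
      rewrite !normrM (ger0_norm n0) ger0_norm// ler_wpM2r//.
      by rewrite -[leRHS]mulr1 ler_wpM2l.
    have := ler_normD (2 * n.+1%:R^-1 * y ord0 i) (x ord0 i).
    by have := normr_ge0 (x ord0 i); have := normr_ge0 (y ord0 i); nra.
- apply: integrableZl_real => //.
  apply: (integrable_prod_coord (h := fun i s => ((2 + `|x ord0 i|) * (1 + `|s|)) ^+ k * gaussian 1 s)).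
    by move=> i s; rewrite mulr_ge0 ?gaussian_ge0// exprn_ge0// mulr_ge0// addr_ge0.
  move=> i; have := integrableZl_real ((2 + `|x ord0 i|) ^+ k) measurableT
     (integrable_gaussian_poly k (@ltr01 R)).
  by apply: eq_integrable => // s _ /=; rewrite exprMn mulrA.
Qed.

End approximate_identity.

(** * The inversion formula *)

Section inversion.
Context (R : realType) (d : nat).
Notation lam := (lebesgue_rV R d).
Implicit Types (f F G psi : 'rV[R]_d -> R[i]) (x y xi : 'rV[R]_d).

(** Both sides are iterated integrals of [F x * cis (s * dotr x xi) * G xi], dominated by a product
    of two decays. The scale [s] is used with values 1 and -1, the latter for the inverse
    transform. *)
Lemma multiplication_formula (s : R) F G : cdecay F -> cdecay G ->
  cintegral lam setT (fun x => F x * fourier G (s *: x)) =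
  cintegral lam setT (fun xi => fourier F (s *: xi) * G xi).
Proof.
move=> dF dG; have [mF _] := dF; have [mG _] := dG.
have [C C0 FC] := cdecay_dominated dF; have [D D0 GD] := cdecay_dominated dG.
pose f (z : 'rV[R]_d * 'rV[R]_d) := F z.1 * (cis (dotr (s *: z.1) z.2) * G z.2).
have mf : cmeasurable f.
  apply: cmeasurableM; first exact: cmeasurable_comp mF measurable_fst.
  apply: cmeasurableM; last exact: cmeasurable_comp mG measurable_snd.
  apply: cmeasurable_cis; apply: measurable_dotr; last exact: measurable_snd.
  have := measurableT_comp (measurable_rV_affine s (0 : 'rV[R]_d)) (@measurable_fst _ _ 'rV[R]_d 'rV[R]_d).
  by apply: eq_measurable_fun => z _ /=; rewrite addr0.
transitivity (cintegral lam setT (fun x => cintegral lam setT (fun xi => f (x, xi)))).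
  apply: eq_cintegral => x; rewrite /fourier -cintegralZl//.
  apply: cintegrable_cdecay; apply: (cdecayM (M := 1)) => //.
    by apply: cmeasurable_cis; exact: measurable_dotr.
  by move=> xi; rewrite normc_cis.
rewrite (cfubini (g := fun x => C * decay x) (h := fun x => D * decay x) mf).
- apply: eq_cintegral => xi; rewrite /fourier -cintegralZr//.
    by apply: eq_cintegral => x; rewrite /f/= dotrZl [dotr x xi]dotrC -dotrZl; ring.
  apply: cintegrable_cdecay; apply: (cdecayM (M := 1)) => //.
    by apply: cmeasurable_cis; exact: measurable_dotr.
  by move=> x; rewrite normc_cis.
- by move=> x xi; rewrite /f/= !normcM normc_cis mul1r ler_pM// normc_ge0.
- by move=> x; rewrite mulr_ge0// decay_ge0.
- by move=> x; rewrite mulr_ge0// decay_ge0.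
- exact: integrable_Zdecay.
- exact: integrable_Zdecay.
Qed.

Definition inverse_fourier F x : R[i] := (((2 * pi) ^+ d)^-1)%:C *
  cintegral lam setT (fun xi => cis (- dotr xi x) * F xi).

Lemma inverse_fourierE F x :
  inverse_fourier F x = (((2 * pi) ^+ d)^-1)%:C * fourier F (-1 *: x).
Proof.
congr (_ * _); apply: eq_cintegral => xi.
by rewrite dotrZl mulN1r dotrC.
Qed.

(** With [z = (2 del) y + x], the Jacobian [(2 del)^d] meets the height [(sqrt pi / del)^d] of the
    heat kernel, and [del] cancels from the constant. *)
Let pairing_gaussian (f : 'rV[R]_d -> R) x (del : R) : 0 < del ->
  lam.-integrable setT (EFin \o (fun z => f z * heat_kernel del (z - x))) ->
  \int[lam]_z (f z * heat_kernel del (z - x)) = (2 * Num.sqrt pi) ^+ d *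
    \int[lam]_y (f ((2 * del) *: y + x) * \prod_(i < d) gaussian 1 (y ord0 i)).
Proof.
move=> d0 fi; have a0 : 0 < 2 * del by rewrite mulr_gt0.
have [fi' E] := integrable_rV_affine x a0 fi.
pose c := (Num.sqrt pi / del) ^+ d : R.
have cN0 : c != 0 by rewrite expf_neq0// mulf_neq0 ?gt_eqF ?invr_gt0 ?sqrtr_gt0 ?pi_gt0.
have E' y : f ((2 * del) *: y + x) * heat_kernel del ((2 * del) *: y + x - x) =
    c * (f ((2 * del) *: y + x) * \prod_(i < d) gaussian 1 (y ord0 i)).
  by rewrite addrK heat_kernelE// mulrCA.
have fi2 : lam.-integrable setT (EFin \o (fun y =>
    f ((2 * del) *: y + x) * \prod_(i < d) gaussian 1 (y ord0 i))).
  have := integrableZl_real c^-1 measurableT fi'.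
  by apply: eq_integrable => // y _ /=; rewrite E' mulKf.
have {}E : \int[lam]_z (f z * heat_kernel del (z - x)) = (2 * del) ^+ d *
    (c * \int[lam]_y (f ((2 * del) *: y + x) * \prod_(i < d) gaussian 1 (y ord0 i))).
  rewrite -RintegralZl//.
  have -> : \int[lam]_y (c * (f ((2 * del) *: y + x) * \prod_(i < d) gaussian 1 (y ord0 i))) =
      \int[lam]_y (f ((2 * del) *: y + x) * heat_kernel del ((2 * del) *: y + x - x)).
    by apply: eq_Rintegral => y _; rewrite E'.
  by rewrite E mulrA divff ?mul1r// expf_neq0// gt_eqF.
rewrite E mulrA /c -exprMn; congr (_ ^+ _ * _).
by field; rewrite gt_eqF.
Qed.

Let del_ (n : nat) : R := n.+1%:R^-1.

Let del_gt0 n : 0 < del_ n. Proof. by rewrite invr_gt0. Qed.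

Let gaussian_rV_cvg1 xi : gaussian_rV (del_ n) xi @[n --> \oo] --> (1 : R).
Proof.
have h : - (del_ n ^+ 2 * dotr xi xi) @[n --> \oo] --> - (0 ^+ 2 * dotr xi xi).
  apply: cvgN; apply: cvgM; last exact: cvg_cst.
  by apply: cvgM; exact: cvg_harmonic.
have := cvg_comp _ expR h (@continuous_expR R (- (0 ^+ 2 * dotr xi xi))).
by rewrite expr0n mul0r oppr0 expR0.
Qed.

Let pi_sqrt : (2 * Num.sqrt pi) ^+ d * (Num.sqrt pi ^+ d) = (2 * pi) ^+ d :> R.
Proof. by rewrite -exprMn -mulrA -expr2 sqr_sqrtr// pi_ge0. Qed.

(** The limits of [u] agree by uniqueness, and the two Gaussian constants multiply to [(2 pi)^d],
    the constant of the inversion formula. *)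
Let scaled_limit (a l : R) (u v : nat -> R) : (forall n, u n = (2 * Num.sqrt pi) ^+ d * v n) ->
  v n @[n --> \oo] --> a * Num.sqrt pi ^+ d -> u n @[n --> \oo] --> l ->
  a = ((2 * pi) ^+ d)^-1 * l.
Proof.
move=> uv va ul.
have h : u n @[n --> \oo] --> (2 * Num.sqrt pi) ^+ d * (a * Num.sqrt pi ^+ d).
  by under eq_fun do rewrite uv; apply: cvgM; [exact: cvg_cst|exact: va].
have -> : l = (2 * pi) ^+ d * a.
  by rewrite -(cvg_lim _ ul)// (cvg_lim _ h)// -pi_sqrt; ring.
by rewrite mulKf// expf_neq0// mulf_neq0// gt_eqF// pi_gt0.
Qed.

(** The test functions are Gaussians modulated by [- x] with widths tending to infinity. On the side
    of [f] their transforms concentrate at [x] and yield [(2 pi)^d f x]; on the side of [F] the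
    Gaussians tend to 1 and dominated convergence yields the integral in [inverse_fourier]. *)
Lemma fourier_inversion f F : slowly_increasing f -> cdecay F -> is_fourier f F ->
  f =1 inverse_fourier F.
Proof.
move=> [sr si] dF fF x.
pose psi n := gaussian_wave (del_ n) (- x).
have spsi n : schwartz (psi n) by exact: schwartz_gaussian_wave (del_gt0 n) _.
have fpsi n z : fourier (psi n) z = (heat_kernel (del_ n) (z - x))%:C.
  exact: fourier_gaussian_wave.
have [C C0 FC] := cdecay_dominated dF; have [mF _] := dF.
have [] := @cintegral_dominated_cvg _ _ _ lam (fun n xi => F xi * psi n xi)
  (fun xi => cis (- dotr xi x) * F xi) (fun xi => C * decay xi).
- move=> n; apply: cmeasurableM => //; have [_] := spsi n.
  by case: (schwartz_cdecay (spsi n)).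
- move=> xi; have E n : Re (F xi * psi n xi) = gaussian_rV (del_ n) xi * Re (cis (- dotr xi x) * F xi).
    rewrite /psi /gaussian_wave -scaleN1r dotrZr mulN1r.
    by rewrite mulrA [F xi * _]mulrC ReM/=; ring.
  under eq_fun do rewrite E.
  have : gaussian_rV (del_ n) xi * Re (cis (- dotr xi x) * F xi) @[n --> \oo] -->
      1 * Re (cis (- dotr xi x) * F xi).
    by apply: cvgM; [exact: gaussian_rV_cvg1|exact: cvg_cst].
  by rewrite mul1r.
- move=> xi; have E n : Im (F xi * psi n xi) = gaussian_rV (del_ n) xi * Im (cis (- dotr xi x) * F xi).
    rewrite /psi /gaussian_wave -scaleN1r dotrZr mulN1r.
    by rewrite mulrA [F xi * _]mulrC ImM/=; ring.
  under eq_fun do rewrite E.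
  have : gaussian_rV (del_ n) xi * Im (cis (- dotr xi x) * F xi) @[n --> \oo] -->
      1 * Im (cis (- dotr xi x) * F xi).
    by apply: cvgM; [exact: gaussian_rV_cvg1|exact: cvg_cst].
  by rewrite mul1r.
- move=> n xi; rewrite !normcM normc_cis mul1r normc_real ger0_norm ?gaussian_rV_ge0//.
  apply: le_trans (FC xi); rewrite ler_piMr ?normc_ge0//.
  by rewrite -expR0 ler_expR oppr_le0 mulr_ge0 ?sqr_ge0 ?dotr_ge0.
- exact: integrable_Zdecay.
move=> cr ci.
have reE n : Re (cintegral lam setT (fun z => f z * fourier (psi n) z)) =
    \int[lam]_z (Re (f z) * heat_kernel (del_ n) (z - x)).
  by apply: eq_Rintegral => z _; rewrite fpsi ReM/= mulr0 subr0.
have imE n : Im (cintegral lam setT (fun z => f z * fourier (psi n) z)) =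
    \int[lam]_z (Im (f z) * heat_kernel (del_ n) (z - x)).
  by apply: eq_Rintegral => z _; rewrite fpsi ImM/= mulr0 add0r.
apply: complex_eq; rewrite /inverse_fourier ?Re_realM ?Im_realM.
- have uv n : Re (cintegral lam setT (fun xi => F xi * psi n xi)) = (2 * Num.sqrt pi) ^+ d *
      \int[lam]_y (Re (f ((2 * del_ n) *: y + x)) * \prod_(i < d) gaussian 1 (y ord0 i)).
    have [[ri _] _ <-] := fF _ (spsi n); rewrite reE.
    apply: (pairing_gaussian (f := fun x => Re (f x))) => //.
    apply: eq_integrable ri => // z _ /=.
    by rewrite fpsi ReM/= mulr0 subr0.
  exact: (scaled_limit uv (approximate_identity (x := x) sr) cr).
- have uv n : Im (cintegral lam setT (fun xi => F xi * psi n xi)) = (2 * Num.sqrt pi) ^+ d *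
      \int[lam]_y (Im (f ((2 * del_ n) *: y + x)) * \prod_(i < d) gaussian 1 (y ord0 i)).
    have [[_ ii] _ <-] := fF _ (spsi n); rewrite imE.
    apply: (pairing_gaussian (f := fun x => Im (f x))) => //.
    apply: eq_integrable ii => // z _ /=.
    by rewrite fpsi ImM/= mulr0 add0r.
  exact: (scaled_limit uv (approximate_identity (x := x) si) ci).
Qed.

Lemma schwartz_slowly_increasing psi : schwartz psi -> slowly_increasing psi.
Proof.
have h (g : 'rV[R]_d -> R) : schwartz_real g -> slowly_increasing_real g.
  move=> sg; split; first exact: schwartz_real_continuous.
  have [_ /(_ 0%N)[C CP]] := sg [::].
  by exists C, 0%N => x; have := CP x; rewrite !expr0 mul1r mulr1.
by move=> [sr si]; split; exact: h.
Qed.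

Lemma cdecay_bounded F : cdecay F -> exists M : R, forall x, normc (F x) <= M.
Proof.
move=> [_ [C C0 FC]]; exists C => x; apply: le_trans (FC x) _.
by rewrite ler_piMr// exprn_ile1 ?decay_ge0 ?decay_le1.
Qed.

Lemma cintegrableM F G (M : R) : cdecay F -> cmeasurable G -> (forall x, normc (G x) <= M) ->
  cintegrable lam setT (fun x => F x * G x).
Proof.
move=> dF mG GM; have := cintegrable_cdecay (cdecayM dF mG GM).
by rewrite (_ : (fun x => F x * G x) = (fun x => G x * F x))//; apply/funext => x; rewrite mulrC.
Qed.

(** By the multiplication formula with [s = 1], the integral transform is also the transform in the
    distributional sense. *)
Lemma schwartz_inversion psi : schwartz psi -> psi =1 inverse_fourier (fourier psi).
Proof.
move=> spsi; have dpsi := schwartz_cdecay spsi.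
apply: fourier_inversion.
- exact: schwartz_slowly_increasing.
- exact: fourier_schwartz_cdecay.
move=> chi schi; have dchi := schwartz_cdecay schi.
have [M1 h1] := fourier_bounded dchi; have [M2 h2] := cdecay_bounded dchi.
have [mchi _] := dchi; split.
- exact: cintegrableM dpsi (cmeasurable_fourier dchi) h1.
- exact: cintegrableM (fourier_schwartz_cdecay spsi) mchi h2.
have := multiplication_formula 1 dpsi dchi.
rewrite (_ : (fun x => _) = (fun x => psi x * fourier chi x)); last first.
  by apply/funext => x; rewrite scale1r.
by move=> ->; apply: eq_cintegral => xi; rewrite scale1r.
Qed.

(** Up to a reflection and a constant this is a Fourier transform, which is Lipschitz and bounded,
    so the growth exponent is 0. *)
Lemma inverse_fourier_slowly_increasing F : cdecay F -> slowly_increasing (inverse_fourier F).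
Proof.
move=> dF; have [M M0 h] := fourier_lipschitz dF; have [B FB] := fourier_bounded dF.
set c := ((2 * pi) ^+ d)^-1 : R.
have c0 : 0 <= c by rewrite invr_ge0 exprn_ge0// mulr_ge0// pi_ge0.
have rE x : Re (inverse_fourier F x) = c * Re (fourier F (-1 *: x)).
  by rewrite inverse_fourierE ReM/= mul0r subr0.
have iE x : Im (inverse_fourier F x) = c * Im (fourier F (-1 *: x)).
  by rewrite inverse_fourierE ImM/= mul0r addr0.
have sumE x y : \sum_(i < d) `|(-1 *: x) ord0 i - (-1 *: y) ord0 i| =
    \sum_(i < d) `|x ord0 i - y ord0 i|.
  by apply: eq_bigr => i _; rewrite !mxE -mulrBr normrM normrN1 mul1r.
split; split.
- apply: (@lipschitz_continuous _ _ _ (c * M)); first exact: mulr_ge0.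
  move=> x y; rewrite !rE -mulrBr normrM (ger0_norm c0) -mulrA ler_wpM2l//.
  by rewrite -sumE; have [] := h (-1 *: x) (-1 *: y).
- exists (c * B), 0%N => x; rewrite expr0 mulr1 rE normrM (ger0_norm c0) ler_wpM2l//.
  by apply: le_trans (FB (-1 *: x)); exact: normc_ge_absRe.
- apply: (@lipschitz_continuous _ _ _ (c * M)); first exact: mulr_ge0.
  move=> x y; rewrite !iE -mulrBr normrM (ger0_norm c0) -mulrA ler_wpM2l//.
  by rewrite -sumE; have [] := h (-1 *: x) (-1 *: y).
- exists (c * B), 0%N => x; rewrite expr0 mulr1 iE normrM (ger0_norm c0) ler_wpM2l//.
  by apply: le_trans (FB (-1 *: x)); exact: normc_ge_absIm.
Qed.

(** The multiplication formula with [s = -1], for [F] and the transform of [psi], moves the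
    transform onto [fourier psi]; inversion for [psi] then recovers [psi]. *)
Lemma is_fourier_inverse F : cdecay F -> is_fourier (inverse_fourier F) F.
Proof.
move=> dF psi spsi; have dpsi := schwartz_cdecay spsi.
have dfpsi := fourier_schwartz_cdecay spsi.
have [M2 h2] := cdecay_bounded dpsi; have [B FB] := fourier_bounded dF.
have [mpsi _] := dpsi; have [sr si] := inverse_fourier_slowly_increasing dF.
have mu' : cmeasurable (inverse_fourier F).
  by split; apply: continuous_rV_measurable; [case: sr|case: si].
have mFo : cmeasurable (fun x => fourier F (-1 *: x)).
  apply: cmeasurable_comp (cmeasurable_fourier dF) _.
  have := measurable_rV_affine (-1) (0 : 'rV[R]_d).
  by apply: eq_measurable_fun => z _ /=; rewrite addr0.
have iFo : cintegrable lam setT (fun x => fourier F (-1 *: x) * fourier psi x).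
  exact: cintegrable_cdecay (cdecayM dfpsi mFo (fun x => FB _)).
split.
- apply: cintegrable_cdecay.
  apply: (cdecayM (M := ((2 * pi) ^+ d)^-1 * B) dfpsi mu') => x.
  rewrite inverse_fourierE normcM normc_real ger0_norm ?ler_wpM2l//.
    by rewrite invr_ge0 exprn_ge0// mulr_ge0// pi_ge0.
  by rewrite invr_ge0 exprn_ge0// mulr_ge0// pi_ge0.
- exact: cintegrableM dF mpsi h2.
transitivity ((((2 * pi) ^+ d)^-1)%:C * cintegral lam setT (fun x => fourier F (-1 *: x) * fourier psi x)).
  by rewrite -cintegralZl//; apply: eq_cintegral => x; rewrite inverse_fourierE mulrA.
rewrite -(multiplication_formula (-1) dF dfpsi) -cintegralZl.
  apply: eq_cintegral => xi; rewrite (schwartz_inversion spsi xi) inverse_fourierE.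
  by rewrite mulrCA.
have [B' FB'] := fourier_bounded dfpsi.
apply: (cintegrableM dF _ (fun x => FB' _)).
apply: cmeasurable_comp (cmeasurable_fourier dfpsi) _.
have := measurable_rV_affine (-1) (0 : 'rV[R]_d).
by apply: eq_measurable_fun => z _ /=; rewrite addr0.
Qed.

End inversion.

(** * The Cauchy problem *)

Section singular_ivp.
Context (R : realType).

(** The coefficients are real, so [singular_ode_zero] applies separately to the differences of the
    real and of the imaginary parts. *)
Lemma singular_ivp_unique (m K : R) (y0 : R[i]) (y y' : R -> R[i]) : 0 <= m -> 0 <= K ->
  is_singular_ivp_solution (fun t => m / t) K y0 y ->
  is_singular_ivp_solution (fun t => m / t) K y0 y' ->
  forall t, 0 < t -> y t = y' t.
Proof.
move=> m0 K0 [ode y00 r1 i1] [ode' y00' r1' i1'] t t0.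
have part (z z' : R -> R) :
    (forall t : R, 0 < t -> [/\ derivable z t 1, derivable (derive1 z) t 1 &
      derive1 (derive1 z) t + m / t * derive1 z t = - K * z t]) ->
    (forall t : R, 0 < t -> [/\ derivable z' t 1, derivable (derive1 z') t 1 &
      derive1 (derive1 z') t + m / t * derive1 z' t = - K * z' t]) ->
    z 0 = z' 0 -> right_derivative0 z 0 -> right_derivative0 z' 0 -> z t = z' t.
  move=> hz hz' z00 rz rz'; apply/eqP; rewrite -subr_eq0; apply/eqP.
  apply: (@singular_ode_zero _ m K (fun t => z t - z' t)
    (fun t => derive1 z t - derive1 z' t)) => //.
  - move=> s s0; have [d1 _ _] := hz s s0; have [d2 _ _] := hz' s s0.
    by rewrite !derive1E; exact: (is_deriveB (derivableP d1) (derivableP d2)).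
  - move=> s s0; have [_ d1 e1] := hz s s0; have [_ d2 e2] := hz' s s0.
    have := is_deriveB (derivableP d1) (derivableP d2).
    move=> dd; apply: (is_derive_eq dd); rewrite -!derive1E.
    have {}e1 : derive1 (derive1 z) s = - K * z s - m / s * derive1 z s by rewrite -e1 addrK.
    have {}e2 : derive1 (derive1 z') s = - K * z' s - m / s * derive1 z' s.
      by rewrite -e2 addrK.
    by rewrite e1 e2; ring.
  - by rewrite z00 subrr.
  - rewrite /right_derivative0.
    rewrite (_ : (fun h => _) = (fun h => h^-1 * (z h - z 0)) \- (fun h => h^-1 * (z' h - z' 0))).
      by rewrite -[X in _ --> X](subrr (0 : R)); exact: cvgB.
    by apply/funext => h /=; ring.
have ode_re (w : R -> R[i]) : (forall t : R, 0 < t ->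
        [/\ cderivable w t, cderivable (cderive w) t &
            cderive (cderive w) t + (m / t)%:C * cderive w t = - K%:C * w t]) ->
    (forall t : R, 0 < t -> let z := fun t => Re (w t) in
      [/\ derivable z t 1, derivable (derive1 z) t 1 &
      derive1 (derive1 z) t + m / t * derive1 z t = - K * z t]) /\
    (forall t : R, 0 < t -> let z := fun t => Im (w t) in
      [/\ derivable z t 1, derivable (derive1 z) t 1 &
      derive1 (derive1 z) t + m / t * derive1 z t = - K * z t]).
  move=> h; split=> s s0 z; have [[d1 d2] [e1 e2] E] := h s s0.
    split; [exact: d1|exact: e1|].
    by move: E => /(congr1 (@complex.Re R)); rewrite -rmorphN Re_realM => <-; rewrite ReD Re_realM.
  split; [exact: d2|exact: e2|].
  by move: E => /(congr1 (@complex.Im R)); rewrite -rmorphN Im_realM => <-; rewrite ImD Im_realM.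
have [h1 h2] := ode_re _ ode; have [h1' h2'] := ode_re _ ode'.
apply: complex_eq.
- by apply: (part _ _ h1 h1') => //; rewrite y00 y00'.
- by apply: (part _ _ h2 h2') => //; rewrite y00 y00'.
Qed.

End singular_ivp.

Lemma is_derive_right_derivative0 (R : realType) (f : R -> R) (l : R) :
  is_derive (0 : R) 1 f l -> right_derivative0 f l.
Proof.
move=> [df <-].
have h : h^-1 *: ((f \o shift 0) (h *: 1) - f 0) @[h --> 0^'] --> 'D_1 f 0 by exact: df.
have := cvg_dnbhs_at_right h; rewrite (eq_cvg _ _ (g := fun h => h^-1 * (f h - f 0)))//.
by move=> x; rewrite /= /GRing.scale/= mulr1 addr0.
Qed.

(** * The solution on the Fourier side *)

Section bessel.
Context (R : realType) (d : nat) (gamma c : R).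
Hypotheses (d_ge1 : (1 <= d)%N) (gamma_gt0 : 0 < gamma) (c_gt0 : 0 < c).
Notation mu := (@lebesgue_measure R).

Let m : R := d%:R / 2 + gamma - 2^-1.
Let m0 : 0 < m. Proof. exact: epd_exponent_gt0. Qed.
Notation k := (semicircle_weight m).
Notation J := (weighted_average m).
Notation A := (epd_const d gamma).

(** By Poisson's integral this is the Bessel function of the first kind of order [m - 1/2] at
    [z = a t], multiplied by [Gamma (m + 1/2) (2 / z)^(m - 1/2)] so as to equal 1 at 0. *)
Definition epd_multiplier (a t : R) : R := A * J 0 a cos t.
Notation H := epd_multiplier.

Let cos1 (s : R) : `|cos s| <= 1. Proof. by rewrite ler_norml cos_geN1 cos_le1. Qed.
Let sin1 (s : R) : `|- sin s| <= 1. Proof. by rewrite normrN ler_norml sin_geN1 sin_le1. Qed.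
Let Ncos1 (s : R) : `|- cos s| <= 1. Proof. by rewrite normrN. Qed.

Let dcos (s : R) : is_derive s 1 (@cos R) (- sin s). Proof. exact: is_derive_cos. Qed.
Let dNsin (s : R) : is_derive s 1 (fun s : R => - sin s) (- cos s).
Proof. exact: is_deriveN. Qed.
Let cNcos : continuous (fun s : R => - cos s).
Proof. by move=> s; apply: cvgN; exact: continuous_cos. Qed.

Let EPD a := average_epd m0 a dcos dNsin cNcos cos1 sin1 Ncos1.

Lemma epd_multiplier0 a : H a 0 = 1.
Proof.
rewrite -(epd_const_average d_ge1 gamma_gt0 a 0) /H; congr (_ * _).
by apply: eq_Rintegral => s _; rewrite mulr0 mul0r cos0.
Qed.

Lemma epd_const_ge0 : 0 <= A.
Proof.
rewrite /epd_const divr_ge0//.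
  by apply: ltW; apply: Gamma_gt0; rewrite addr_gt0.
by rewrite mulr_ge0 ?sqrtr_ge0// ltW// Gamma_gt0.
Qed.

Lemma epd_multiplier_bounded a t : `|H a t| <= 1.
Proof.
rewrite -(epd_const_average d_ge1 gamma_gt0 a t) /H normrM (ger0_norm epd_const_ge0).
rewrite ler_wpM2l ?epd_const_ge0//.
have i1 := integrable_average m0 0 a t (@continuous_cos R) cos1.
have i2 : mu.-integrable setT (EFin \o (fun s => k s * s ^+ 0 * (cst 1 : R -> R) (a * t * s))).
  apply: (@integrable_average _ _ m0 0 a (cst 1) t 1) => x; last by rewrite normr1.
  exact: cst_continuous.
apply: le_trans (le_normr_Rintegral measurableT i1) _.
apply: le_Rintegral => //; first exact: integrable_norm.
move=> s _; rewrite expr0 !mulr1 normrM (ger0_norm (semicircle_weight_ge0 m s)).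
by rewrite ler_piMr// semicircle_weight_ge0.
Qed.

Let dH a (t : R) : is_derive t 1 (H a) (A * (a * J 1 a (fun s => - sin s) t)).
Proof. by have [d1 _ _ _] := EPD a t; exact: (is_deriveZ A d1). Qed.

Lemma epd_multiplier_continuous : continuous (H 1).
Proof. by move=> t; exact: is_derive1_continuous (dH 1 t). Qed.

(** Measurability in the frequency, which enters through [a], reduces to the continuity of the
    single function [H 1]. *)
Lemma epd_multiplierE a t : H a t = H 1 (a * t).
Proof. by rewrite /H /weighted_average mul1r. Qed.

Lemma epd_multiplier_ivp a (y0 : R[i]) :
  is_singular_ivp_solution (fun t => (2 * m) / t) (a ^+ 2) y0 (fun t => (H a t)%:C * y0).
Proof.
have d1 t : derive1 (H a) t = A * (a * J 1 a (fun s => - sin s) t).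
  by rewrite derive1E; apply: derive_val; exact: dH.
have dd (t : R) : is_derive t 1 (derive1 (H a)) (A * (a ^+ 2 * J 2 a (fun s => - cos s) t)).
  rewrite (_ : derive1 (H a) = (fun t => A * (a * J 1 a (fun s => - sin s) t))); last exact/funext.
  by have [_ d2 _ _] := EPD a t; exact: (is_deriveZ A d2).
have ReE t : Re ((H a t)%:C * y0) = H a t * Re y0 by rewrite Re_realM.
have ImE t : Im ((H a t)%:C * y0) = H a t * Im y0 by rewrite Im_realM.
have dc (f f' : R -> R) (r t : R) : is_derive t 1 f (f' t) ->
    is_derive t 1 (fun t => f t * r) (f' t * r).
  move=> df; have dm := is_deriveM df (is_derive_cst r t 1).
  by apply: (is_derive_eq dm); rewrite /GRing.scale/= mulr0 add0r mulrC.
have dH' r (t : R) : is_derive t 1 (fun t => H a t * r) (derive1 (H a) t * r).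
  by apply: dc; rewrite d1.
have d1r r : derive1 (fun t => H a t * r) = (fun t => derive1 (H a) t * r).
  by apply/funext => t; rewrite derive1E; apply: derive_val; exact: dH'.
have ddr r (t : R) : is_derive t 1 (fun t => derive1 (H a) t * r)
    (A * (a ^+ 2 * J 2 a (fun s => - cos s) t) * r) by exact: (dc _ (fun t => A * (a ^+ 2 * J 2 a (fun s => - cos s) t))).
have d2r r : derive1 (fun t => derive1 (H a) t * r) =
    (fun t => A * (a ^+ 2 * J 2 a (fun s => - cos s) t) * r).
  by apply/funext => t; rewrite derive1E; apply: derive_val; exact: ddr.
have cdE : cderive (fun t => (H a t)%:C * y0) = (fun t => (derive1 (H a) t)%:C * y0).
  apply/funext => t; apply: complex_eq; rewrite /cderive ?Re_realM ?Im_realM/=.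
    by rewrite (_ : (fun x => _) = (fun t => H a t * Re y0)) ?d1r//; exact/funext.
  by rewrite (_ : (fun x => _) = (fun t => H a t * Im y0)) ?d1r//; exact/funext.
have reE (h : R -> R) : (fun t => Re ((h t)%:C * y0)) = (fun t => h t * Re y0).
  by apply/funext => t; rewrite Re_realM.
have imE (h : R -> R) : (fun t => Im ((h t)%:C * y0)) = (fun t => h t * Im y0).
  by apply/funext => t; rewrite Im_realM.
(* For [f = cos] the second derivative is [- cos], so the right side of the averaged equation is
   [- a^2] times the average itself. *)
have ode t : 0 < t -> A * (a ^+ 2 * J 2 a (fun s => - cos s) t) + 2 * m / t * derive1 (H a) t =
    - a ^+ 2 * H a t.
  move=> t0; have [_ _ _ /(_ (lt0r_neq0 t0)) E] := EPD a t.
  rewrite d1 /H; have -> : J 0 a cos t = - J 0 a (fun s => - cos s) t.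
    rewrite /weighted_average -mulN1r -RintegralZl//.
      by apply: eq_Rintegral => s _; ring.
    exact: integrable_average cNcos Ncos1.
  have -> : - a ^+ 2 * (A * - J 0 a (fun s => - cos s) t) =
    A * (a ^+ 2 * J 0 a (fun s => - cos s) t) by ring.
  by rewrite -E; ring.
split.
- move=> t t0; split.
  + by split; rewrite ?reE ?imE; [have [] := dH' (Re y0) t|have [] := dH' (Im y0) t].
  + by rewrite cdE; split; rewrite ?reE ?imE; [have [] := ddr (Re y0) t|have [] := ddr (Im y0) t].
  + rewrite cdE; have -> : - (a ^+ 2)%:C * ((H a t)%:C * y0) = (- a ^+ 2 * H a t)%:C * y0.
      by rewrite mulrA -rmorphN -rmorphM.
    have -> : cderive (fun t => (derive1 (H a) t)%:C * y0) t =
        (A * (a ^+ 2 * J 2 a (fun s => - cos s) t))%:C * y0.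
      by apply: complex_eq; rewrite /cderive ?Re_realM ?Im_realM/= ?reE ?imE d2r.
    rewrite -ode//; set D := derive1 _ _; set X := A * _.
    by rewrite [_%:C * (_%:C * _)]mulrA -rmorphM -mulrDl -rmorphD.
- by rewrite epd_multiplier0 mul1r.
(* The averages are defined and differentiable for all real [t], so the one-sided derivative at 0
   comes from a two-sided one. *)
- rewrite reE; apply: is_derive_right_derivative0; apply: (is_derive_eq (dH' _ 0)).
  by have [_ _ J0 _] := EPD a 0; rewrite d1 J0 !(mulr0, mul0r).
- rewrite imE; apply: is_derive_right_derivative0; apply: (is_derive_eq (dH' _ 0)).
  by have [_ _ J0 _] := EPD a 0; rewrite d1 J0 !(mulr0, mul0r).
Qed.

End bessel.

(** * Existence, uniqueness and the integral formula *)

Section cauchy_problem.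
Context (R : realType) (d : nat) (gamma c nu : R) (phi : 'rV[R]_d -> R[i]).
Hypotheses (d_ge1 : (1 <= d)%N) (gamma_gt0 : 0 < gamma) (c_gt0 : 0 < c).
Hypothesis phi_schwartz : schwartz phi.
Notation mu := (@lebesgue_measure R).
Notation lam := (lebesgue_rV R d).
Implicit Types (x xi : 'rV[R]_d) (t w : R).

Let b xi : R := enorm xi `^ (nu / 2).
Let g t w : R := epd_kernel d gamma c w t.
Notation H := (epd_multiplier d gamma).

Definition epd_transform xi t : R[i] := (H (c * b xi) t)%:C * fourier phi xi.

Let measurable_b : measurable_fun setT b.
Proof. exact: measurableT_comp (measurable_powR _) (@measurable_enorm R d). Qed.

Lemma cdecay_epd_transform t : cdecay (epd_transform ^~ t).
Proof.
apply: (cdecayM (M := 1)).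
- exact: fourier_schwartz_cdecay.
- apply: cmeasurable_real; under eq_fun do rewrite epd_multiplierE.
  apply: measurableT_comp.
    exact: continuous_measurable_fun (epd_multiplier_continuous d_ge1 gamma_gt0).
  by apply: measurable_funM => //; exact: measurable_funM.
- by move=> xi; rewrite normc_real; exact: epd_multiplier_bounded.
Qed.

Let g_ge0 t w : 0 < t -> 0 <= g t w.
Proof.
move=> t0; rewrite /g epd_kernelE// mulr_ge0 ?semicircle_weight_ge0//.
by rewrite divr_ge0 ?epd_const_ge0// mulr_ge0 ?(ltW t0) ?(ltW c_gt0).
Qed.

Let g_out t w : 0 < t -> ~ `[- (c * t), c * t]%classic w -> g t w = 0.
Proof.
move=> t0; rewrite /= in_itv/= -ler_norml => /negP; rewrite -ltNge => h.
have ct0 : 0 < c * t by rewrite mulr_gt0.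
rewrite /g epd_kernelE// semicircle_weight_out ?mulr0// addr0 normrM normfV.
by rewrite (gtr0_norm ct0) mulrC ler_pdivlMr// mul1r ltW.
Qed.

(** Adding the two opposite phases gives [cis y + cis (- y) = 2 cos y], the cosine that the kernel
    averages into the multiplier. *)
Let half_sum x w : (p1 nu phi x w + p2 nu phi x w) / 2%:R =
  (((2 * pi) ^+ d)^-1)%:C * cintegral lam setT
    (fun xi => (cos (b xi * w))%:C * (cis (- dotr xi x) * fourier phi xi)).
Proof.
have dE : cdecay (fun xi => cis (- dotr xi x) * fourier phi xi).
  apply: (cdecayM (M := 1)); first exact: fourier_schwartz_cdecay.
    apply: cmeasurable_cis; apply: measurableT_comp => //.
    exact: measurable_dotr.
  by move=> xi; rewrite normc_cis.
have ic (e : 'rV[R]_d -> R) : measurable_fun setT e -> cintegrable lam setT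
    (fun xi => cis (- dotr xi x) * cis (e xi) * fourier phi xi).
  move=> me; rewrite (_ : (fun xi => _) =
      (fun xi => cis (e xi) * (cis (- dotr xi x) * fourier phi xi))).
    apply: cintegrable_cdecay; apply: (cdecayM (M := 1)) => //.
      exact: cmeasurable_cis.
    by move=> xi; rewrite normc_cis.
  by apply/funext => xi; rewrite mulrCA mulrA.
have mbw : measurable_fun setT (fun xi => b xi * w) by exact: measurable_funM.
have i1 := ic _ mbw; have i2 := ic _ (measurableT_comp (@oppr_measurable R setT) mbw).
have i3 : cintegrable lam setT
    (fun xi => (cos (b xi * w))%:C * (cis (- dotr xi x) * fourier phi xi)).
  apply: cintegrable_cdecay; apply: (cdecayM (M := 1)) => //.
    apply: cmeasurable_real.
    exact: measurableT_comp (continuous_measurable_fun (@continuous_cos R)) mbw.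
  by move=> xi; rewrite normc_real ler_norml cos_geN1 cos_le1.
have cos2 y : cis y + cis (- y) = 2%:R * (cos y)%:C :> R[i].
  apply: complex_eq; first by rewrite ReD ReM/= cosN; ring.
  by rewrite ImD ImM/= sinN; ring.
rewrite /p1 /p2 -mulrDr -cintegralD// -mulrA; congr (_ * _).
rewrite (eq_cintegral _ (g := fun xi => 2%:R *
    ((cos (b xi * w))%:C * (cis (- dotr xi x) * fourier phi xi)))).
  by rewrite cintegralZl// mulrAC divff ?mul1r// pnatr_eq0.
by move=> xi; rewrite -/(b xi) -mulrDl -mulrDr cos2; ring.
Qed.

Let average_cos xi t : 0 < t ->
  \int[mu]_w (g t w * cos (b xi * w)) = H (c * b xi) t.
Proof.
move=> t0; rewrite (epd_kernel_pairing d_ge1 gamma_gt0 c_gt0 t0 (M := 1) (f := fun w => cos (b xi * w))).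
- by congr (_ * _); apply: eq_Rintegral => s _; congr (_ * cos _); ring.
- move=> w; apply: continuous_comp; last exact: continuous_cos.
  by apply: continuousM => //; exact: cst_continuous.
- by move=> w; rewrite ler_norml cos_geN1 cos_le1.
Qed.

Lemma inverse_fourier_epd_transform x t : 0 < t ->
  inverse_fourier (epd_transform ^~ t) x = cintegral mu `[- (c * t), c * t]
    (fun w => (epd_kernel d gamma c w t)%:C * ((p1 nu phi x w + p2 nu phi x w) / 2%:R)).
Proof.
move=> t0; rewrite cintegral_out; last by move=> w /(g_out t0); rewrite /g => ->; rewrite mul0r.
set c0 := ((2 * pi) ^+ d)^-1 : R.
have c00 : 0 <= c0 by rewrite invr_ge0 exprn_ge0// mulr_ge0// pi_ge0.
pose E xi := cis (- dotr xi x) * fourier phi xi.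
have dE : cdecay E.
  apply: (cdecayM (M := 1)); first exact: fourier_schwartz_cdecay.
    apply: cmeasurable_cis; apply: measurableT_comp => //.
    exact: measurable_dotr.
  by move=> xi; rewrite normc_cis.
have [C C0 EC] := cdecay_dominated dE; have [mE _] := dE.
have gi := integrable_epd_kernel d_ge1 gamma_gt0 c_gt0 t0.
have /measurable_EFinP mg := measurable_int _ gi.
pose f (z : measurableTypeR R * 'rV[R]_d) : R[i] :=
  (g t z.1 * c0 * cos (b z.2 * z.1))%:C * E z.2.
have mcos : measurable_fun setT (fun z : measurableTypeR R * 'rV[R]_d => cos (b z.2 * z.1)).
  apply: measurableT_comp; first exact: continuous_measurable_fun (@continuous_cos R).
  by apply: measurable_funM => //; exact: measurableT_comp measurable_b measurable_snd.
have mf : cmeasurable f.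
  apply: cmeasurableM; last exact: cmeasurable_comp mE measurable_snd.
  apply: cmeasurable_real; apply: measurable_funM => //; apply: measurable_funM => //.
  exact: measurableT_comp mg measurable_fst.
have fE w xi : f (w, xi) = (g t w * c0 * cos (b xi * w))%:C * E xi by [].
have fub : cintegral mu setT (fun w => cintegral lam setT (fun xi => f (w, xi))) =
    cintegral lam setT (fun xi => cintegral mu setT (fun w => f (w, xi))).
  (* Since [|cos| <= 1], the integrand is dominated by the kernel, integrable in [w], times a
     multiple of [decay xi]. *)
  apply: (@cfubini _ _ (measurableTypeR R) 'rV[R]_d R (@lebesgue_measure R) lam f (g t) (fun xi => c0 * (C * decay xi)) mf).
  - move=> w xi; rewrite fE; move: (g t w) (g_ge0 w t0) => G G0.
    rewrite normcM normc_real !normrM (ger0_norm G0) (ger0_norm c00) -!mulrA.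
    rewrite ler_wpM2l// ler_wpM2l//.
    apply: le_trans (EC xi); rewrite ler_piMl ?normc_ge0//.
    by rewrite ler_norml cos_geN1 cos_le1.
  - by move=> w; exact: g_ge0.
  - by move=> xi; rewrite !mulr_ge0// ltW// decay_gt0.
  - exact: gi.
  - by apply: integrableZl_real => //; exact: integrable_Zdecay.
have -> : cintegral mu setT (fun w => (epd_kernel d gamma c w t)%:C *
      ((p1 nu phi x w + p2 nu phi x w) / 2%:R)) =
    cintegral mu setT (fun w => cintegral lam setT (fun xi => f (w, xi))).
  apply: eq_cintegral => w; rewrite half_sum -/c0 mulrA -rmorphM -cintegralZl.
    by apply: eq_cintegral => xi; rewrite fE [in RHS]rmorphM mulrA.
  apply: cintegrable_cdecay; apply: (cdecayM (M := 1)) => //.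
    apply: cmeasurable_real; apply: measurableT_comp; first exact: continuous_measurable_fun (@continuous_cos R).
    exact: measurable_funM.
  by move=> xi; rewrite normc_real ler_norml cos_geN1 cos_le1.
rewrite fub /inverse_fourier -cintegralZl.
  apply: eq_cintegral => xi; under eq_cintegral do rewrite fE.
  transitivity (cintegral mu setT (fun w => (g t w * cos (b xi * w))%:C * (c0%:C * E xi))).
    rewrite cintegralZr.
      by rewrite cintegral_real average_cos// /epd_transform /E -/c0; ring.
    apply: cintegrable_dominated gi.
      apply: cmeasurable_real; apply: measurable_funM => //.
      apply: measurableT_comp; first exact: continuous_measurable_fun (@continuous_cos R).
      exact: (measurable_funM (measurable_cst (b xi))).
    move=> w; rewrite normc_real normrM ger0_norm ?g_ge0//.
    by rewrite ler_piMr ?g_ge0// ler_norml cos_geN1 cos_le1.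
  apply: eq_cintegral => w; rewrite mulrA -rmorphM; congr (_%:C * _); ring.
apply: cintegrable_cdecay; apply: (cdecayM (M := 1)) => //.
- exact: cdecay_epd_transform.
- by apply: cmeasurable_cis; apply: measurableT_comp => //; exact: measurable_dotr.
- by move=> xi; rewrite normc_cis.
Qed.

Lemma epd_transform_ivp xi : is_singular_ivp_solution
  (fun t => (d%:R + 2 * gamma - 1) / t) (c ^+ 2 * enorm xi `^ nu) (fourier phi xi)
  (epd_transform xi).
Proof.
have -> : c ^+ 2 * enorm xi `^ nu = (c * b xi) ^+ 2.
  by rewrite exprMn; congr (_ * _); rewrite /b -powR_mulrn ?powR_ge0// -powRrM divfK.
rewrite (_ : (fun t => _) = (fun t => (2 * (d%:R / 2 + gamma - 2^-1)) / t)).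
  exact: (epd_multiplier_ivp d_ge1 gamma_gt0).
by apply/funext => t; congr (_ / _); field.
Qed.

(** At [t = 0] the multiplier is 1, so the initial condition is the inversion formula for [phi]; at
    other times the decay of [epd_transform] gives growth and transform of the candidate. *)
Lemma cauchy_solution_exists :
  is_cauchy_solution gamma c nu phi (fun x t => inverse_fourier (epd_transform ^~ t) x).
Proof.
split.
- move=> x; rewrite [RHS](schwartz_inversion phi_schwartz); congr (inverse_fourier _ x).
  by apply/funext => xi; rewrite /epd_transform epd_multiplier0// mul1r.
- by move=> t _; exact: inverse_fourier_slowly_increasing (cdecay_epd_transform t).
- exists epd_transform; split; last exact: epd_transform_ivp.
  by move=> t _; exact: is_fourier_inverse (cdecay_epd_transform t).
Qed.

(** Nothing is assumed about the decay of [uhat]. Uniqueness of the initial value problem at each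
    frequency identifies it with [epd_transform], whose decay is what [fourier_inversion]
    requires. *)
Lemma cauchy_solution_unique u : is_cauchy_solution gamma c nu phi u ->
  forall x t, 0 < t -> u x t = inverse_fourier (epd_transform ^~ t) x.
Proof.
move=> [_ us [uhat [uF uivp]]] x t t0.
have m0 : 0 <= d%:R + 2 * gamma - 1.
  have := epd_exponent_gt0 d_ge1 gamma_gt0; lra.
have K0 xi : 0 <= c ^+ 2 * enorm xi `^ nu by rewrite mulr_ge0 ?sqr_ge0 ?powR_ge0.
have E : uhat ^~ t = epd_transform ^~ t.
  apply/funext => xi.
  exact: (singular_ivp_unique m0 (K0 xi) (uivp xi) (epd_transform_ivp xi)).
apply: (fourier_inversion (us t (ltW t0)) (cdecay_epd_transform t)).
by rewrite -E; exact: uF (ltW t0).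
Qed.

End cauchy_problem.

Theorem corollary5 (R : realType) (d : nat) (gamma c nu : R)
    (phi : 'rV[R]_d -> R[i])
    (d_ge1 : (1 <= d)%N) (gamma_gt0 : 0 < gamma) (c_gt0 : 0 < c)
    (nu_gt0 : 0 < nu) (nu_lt2 : nu < 2) (phi_schwartz : schwartz phi) :
  [/\ exists u : 'rV[R]_d -> R -> R[i], is_cauchy_solution gamma c nu phi u,
      forall u : 'rV[R]_d -> R -> R[i], is_cauchy_solution gamma c nu phi u ->
        forall (x : 'rV[R]_d) (t : R), 0 < t ->
          u x t = cintegral (@lebesgue_measure R) `[- (c * t), c * t]
            (fun w => (epd_kernel d gamma c w t)%:C *
                      ((p1 nu phi x w + p2 nu phi x w) / 2%:R)) &
      is_fundamental_solution c (fun t => (gamma + d%:R / 2 - 2^-1) / t)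
        (epd_kernel d gamma c)].
Proof.
split.
- by eexists; exact: (cauchy_solution_exists c nu d_ge1 gamma_gt0 phi_schwartz).
- move=> u hu x t t0.
  rewrite (cauchy_solution_unique d_ge1 gamma_gt0 phi_schwartz hu x t0).
  exact: inverse_fourier_epd_transform.
- exact: epd_kernel_fundamental.
Qed.
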